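(* Let $\zeta\in\mathbb C\setminus\{0,-1\}$ and $\mathfrak g=D(2|1;\zeta)$. Let $\lambda\in\mathfrak h^*$ and let $\gamma\in\Phi^+_{\bar 0}$ be a positive even root. Suppose that $\langle\lambda,h_\gamma\rangle=n\in\mathbb N=\{0,1,2,\dots\}$. Then there is a nonzero singular vector in the Verma module $M_\lambda$ of weight $\lambda-\rho-n\gamma$, and hence $\mathrm{Hom}_{\mathfrak g}(M_{s_\gamma\lambda},M_\lambda)\neq 0$. In particular, $[M_\lambda:L_{s_\gamma\lambda}]>0$.
   Context: $\mathfrak g=D(2|1;\zeta)$ is the $17$-dimensional simple Lie superalgebra of basic type with Cartan matrix $\begin{pmatrix}0&1&\zeta\\-1&2&0\\-1&0&2\end{pmatrix}$, whose first simple root is odd and whose other two simple roots are even. Its Cartan subalgebra $\mathfrak h$ has basis $h_{2\delta},h_{2\epsilon_1},h_{2\epsilon_2}$ (the coroots of the even roots $2\delta,2\epsilon_1,2\epsilon_2$) with dual basis $\delta,\epsilon_1,\epsilon_2$ of $\mathfrak h^*$. The simple roots are $\alpha_0=\delta-\epsilon_1-\epsilon_2$ (odd), $\alpha_1=2\epsilon_1$, $\alpha_2=2\epsilon_2$; the positive even roots are $\Phi^+_{\bar 0}=\{2\delta,2\epsilon_1,2\epsilon_2\}$ and the positive odd roots are $\{\delta\pm\epsilon_1\pm\epsilon_2\}$ (all four sign choices). For $\gamma\in\Phi^+_{\bar 0}$ the reflection $s_\gamma$ is $s_\gamma\nu=\nu-\langle\nu,h_\gamma\rangle\gamma$ for $\nu\in\mathfrak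 h^*$. $\mathfrak n_\pm$ is the sum of the positive/negative root spaces, and $\rho=-\delta+\epsilon_1+\epsilon_2$. For $\lambda\in\mathfrak h^*$, $M_\lambda=U(\mathfrak g)\otimes_{U(\mathfrak h+\mathfrak n_+)}\mathbb C_{\lambda-\rho}$ is the Verma module of highest weight $\lambda-\rho$ (note the $\rho$-shift), and $L_\lambda$ is its unique irreducible quotient. A singular vector is a weight vector annihilated by $\mathfrak n_+$. Modules are $U(\mathfrak g)$-modules, homomorphisms are $U(\mathfrak g)$-linear maps, and $[M:L]$ denotes composition multiplicity. *)

(* Defs.v *)
From HB Require Import structures.
From mathcomp Require Import all_boot all_order all_algebra generic_quotient ring_quotient.
From mathcomp Require Import boolp ring.

Set Implicit Arguments.
Unset Strict Implicit.
Unset Printing Implicit Defensive.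

Import Order.TTheory GRing.Theory Num.Theory.

Local Open Scope ring_scope.
Local Open Scope quotient_scope.

(* [lsa_part false] is the even part, [lsa_part true] the odd part. *)
Record lieSuperalg (K : fieldType) := LieSuperalg {
  lsa_car :> vectType K;
  lsa_part : bool -> {vspace lsa_car};
  lsa_br : lsa_car -> lsa_car -> lsa_car;
  lsa_full : (lsa_part false + lsa_part true)%VS = fullv;
  lsa_direct : (lsa_part false :&: lsa_part true)%VS = 0%VS;
  lsa_br_linl : forall y, linear (lsa_br ^~ y);
  lsa_br_linr : forall x, linear (lsa_br x);
  lsa_br_part : forall (a b : bool) x y,
    x \in lsa_part a -> y \in lsa_part b -> lsa_br x y \in lsa_part (a (+) b);
  lsa_br_skew : forall (a b : bool) x y,
    x \in lsa_part a -> y \in lsa_part b ->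
    lsa_br x y = - ((-1) ^+ (a && b) *: lsa_br y x);
  lsa_br_jacobi : forall (a b : bool) x y z,
    x \in lsa_part a -> y \in lsa_part b ->
    lsa_br x (lsa_br y z) =
      lsa_br (lsa_br x y) z + (-1) ^+ (a && b) *: lsa_br y (lsa_br x z)
}.

Record subSuperalg (K : fieldType) (g : lieSuperalg K) := SubSuperalg {
  ssa_space :> {vspace g};
  ssa_br : forall x y, x \in ssa_space -> y \in ssa_space ->
    lsa_br x y \in ssa_space;
  ssa_graded : (ssa_space <= (ssa_space :&: lsa_part g false)
                           + (ssa_space :&: lsa_part g true))%VS
}.

Section SubLie.
Variables (K : fieldType) (g : lieSuperalg K) (b : subSuperalg g).

Definition sub_part (a : bool) : {vspace subvs_of b} :=
  (linfun vsval @^-1: lsa_part g a)%VS.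

Definition sub_br (x y : subvs_of b) : subvs_of b :=
  vsproj b (lsa_br (vsval x) (vsval y)).

Lemma sub_partE a x : (x \in sub_part a) = (vsval x \in lsa_part g a).
Proof. by rewrite -memv_preim lfunE. Qed.

Lemma sub_brE x y : vsval (sub_br x y) = lsa_br (vsval x) (vsval y).
Proof. by rewrite vsprojK // ssa_br ?subvsP. Qed.

Fact sub_full : (sub_part false + sub_part true)%VS = fullv.
Proof.
apply/vspaceP=> x; rewrite memvf; apply/memv_addP.
have /memv_addP[y + [z + xyz]] := subvP (ssa_graded b) _ (subvsP x).
rewrite !memv_cap => /andP[yb y0] /andP[zb z1].
exists (Subvs yb); first by rewrite sub_partE.
exists (Subvs zb); first by rewrite sub_partE.
by apply: val_inj; rewrite /= xyz.
Qed.

Fact sub_direct : (sub_part false :&: sub_part true)%VS = 0%VS.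
Proof.
apply/eqP; rewrite -subv0; apply/subvP=> x.
rewrite memv_cap !sub_partE -memv_cap lsa_direct !memv0 => /eqP x0.
by apply/eqP/val_inj.
Qed.

Fact sub_br_linl y : linear (sub_br ^~ y).
Proof.
move=> c x x'; apply: subvs_inj.
by rewrite linearP /= !sub_brE linearP; apply: lsa_br_linl.
Qed.

Fact sub_br_linr x : linear (sub_br x).
Proof.
move=> c y y'; apply: subvs_inj.
by rewrite linearP /= !sub_brE linearP; apply: lsa_br_linr.
Qed.

Fact sub_br_part a a' x y : x \in sub_part a -> y \in sub_part a' ->
  sub_br x y \in sub_part (a (+) a').
Proof. by rewrite !sub_partE sub_brE; apply: lsa_br_part. Qed.

Fact sub_br_skew (a a' : bool) x y : x \in sub_part a -> y \in sub_part a' ->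
  sub_br x y = - ((-1) ^+ (a && a') *: sub_br y x).
Proof.
rewrite !sub_partE => xa ya; apply: subvs_inj.
by rewrite linearN linearZ /= !sub_brE scalerN; apply: lsa_br_skew.
Qed.

Fact sub_br_jacobi (a a' : bool) x y z :
  x \in sub_part a -> y \in sub_part a' ->
  sub_br x (sub_br y z) =
    sub_br (sub_br x y) z + (-1) ^+ (a && a') *: sub_br y (sub_br x z).
Proof.
rewrite !sub_partE => xa ya; apply: subvs_inj.
by rewrite linearD linearZ /= !sub_brE; apply: lsa_br_jacobi.
Qed.

Definition subLie : lieSuperalg K :=
  LieSuperalg sub_full sub_direct sub_br_linl sub_br_linr sub_br_part
    sub_br_skew sub_br_jacobi.

End SubLie.

(* U(g) is the unital associative K-algebra generated by the vector space g
   subject to xy - (-1)^{|x||y|} yx = [x,y] for homogeneous x, y: formal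
   noncommutative expressions modulo the congruence generated by the algebra
   axioms and these relations. *)
Section Enveloping.
Variables (K : fieldType) (g : lieSuperalg K).

Inductive uterm : Type :=
  | UGen of g
  | UConst of K
  | UAdd of uterm & uterm
  | UMul of uterm & uterm.

Inductive ueqv : uterm -> uterm -> Prop :=
  | ueqv_refl s : ueqv s s
  | ueqv_sym s t : ueqv s t -> ueqv t s
  | ueqv_trans s t u : ueqv s t -> ueqv t u -> ueqv s u
  | ueqv_add s s' t t' :
      ueqv s s' -> ueqv t t' -> ueqv (UAdd s t) (UAdd s' t')
  | ueqv_mul s s' t t' :
      ueqv s s' -> ueqv t t' -> ueqv (UMul s t) (UMul s' t')
  | ueqv_addA s t u : ueqv (UAdd s (UAdd t u)) (UAdd (UAdd s t) u)
  | ueqv_addC s t : ueqv (UAdd s t) (UAdd t s)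
  | ueqv_add0 s : ueqv (UAdd (UConst 0) s) s
  | ueqv_addN s : ueqv (UAdd (UMul (UConst (-1)) s) s) (UConst 0)
  | ueqv_mulA s t u : ueqv (UMul s (UMul t u)) (UMul (UMul s t) u)
  | ueqv_1mul s : ueqv (UMul (UConst 1) s) s
  | ueqv_mul1 s : ueqv (UMul s (UConst 1)) s
  | ueqv_mulDl s t u : ueqv (UMul (UAdd s t) u) (UAdd (UMul s u) (UMul t u))
  | ueqv_mulDr s t u : ueqv (UMul s (UAdd t u)) (UAdd (UMul s t) (UMul s u))
  | ueqv_constD c d : ueqv (UConst (c + d)) (UAdd (UConst c) (UConst d))
  | ueqv_constM c d : ueqv (UConst (c * d)) (UMul (UConst c) (UConst d))
  | ueqv_central c s : ueqv (UMul (UConst c) s) (UMul s (UConst c))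
  | ueqv_genD x y : ueqv (UGen (x + y)) (UAdd (UGen x) (UGen y))
  | ueqv_genZ c x : ueqv (UGen (c *: x)) (UMul (UConst c) (UGen x))
  | ueqv_br (a b : bool) x y : x \in lsa_part g a -> y \in lsa_part g b ->
      ueqv (UAdd (UMul (UGen x) (UGen y))
                 (UMul (UConst (- (-1) ^+ (a && b))) (UMul (UGen y) (UGen x))))
           (UGen (lsa_br x y)).

HB.instance Definition _ := gen_eqMixin uterm.
HB.instance Definition _ := gen_choiceMixin uterm.

Definition ueqvb : rel uterm := fun s t => `[< ueqv s t >].

Fact ueqvb_equiv : equiv_class_of ueqvb.
Proof.
split=> [s|s t|t s u]; first by apply/asboolP; exact: ueqv_refl.
  by apply/asboolP/asboolP; exact: ueqv_sym.
by move=> /asboolP st /asboolP tu; apply/asboolP; exact: ueqv_trans tu.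
Qed.

Canonical ueqvb_equivRel := EquivRelPack ueqvb_equiv.

Definition uenv : Type := {eq_quot ueqvb}.
HB.instance Definition _ := Choice.on uenv.
HB.instance Definition _ := EqQuotient.on uenv.

Definition uenv_pi (s : uterm) : uenv := \pi_uenv s.
Local Notation pi := uenv_pi.

Lemma upiP s t : pi s = pi t <-> ueqv s t.
Proof.
split=> [/eqmodP/asboolP//|st].
by apply/eqmodP/asboolP.
Qed.

Lemma ureprK (u : uenv) : pi (repr u) = u. Proof. exact: reprK. Qed.

Lemma urepr_pi s : ueqv (repr (pi s)) s.
Proof. by apply/upiP; rewrite ureprK. Qed.

Definition uenv_const (c : K) : uenv := pi (UConst c).
Definition uenv_gen (x : g) : uenv := pi (UGen x).
Definition uenv_add (u v : uenv) : uenv := pi (UAdd (repr u) (repr v)).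
Definition uenv_mul (u v : uenv) : uenv := pi (UMul (repr u) (repr v)).
Definition uenv_opp (u : uenv) : uenv := uenv_mul (uenv_const (-1)) u.
Definition uenv_scale (c : K) (u : uenv) : uenv := uenv_mul (uenv_const c) u.

Lemma upi_add s t : pi (UAdd s t) = uenv_add (pi s) (pi t).
Proof.
by apply/upiP; apply: ueqv_add; apply: ueqv_sym; apply: urepr_pi.
Qed.

Lemma upi_mul s t : pi (UMul s t) = uenv_mul (pi s) (pi t).
Proof.
by apply/upiP; apply: ueqv_mul; apply: ueqv_sym; apply: urepr_pi.
Qed.

Fact uenv_addA : associative uenv_add.
Proof.
move=> u v w; rewrite -[u]ureprK -[v]ureprK -[w]ureprK -!upi_add.
by apply/upiP/ueqv_addA.
Qed.
Fact uenv_addC : commutative uenv_add.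
Proof.
move=> u v; rewrite -[u]ureprK -[v]ureprK -!upi_add.
by apply/upiP/ueqv_addC.
Qed.
Fact uenv_add0 : left_id (uenv_const 0) uenv_add.
Proof.
by move=> u; rewrite -[u]ureprK -!upi_add; apply/upiP/ueqv_add0.
Qed.
Fact uenv_addN : left_inverse (uenv_const 0) uenv_opp uenv_add.
Proof.
move=> u; rewrite /uenv_opp -[u]ureprK -upi_mul -!upi_add.
by apply/upiP/ueqv_addN.
Qed.

HB.instance Definition _ :=
  GRing.isZmodule.Build uenv uenv_addA uenv_addC uenv_add0 uenv_addN.

Lemma upi_addr s t : pi (UAdd s t) = pi s + pi t.
Proof. exact: upi_add. Qed.

Lemma upi_oppr s : pi (UMul (UConst (-1)) s) = - pi s.
Proof. exact: upi_mul. Qed.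

Fact uenv_mulA : associative uenv_mul.
Proof.
move=> u v w; rewrite -[u]ureprK -[v]ureprK -[w]ureprK -!upi_mul.
by apply/upiP/ueqv_mulA.
Qed.
Fact uenv_1mul : left_id (uenv_const 1) uenv_mul.
Proof. by move=> u; rewrite -[u]ureprK -!upi_mul; apply/upiP/ueqv_1mul. Qed.
Fact uenv_mul1 : right_id (uenv_const 1) uenv_mul.
Proof. by move=> u; rewrite -[u]ureprK -!upi_mul; apply/upiP/ueqv_mul1. Qed.
Fact uenv_mulDl : left_distributive uenv_mul +%R.
Proof.
move=> u v w; rewrite -[u]ureprK -[v]ureprK -[w]ureprK.
by rewrite -upi_addr -!upi_mul -upi_addr; apply/upiP/ueqv_mulDl.
Qed.
Fact uenv_mulDr : right_distributive uenv_mul +%R.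
Proof.
move=> u v w; rewrite -[u]ureprK -[v]ureprK -[w]ureprK.
by rewrite -upi_addr -!upi_mul -upi_addr; apply/upiP/ueqv_mulDr.
Qed.

(* The augmentation U(g) -> K, used only to see that 1 != 0. *)
Fixpoint ueval0 (s : uterm) : K :=
  match s with
  | UGen _ => 0
  | UConst c => c
  | UAdd s t => ueval0 s + ueval0 t
  | UMul s t => ueval0 s * ueval0 t
  end.

Fact ueval0_eqv s t : ueqv s t -> ueval0 s = ueval0 t.
Proof.
elim=> {s t} //=; do ?by move=> *; congruence.
- by move=> s t u; rewrite addrA.
- by move=> s t; rewrite addrC.
- by move=> s; rewrite add0r.
- by move=> s; rewrite mulN1r addNr.
- by move=> s t u; rewrite mulrA.
- by move=> s; rewrite mul1r.
- by move=> s; rewrite mulr1.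
- by move=> s t u; rewrite mulrDl.
- by move=> s t u; rewrite mulrDr.
- by move=> c s; rewrite mulrC.
- by rewrite addr0.
- by move=> *; rewrite mulr0.
- by move=> *; rewrite !mulr0 addr0.
Qed.

Fact uenv_1neq0 : uenv_const 1 != 0.
Proof.
by apply/eqP=> /upiP/ueval0_eqv /= /eqP; rewrite oner_eq0.
Qed.

HB.instance Definition _ := GRing.Zmodule_isNzRing.Build uenv
  uenv_mulA uenv_1mul uenv_mul1 uenv_mulDl uenv_mulDr uenv_1neq0.

Fact uenv_scaleA c d u : uenv_scale c (uenv_scale d u) = uenv_scale (c * d) u.
Proof.
rewrite /uenv_scale uenv_mulA; congr uenv_mul.
by rewrite /uenv_const -upi_mul; apply/upiP/ueqv_sym/ueqv_constM.
Qed.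
Fact uenv_scale1 : left_id 1 uenv_scale.
Proof. exact: uenv_1mul. Qed.
Fact uenv_scaleDr : right_distributive uenv_scale +%R.
Proof. by move=> c u v; exact: uenv_mulDr. Qed.
Fact uenv_scaleDl u : {morph uenv_scale^~ u : c d / c + d}.
Proof.
move=> c d; rewrite /uenv_scale -uenv_mulDl; congr uenv_mul.
by rewrite -upi_addr; apply/upiP/ueqv_constD.
Qed.

Lemma upi_mulr s t : pi (UMul s t) = pi s * pi t.
Proof. exact: upi_mul. Qed.

HB.instance Definition _ := GRing.Zmodule_isLmodule.Build K uenv
  uenv_scaleA uenv_scale1 uenv_scaleDr uenv_scaleDl.

Lemma upi_scaler c s : pi (UMul (UConst c) s) = c *: pi s.
Proof. exact: upi_mul. Qed.

Fact uenv_scaleAl c (u v : uenv) : c *: (u * v) = (c *: u) * v.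
Proof. exact: uenv_mulA. Qed.
HB.instance Definition _ := GRing.Lmodule_isLalgebra.Build K uenv uenv_scaleAl.

Fact uenv_scaleAr c (u v : uenv) : c *: (u * v) = u * (c *: v).
Proof.
change (uenv_mul (uenv_const c) (uenv_mul u v) =
        uenv_mul u (uenv_mul (uenv_const c) v)).
rewrite !uenv_mulA; congr uenv_mul.
by rewrite -[u]ureprK -!upi_mul; apply/upiP/ueqv_central.
Qed.
HB.instance Definition _ := GRing.Lalgebra_isAlgebra.Build K uenv uenv_scaleAr.

End Enveloping.

(* Maps from g to an associative algebra A that turn the superbracket into the
   supercommutator; they extend uniquely to algebra maps U(g) -> A. *)
Record superRep (K : fieldType) (g : lieSuperalg K) (A : algType K) :=
  SuperRep {
    srep_fun :> g -> A;
    srep_lin : linear srep_fun;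
    srep_br : forall (a b : bool) x y,
      x \in lsa_part g a -> y \in lsa_part g b ->
      srep_fun x * srep_fun y - (-1) ^+ (a && b) *: (srep_fun y * srep_fun x)
        = srep_fun (lsa_br x y)
  }.

Section Lift.
Variables (K : fieldType) (g : lieSuperalg K) (A : algType K).
Variable f : superRep g A.

Fixpoint ueval (s : uterm g) : A :=
  match s with
  | UGen x => f x
  | UConst c => c%:A
  | UAdd s t => ueval s + ueval t
  | UMul s t => ueval s * ueval t
  end.

Fact ueval_eqv s t : ueqv s t -> ueval s = ueval t.
Proof.
elim=> {s t} //=; do ?by move=> *; congruence.
- by move=> s t u; rewrite addrA.
- by move=> s t; rewrite addrC.
- by move=> s; rewrite scale0r add0r.
- by move=> s; rewrite mulr_algl scaleN1r addNr scale0r.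
- by move=> s t u; rewrite mulrA.
- by move=> s; rewrite scale1r mul1r.
- by move=> s; rewrite scale1r mulr1.
- by move=> s t u; rewrite mulrDl.
- by move=> s t u; rewrite mulrDr.
- by move=> c d; rewrite scalerDl.
- by move=> c d; rewrite mulr_algl scalerA.
- by move=> c s; rewrite mulr_algl mulr_algr.
- by move=> x y; have := srep_lin f 1 x y; rewrite !scale1r.
- move=> c x; have := srep_lin f c x 0; have := srep_lin f 1 0 0.
  rewrite !scale1r !addr0 => /eqP; rewrite eq_sym -subr_eq0 addrK => /eqP->.
  by rewrite addr0 mulr_algl.
- by move=> a b x y xa yb; rewrite mulr_algl scaleNr; apply: srep_br.
Qed.

Definition ulift (u : uenv g) : A := ueval (repr u).

Lemma ulift_pi s : ulift (uenv_pi s) = ueval s.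
Proof. by apply: ueval_eqv; apply: urepr_pi. Qed.

Lemma ulift_gen x : ulift (uenv_gen x) = f x.
Proof. by rewrite ulift_pi. Qed.

Fact ulift_zmod : zmod_morphism ulift.
Proof.
move=> u v; rewrite -[u]ureprK -[v]ureprK.
by rewrite -upi_oppr -upi_addr !ulift_pi /= mulr_algl scaleN1r.
Qed.

Fact ulift_monoid : monoid_morphism ulift.
Proof.
split; first by rewrite [1]/(uenv_pi (UConst g 1)) ulift_pi /= scale1r.
by move=> u v; rewrite -[u]ureprK -[v]ureprK -upi_mulr !ulift_pi.
Qed.

HB.instance Definition _ := GRing.isZmodMorphism.Build (uenv g) A ulift ulift_zmod.
HB.instance Definition _ := GRing.isMonoidMorphism.Build (uenv g) A ulift ulift_monoid.

End Lift.

Section EnvGen.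
Variables (K : fieldType) (g : lieSuperalg K).

Lemma uenv_gen_linear : linear (@uenv_gen K g).
Proof.
move=> c x y; rewrite /uenv_gen.
rewrite -upi_scaler -upi_addr; apply/upiP; apply: ueqv_trans (ueqv_genD _ _) _.
by apply: ueqv_add; [apply: ueqv_genZ | apply: ueqv_refl].
Qed.

HB.instance Definition _ :=
  GRing.isLinear.Build K g (uenv g) _ (@uenv_gen K g) uenv_gen_linear.

Lemma uenv_gen_br (a b : bool) (x y : g) :
  x \in lsa_part g a -> y \in lsa_part g b ->
  uenv_gen x * uenv_gen y - (-1) ^+ (a && b) *: (uenv_gen y * uenv_gen x)
    = uenv_gen (lsa_br x y).
Proof.
move=> xa yb; apply/esym; rewrite -scaleNr.
rewrite /uenv_gen -[LHS](iffRL (upiP _ _) (ueqv_br xa yb)).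
by rewrite upi_addr upi_scaler !upi_mulr.
Qed.

End EnvGen.

Section SubEnv.
Variables (K : fieldType) (g : lieSuperalg K) (b : subSuperalg g).

Let incl (x : subLie b) : uenv g := uenv_gen (vsval x).

Fact incl_lin : linear incl.
Proof. by move=> c x y; rewrite /incl !linearP. Qed.

Fact incl_br (a a' : bool) (x y : subLie b) :
  x \in lsa_part (subLie b) a -> y \in lsa_part (subLie b) a' ->
  incl x * incl y - (-1) ^+ (a && a') *: (incl y * incl x)
    = incl (lsa_br x y).
Proof.
rewrite !sub_partE => xa ya; rewrite /incl (uenv_gen_br xa ya).
by congr uenv_gen; rewrite sub_brE.
Qed.

Definition uenv_sub : uenv (subLie b) -> uenv g :=
  ulift (SuperRep incl_lin incl_br).
HB.instance Definition _ := GRing.RMorphism.on uenv_sub.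

End SubEnv.

(* The A-module A (x)_B N, for a left B-module N and a ring map phi : B -> A:
   the free abelian group on the symbols a (x) n modulo biadditivity and
   a phi(b) (x) n = a (x) bn. *)
Section Induction.
Variables (A B : pzRingType) (phi : {rmorphism B -> A}) (N : lmodType B).

Inductive tterm : Type :=
  | TZero
  | TPure of A & N
  | TOpp of tterm
  | TAdd of tterm & tterm.

Inductive teqv : tterm -> tterm -> Prop :=
  | teqv_refl s : teqv s s
  | teqv_sym s t : teqv s t -> teqv t s
  | teqv_trans s t u : teqv s t -> teqv t u -> teqv s u
  | teqv_opp s s' : teqv s s' -> teqv (TOpp s) (TOpp s')
  | teqv_add s s' t t' :
      teqv s s' -> teqv t t' -> teqv (TAdd s t) (TAdd s' t')
  | teqv_addA s t u : teqv (TAdd s (TAdd t u)) (TAdd (TAdd s t) u)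
  | teqv_addC s t : teqv (TAdd s t) (TAdd t s)
  | teqv_add0 s : teqv (TAdd TZero s) s
  | teqv_addN s : teqv (TAdd (TOpp s) s) TZero
  | teqv_pureDl a a' n :
      teqv (TPure (a + a') n) (TAdd (TPure a n) (TPure a' n))
  | teqv_pureDr a n n' :
      teqv (TPure a (n + n')) (TAdd (TPure a n) (TPure a n'))
  | teqv_bal a b n : teqv (TPure (a * phi b) n) (TPure a (b *: n)).

HB.instance Definition _ := gen_eqMixin tterm.
HB.instance Definition _ := gen_choiceMixin tterm.

Definition teqvb : rel tterm := fun s t => `[< teqv s t >].

Fact teqvb_equiv : equiv_class_of teqvb.
Proof.
split=> [s|s t|t s u]; first by apply/asboolP; exact: teqv_refl.
  by apply/asboolP/asboolP; exact: teqv_sym.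
by move=> /asboolP st /asboolP tu; apply/asboolP; exact: teqv_trans tu.
Qed.

Canonical teqvb_equivRel := EquivRelPack teqvb_equiv.

Definition indMod : Type := {eq_quot teqvb}.
HB.instance Definition _ := Choice.on indMod.
HB.instance Definition _ := EqQuotient.on indMod.

Definition ind_pi (s : tterm) : indMod := \pi_indMod s.
Local Notation pi := ind_pi.

Lemma tpiP s t : pi s = pi t <-> teqv s t.
Proof.
split=> [/eqmodP/asboolP//|st].
by apply/eqmodP/asboolP.
Qed.

Lemma treprK (u : indMod) : pi (repr u) = u. Proof. exact: reprK. Qed.

Lemma trepr_pi s : teqv (repr (pi s)) s.
Proof. by apply/tpiP; rewrite treprK. Qed.

Fixpoint tact (a : A) (s : tterm) : tterm :=
  match s with
  | TZero => TZero
  | TPure a' n => TPure (a * a') n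
  | TOpp s => TOpp (tact a s)
  | TAdd s t => TAdd (tact a s) (tact a t)
  end.

Fact tact_eqv a s t : teqv s t -> teqv (tact a s) (tact a t).
Proof.
elim=> {s t} /=; do ?by move=> *; econstructor; eauto.
- by move=> a1 a2 n; rewrite mulrDr; apply: teqv_pureDl.
- by move=> a' b n; rewrite mulrA; apply: teqv_bal.
Qed.

Definition ind_pure (a : A) (n : N) : indMod := pi (TPure a n).
Definition ind_zero : indMod := pi TZero.
Definition ind_opp (u : indMod) : indMod := pi (TOpp (repr u)).
Definition ind_add (u v : indMod) : indMod := pi (TAdd (repr u) (repr v)).
Definition ind_act (a : A) (u : indMod) : indMod := pi (tact a (repr u)).

Lemma tpi_opp s : pi (TOpp s) = ind_opp (pi s).
Proof. by apply/tpiP; apply: teqv_opp; apply: teqv_sym; apply: trepr_pi. Qed.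
Lemma tpi_add s t : pi (TAdd s t) = ind_add (pi s) (pi t).
Proof. by apply/tpiP; apply: teqv_add; apply: teqv_sym; apply: trepr_pi. Qed.
Lemma tpi_act a s : pi (tact a s) = ind_act a (pi s).
Proof. by apply/tpiP; apply: tact_eqv; apply: teqv_sym; apply: trepr_pi. Qed.

Fact ind_addA : associative ind_add.
Proof.
move=> u v w; rewrite -[u]treprK -[v]treprK -[w]treprK -!tpi_add.
by apply/tpiP/teqv_addA.
Qed.
Fact ind_addC : commutative ind_add.
Proof.
by move=> u v; rewrite -[u]treprK -[v]treprK -!tpi_add; apply/tpiP/teqv_addC.
Qed.
Fact ind_add0 : left_id ind_zero ind_add.
Proof. by move=> u; rewrite -[u]treprK -!tpi_add; apply/tpiP/teqv_add0. Qed.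
Fact ind_addN : left_inverse ind_zero ind_opp ind_add.
Proof.
move=> u; rewrite -[u]treprK -tpi_opp -!tpi_add.
by apply/tpiP/teqv_addN.
Qed.

HB.instance Definition _ :=
  GRing.isZmodule.Build indMod ind_addA ind_addC ind_add0 ind_addN.

Lemma tpi_addr s t : pi (TAdd s t) = pi s + pi t.
Proof. exact: tpi_add. Qed.
Lemma tpi_zero : pi TZero = 0.
Proof. by []. Qed.
Lemma tpi_oppr s : pi (TOpp s) = - pi s.
Proof. exact: tpi_opp. Qed.

Fact ind_actA a a' u : ind_act a (ind_act a' u) = ind_act (a * a') u.
Proof.
rewrite -[u]treprK -!tpi_act; congr pi.
by elim: (repr u) => //= [a1 n|s ->|s -> t ->] //; rewrite mulrA.
Qed.
Fact ind_act1 : left_id 1 ind_act.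
Proof.
move=> u; rewrite -[u]treprK -!tpi_act; congr pi.
by elim: (repr u) => //= [a1 n|s ->|s -> t ->] //; rewrite mul1r.
Qed.
Fact ind_actDr : right_distributive ind_act +%R.
Proof.
move=> a u v; rewrite -[u]treprK -[v]treprK -tpi_addr -!tpi_act.
by rewrite -tpi_addr.
Qed.
Fact ind_actDl u : {morph ind_act^~ u : a a' / a + a'}.
Proof.
move=> a a'; rewrite -[u]treprK -!tpi_act; elim: (repr u) => /=.
- by rewrite tpi_zero addr0.
- by move=> a1 n; rewrite -tpi_addr mulrDl; apply/tpiP/teqv_pureDl.
- by move=> s IH; rewrite !tpi_oppr IH opprD.
- by move=> s IHs t IHt; rewrite !tpi_addr IHs IHt addrACA.
Qed.

HB.instance Definition _ := GRing.Zmodule_isLmodule.Build A indMod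
  ind_actA ind_act1 ind_actDr ind_actDl.

End Induction.

(* The base ring K as a left A-module through a character chi : A -> K. *)
Section OneDim.
Variables (K : nzRingType) (A : pzRingType) (chi : {rmorphism A -> K}).

Definition oneDim : Type := let _ := chi in K.
HB.instance Definition _ := GRing.Zmodule.on oneDim.

Definition oneDim_scale (a : A) (c : oneDim) : oneDim := chi a * (c : K).

Fact oneDim_scaleA a b c :
  oneDim_scale a (oneDim_scale b c) = oneDim_scale (a * b) c.
Proof. by rewrite /oneDim_scale rmorphM mulrA. Qed.
Fact oneDim_scale1 : left_id 1 oneDim_scale.
Proof. by move=> c; rewrite /oneDim_scale rmorph1 mul1r. Qed.
Fact oneDim_scaleDr : right_distributive oneDim_scale +%R.
Proof. by move=> a b c; rewrite /oneDim_scale mulrDr. Qed.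
Fact oneDim_scaleDl c : {morph oneDim_scale^~ c : a b / a + b}.
Proof. by move=> a b; rewrite /oneDim_scale rmorphD mulrDl. Qed.

HB.instance Definition _ := GRing.Zmodule_isLmodule.Build A oneDim
  oneDim_scaleA oneDim_scale1 oneDim_scaleDr oneDim_scaleDl.
End OneDim.

Section Submodules.
Variables (A : pzRingType) (M : lmodType A).
Implicit Types N P : submodClosed M.

Inductive submodType P : Type := SubmodElt (x : M) & x \in P.
Definition submod_val P (u : submodType P) : M := let: SubmodElt x _ := u in x.

Section SubInst.
Variable P : submodClosed M.
HB.instance Definition _ := [isSub for @submod_val P].
HB.instance Definition _ := [Choice of submodType P by <:].
HB.instance Definition _ := [SubChoice_isSubLmodule of submodType P by <:].
End SubInst.

Section QuotInst.
Variable N : submodClosed M.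

(* MathComp does not see by itself that a submodule is an additive subgroup. *)
Definition submod_zmod : pred M := fun x => x \in N.
HB.instance Definition _ := GRing.isZmodClosed.Build M submod_zmod
  (GRing.submod_closedB (submodClosedP N)).

Definition submod_subgroup : zmodClosed M :=
  GRing.ZmodClosed.clone M submod_zmod _.

Definition quotMod : Type := Quotient.quot submod_subgroup.
HB.instance Definition _ := Choice.on quotMod.
HB.instance Definition _ := GRing.Zmodule.on quotMod.
HB.instance Definition _ := EqQuotient.on quotMod.

Definition quot_proj (x : M) : quotMod := \pi_quotMod x.
Definition quot_scale (a : A) (u : quotMod) : quotMod := quot_proj (a *: repr u).

Lemma quot_projP x y : quot_proj x = quot_proj y <-> x - y \in N.
Proof.
have E : (x - y \in N) = (quot_proj x == quot_proj y).
  exact: (Quotient.idealrBE submod_subgroup x y).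
by rewrite E; split=> /eqP.
Qed.

Fact quot_proj_zmod : zmod_morphism quot_proj.
Proof. by move=> x y; rewrite /quot_proj raddfB. Qed.
HB.instance Definition _ :=
  GRing.isZmodMorphism.Build M quotMod quot_proj quot_proj_zmod.

Lemma quot_scaleE a x : quot_scale a (quot_proj x) = quot_proj (a *: x).
Proof.
apply/quot_projP; rewrite -scalerBr rpredZ //; apply/quot_projP.
exact: reprK.
Qed.

Lemma quot_surj (u : quotMod) : {x | u = quot_proj x}.
Proof. by exists (repr u); rewrite /quot_proj reprK. Qed.

Fact quot_scaleA a b u : quot_scale a (quot_scale b u) = quot_scale (a * b) u.
Proof. by have [x ->] := quot_surj u; rewrite !quot_scaleE scalerA. Qed.
Fact quot_scale1 : left_id 1 quot_scale.
Proof. by move=> u; have [x ->] := quot_surj u; rewrite quot_scaleE scale1r. Qed.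
Fact quot_scaleDr : right_distributive quot_scale +%R.
Proof.
move=> a u v; have [x ->] := quot_surj u; have [y ->] := quot_surj v.
by rewrite -raddfD !quot_scaleE scalerDr raddfD.
Qed.
Fact quot_scaleDl u : {morph quot_scale^~ u : a b / a + b}.
Proof.
move=> a b; have [x ->] := quot_surj u.
by rewrite !quot_scaleE scalerDl raddfD.
Qed.
HB.instance Definition _ := GRing.Zmodule_isLmodule.Build A quotMod
  quot_scaleA quot_scale1 quot_scaleDr quot_scaleDl.

Fact quot_proj_scalable : scalable quot_proj.
Proof. by move=> a x; rewrite -quot_scaleE. Qed.
HB.instance Definition _ :=
  GRing.isScalable.Build A M quotMod _ quot_proj quot_proj_scalable.
End QuotInst.
End Submodules.

Section Subquotients.
Variables (A : pzRingType) (M : lmodType A).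
Implicit Types N P : submodClosed M.

Definition submod_cap N P : pred (submodType P) := fun u => val u \in N.

Fact submod_cap_closed N P : submod_closed (submod_cap N (P:=P)).
Proof.
split=> [|a x y xN yN]; first by change (val (0 : submodType P) \in N); apply: rpred0.
change (val (a *: x + y) \in N); rewrite linearP.
by apply: rpredD => //; apply: rpredZ.
Qed.
HB.instance Definition _ N P := GRing.isSubmodClosed.Build A (submodType P)
  (submod_cap N (P:=P)) (submod_cap_closed N P).

(* P / N, meant for N contained in P. *)
Definition subquot N P : lmodType A := 
  quotMod (GRing.SubmodClosed.clone A (submodType P) (submod_cap N (P:=P)) _).

Definition submod_sub N P := {subset N <= P}.
Definition proper_submod N := exists x, x \notin N.

Definition irreducible_mod :=
  (exists x : M, x != 0) /\
  forall N, (exists2 x, x \in N & x != 0) -> forall x, x \in N.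

Definition maxsub : pred M := fun x =>
  `[< exists2 s : seq M,
        (forall y, y \in s -> exists2 N, proper_submod N & y \in N) &
        x = \sum_(y <- s) y >].

Fact maxsub_closed : submod_closed maxsub.
Proof.
split; first by apply/asboolP; exists [::]; rewrite ?big_nil.
move=> a x y /asboolP[s sP ->] /asboolP[t tP ->]; apply/asboolP.
exists ([seq a *: z | z <- s] ++ t) => [z|].
  rewrite mem_cat => /orP[/mapP[z' /sP[N Np z'N] ->]|/tP//].
  by exists N; rewrite ?rpredZ.
by rewrite big_cat big_map scaler_sumr.
Qed.
HB.instance Definition _ := GRing.isSubmodClosed.Build A M maxsub maxsub_closed.

(* M / (sum of all proper submodules): the unique irreducible quotient of M
   whenever M has a largest proper submodule, as highest weight modules do. *)
Definition headMod : lmodType A := 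
  quotMod (GRing.SubmodClosed.clone A M maxsub _).

End Subquotients.

Definition mod_iso (A : pzRingType) (M N : lmodType A) :=
  exists f : {linear M -> N}, bijective f.

Section CompositionSeries.
Variables (A : pzRingType) (M : lmodType A).

(* 0 = N 0 <= N 1 <= ... <= N k = M with irreducible factors. *)
Definition composition_series (k : nat) (N : nat -> submodClosed M) :=
  [/\ forall x, x \in N 0%N -> x = 0,
      forall x, x \in N k &
      forall i, (i < k)%N ->
        submod_sub (N i) (N i.+1) /\ irreducible_mod (subquot (N i) (N i.+1))].

Definition composition_count (k : nat) (N : nat -> submodClosed M)
    (L : lmodType A) : nat :=
  #|[set i : 'I_k | `[< mod_iso (subquot (N i) (N i.+1)) L >]]|.

(* [M : L] = m; by Jordan-Hoelder the count does not depend on the series. *)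
Definition comp_mult (L : lmodType A) (m : nat) :=
  exists k N, composition_series k N /\ composition_count k N L = m.

End CompositionSeries.

(* The three axes index the three sl2 factors of the even part, with positive
   roots 2 delta, 2 epsilon_1, 2 epsilon_2. *)
Inductive axis := Delta | Eps1 | Eps2.

Definition axes := [:: Delta; Eps1; Eps2].

Definition axis_code (i : axis) : option bool :=
  match i with Delta => None | Eps1 => Some false | Eps2 => Some true end.
Definition axis_decode (c : option bool) : axis :=
  match c with None => Delta | Some false => Eps1 | Some true => Eps2 end.
Fact axis_codeK : cancel axis_code axis_decode. Proof. by case. Qed.
HB.instance Definition _ := Countable.copy axis (can_type axis_codeK).
Fact axes_enum : Finite.axiom axes. Proof. by case. Qed.
HB.instance Definition _ := isFinite.Build axis axes_enum.

Inductive sl2 := SE | SH | SF.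

Definition sl2_code (x : sl2) : option bool :=
  match x with SE => Some true | SH => None | SF => Some false end.
Definition sl2_decode (c : option bool) : sl2 :=
  match c with Some true => SE | None => SH | Some false => SF end.
Fact sl2_codeK : cancel sl2_code sl2_decode. Proof. by case. Qed.
HB.instance Definition _ := Countable.copy sl2 (can_type sl2_codeK).
Fact sl2_enum : Finite.axiom [:: SE; SH; SF]. Proof. by case. Qed.
HB.instance Definition _ := isFinite.Build sl2 sl2_enum.

(* A triple of signs (true is +) stands for a basis vector of the odd part
   V (x) V (x) V, where V is the natural module of sl2 with its weight basis. *)
Definition signs : Type := (bool * bool * bool)%type.

Definition sign_at (s : signs) (i : axis) : bool :=
  match i with Delta => s.1.1 | Eps1 => s.1.2 | Eps2 => s.2 end.

Definition sign_set (s : signs) (i : axis) (e : bool) : signs :=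
  match i with
  | Delta => (e, s.1.2, s.2)
  | Eps1 => (s.1.1, e, s.2)
  | Eps2 => (s.1.1, s.1.2, e)
  end.

Definition d21_basis : Type := (axis * sl2 + signs)%type.

Definition basis_parity (b : d21_basis) : bool := if b is inr _ then true else false.

(* A structure constant (None, n) is the integer n, and (Some i, n) is
   n sigma_i, where sigma_delta + sigma_epsilon1 + sigma_epsilon2 = 0. *)
Definition scoef : Type := (option axis * int)%type.

Definition sl2_br (x y : sl2) : seq (int * sl2) :=
  match x, y with
  | SE, SF => [:: (1, SH)]
  | SF, SE => [:: (-1, SH)]
  | SH, SE => [:: (2, SE)]
  | SE, SH => [:: (-2, SE)]
  | SH, SF => [:: (-2, SF)]
  | SF, SH => [:: (2, SF)]
  | _, _ => [::]
  end.

Definition sl2_act (x : sl2) (e : bool) : seq (int * bool) :=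
  match x, e with
  | SE, false => [:: (1, true)]
  | SF, true => [:: (1, false)]
  | SH, true => [:: (1, true)]
  | SH, false => [:: (-1, false)]
  | _, _ => [::]
  end.

(* The invariant symplectic form on V, and the invariant symmetric map
   V x V -> sl2 given by p(u,v)w = psi(v,w) u - psi(w,u) v. *)
Definition psi (e e' : bool) : int :=
  match e, e' with true, false => 1 | false, true => -1 | _, _ => 0 end.

Definition pmap_V (e e' : bool) : int * sl2 :=
  match e, e' with
  | true, true => (2, SE)
  | false, false => (-2, SF)
  | _, _ => (-1, SH)
  end.

Definition odd_coef (s t : signs) (i : axis) : int :=
  foldr (fun j => *%R (psi (sign_at s j) (sign_at t j))) 1
    [seq j <- axes | j != i].

(* Kac-Scheunert realization of D(2|1;zeta): the even part is sl2 + sl2 + sl2,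
   acting on the odd part V (x) V (x) V, and the bracket of two odd vectors is
     [u1 u2 u3, v1 v2 v3] = sum_i sigma_i (prod_{j <> i} psi(uj,vj)) p(ui,vi).
   The normalization of sigma below makes the Cartan matrix come out exactly;
   see chevalley_ef, chevalley_he and chevalley_hf. *)
Definition basis_br (a b : d21_basis) : seq (scoef * d21_basis) :=
  match a, b with
  | inl (i, x), inl (j, y) =>
      if i == j then [seq ((None, p.1), inl (i, p.2)) | p <- sl2_br x y] else [::]
  | inl (i, x), inr s =>
      [seq ((None, p.1), inr (sign_set s i p.2)) | p <- sl2_act x (sign_at s i)]
  | inr s, inl (i, x) =>
      [seq ((None, - p.1), inr (sign_set s i p.2)) | p <- sl2_act x (sign_at s i)]
  | inr s, inr t =>
      [seq (let p := pmap_V (sign_at s i) (sign_at t i) in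
            ((Some i, odd_coef s t i * p.1), inl (i, p.2))) | i <- axes]
  end.

Section D21.
Variables (K : numFieldType) (zeta : K).

Definition sigma (i : axis) : K :=
  match i with
  | Delta => - (1 + zeta) / 2
  | Eps1 => 1 / 2
  | Eps2 => zeta / 2
  end.

Lemma sigma_sum : sigma Delta + sigma Eps1 + sigma Eps2 = 0.
Proof. by rewrite /sigma; field. Qed.

Definition tag_eval (t : option axis) : K := if t is Some i then sigma i else 1.
Definition scoef_eval (c : scoef) : K := tag_eval c.1 * c.2%:~R.

Definition d21_car := {ffun d21_basis -> K^o}.

Definition bvec (b : d21_basis) : d21_car := [ffun c => (c == b)%:R].

Definition d21_br (x y : d21_car) : d21_car :=
  \sum_a \sum_b (x a * y b) *:
    \sum_(p <- basis_br a b) scoef_eval p.1 *: bvec p.2.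

Definition bspan (P : pred d21_basis) : {vspace d21_car} :=
  <<[seq bvec b | b <- enum P]>>%VS.

Definition d21_part (e : bool) : {vspace d21_car} :=
  bspan (fun b => basis_parity b == e).

Lemma bvec_sum (x : d21_car) : x = \sum_b x b *: bvec b.
Proof.
apply/ffunP=> c; rewrite sum_ffunE (bigD1 c) //= big1 => [|b bc].
  by rewrite !ffunE eqxx addr0 [RHS]mulr1.
by rewrite !ffunE eq_sym (negPf bc) [LHS]mulr0.
Qed.

Lemma bspanP P (x : d21_car) :
  reflect (forall b, ~~ P b -> x b = 0) (x \in bspan P).
Proof.
apply: (iffP idP) => [|x0].
  pose X := in_tuple [seq bvec b | b <- enum P].
  move=> xP b Pb; have /coord_span-> : x \in <<X>>%VS by [].
  rewrite sum_ffunE big1 // => i _; rewrite ffunE.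
  have /mapP[c + ->] : X`_i \in X by rewrite mem_nth.
  rewrite mem_enum => Pc; rewrite ffunE.
  have /negPf-> : b != c by apply: contraNneq Pb => ->.
  exact: mulr0.
rewrite [x]bvec_sum; apply: rpred_sum => b _.
have [Pb|/x0->] := boolP (P b); last by rewrite scale0r rpred0.
by apply/rpredZ/memv_span/map_f; rewrite mem_enum.
Qed.

Lemma bvec_bspan (P : pred d21_basis) b : P b -> bvec b \in bspan P.
Proof. by move=> Pb; apply/memv_span/map_f; rewrite mem_enum. Qed.

Lemma d21_partP e (x : d21_car) :
  reflect (forall b, basis_parity b != e -> x b = 0) (x \in d21_part e).
Proof. exact: bspanP. Qed.

Lemma bvec_part b : bvec b \in d21_part (basis_parity b).
Proof. by apply: bvec_bspan; apply: eqxx. Qed.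

Lemma part_ind e (P : d21_car -> Prop) :
    (forall c x y, P x -> P y -> P (c *: x + y)) -> P 0 ->
    (forall b, basis_parity b = e -> P (bvec b)) ->
  forall x, x \in d21_part e -> P x.
Proof.
move=> Plin P0 Pb x /d21_partP xe; rewrite [x]bvec_sum.
elim/big_rec: _ => // b y _ Py.
have [/eqP be|be] := boolP (basis_parity b == e); first exact/Plin/Py/Pb.
by rewrite xe // scale0r add0r.
Qed.

Fact d21_br_linl y : linear (d21_br ^~ y).
Proof.
move=> c x x'; rewrite /d21_br scaler_sumr -big_split; apply: eq_bigr => a _ /=.
rewrite scaler_sumr -big_split; apply: eq_bigr => b _ /=.
by rewrite !ffunE mulrDl scalerDl scalerA mulrA.
Qed.

Fact d21_br_linr x : linear (d21_br x).
Proof.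
move=> c y y'; rewrite /d21_br scaler_sumr -big_split; apply: eq_bigr => a _ /=.
rewrite scaler_sumr -big_split; apply: eq_bigr => b _ /=.
by rewrite !ffunE mulrDr scalerDl scalerA mulrCA.
Qed.

Lemma d21_br0l y : d21_br 0 y = 0.
Proof. by have := d21_br_linl y (-1) 0 0; rewrite scaler0 addr0 scaleN1r addNr. Qed.
Lemma d21_br0r x : d21_br x 0 = 0.
Proof. by have := d21_br_linr x (-1) 0 0; rewrite scaler0 addr0 scaleN1r addNr. Qed.

Lemma d21_brlDZ c x x' y : d21_br (c *: x + x') y = c *: d21_br x y + d21_br x' y.
Proof. exact: d21_br_linl. Qed.
Lemma d21_brrDZ c x y y' : d21_br x (c *: y + y') = c *: d21_br x y + d21_br x y'.
Proof. exact: d21_br_linr. Qed.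

Lemma d21_br_basis a b : d21_br (bvec a) (bvec b) =
  \sum_(p <- basis_br a b) scoef_eval p.1 *: bvec p.2.
Proof.
rewrite /d21_br (bigD1 a) //= [X in _ + X]big1 => [|c ca]; last first.
  by rewrite big1 // => d _; rewrite !ffunE (negPf ca) mul0r scale0r.
rewrite addr0 (bigD1 b) //= [X in _ + X]big1 => [|c cb]; last first.
  by rewrite !ffunE (negPf cb) mulr0 scale0r.
by rewrite !ffunE !eqxx mulr1 addr0 scale1r.
Qed.

(* Identities between structure constants are checked by computation on lists
   of monomials n sigma_i b. *)
Definition mono := (option axis * int * d21_basis)%type.

Definition mono_eval (l : seq mono) : d21_car :=
  \sum_(m <- l) (tag_eval m.1.1 * m.1.2%:~R) *: bvec m.2.

Definition all_basis : seq d21_basis :=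
  [seq inl (i, x) | i <- axes, x <- [:: SE; SH; SF]] ++
  [seq inr (s, u) | s <- [seq (t, u) | t <- [:: false; true], u <- [:: false; true]],
                    u <- [:: false; true]].

Lemma mem_all_basis b : b \in all_basis.
Proof. by case: b => [[[] []]|[[[] []] []]]. Qed.

Definition mono_coef (l : seq mono) (b : d21_basis) (t : option axis) : int :=
  foldr (fun m z => if (m.2 == b) && (m.1.1 == t) then m.1.2 + z else z) 0 l.

Definition mono_zero (l : seq mono) : bool :=
  all (fun b => [&& mono_coef l b None == 0,
    mono_coef l b (Some Delta) == mono_coef l b (Some Eps1) &
    mono_coef l b (Some Eps1) == mono_coef l b (Some Eps2)]) all_basis.

Lemma mono_evalE l b : mono_eval l b =
  (mono_coef l b None)%:~R + \sum_(i <- axes) sigma i * (mono_coef l b (Some i))%:~R.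
Proof.
rewrite /mono_eval sum_ffunE !big_cons big_nil addr0.
elim: l => [|[[t n] c] l IH]; first by rewrite big_nil /= !mulr0 !addr0.
rewrite big_cons IH !ffunE /= [b == c]eq_sym.
case: eqP => [_|_]; last by rewrite [_ *: _]mulr0 add0r.
by rewrite [_ *: _]mulr1; case: t => [[]|] /=; rewrite ?rmorphD /=; ring.
Qed.

Lemma mono_zeroP l : mono_zero l -> mono_eval l = 0.
Proof.
move=> /allP lz; apply/ffunP=> b; rewrite mono_evalE !ffunE.
rewrite !big_cons big_nil addr0.
have /and3P[/eqP-> /eqP-> /eqP->] := lz b (mem_all_basis b).
rewrite add0r addrA -(mulrDl (sigma Delta)).
by rewrite -(mulrDl (sigma Delta + sigma Eps1)) sigma_sum mul0r.
Qed.

Lemma mono_eval_cat l l' : mono_eval (l ++ l') = mono_eval l + mono_eval l'.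
Proof. by rewrite /mono_eval big_cat. Qed.

Definition mono_opp (e : bool) (l : seq mono) : seq mono :=
  [seq (m.1.1, if e then - m.1.2 else m.1.2, m.2) | m <- l].

Lemma mono_eval_opp e l : mono_eval (mono_opp e l) = (-1) ^+ e *: mono_eval l.
Proof.
rewrite /mono_eval big_map scaler_sumr; apply: eq_bigr => m _ /=.
by case: e; rewrite ?scale1r // scaleN1r rmorphN mulrN scaleNr.
Qed.

Definition mono_br (a b : d21_basis) : seq mono :=
  [seq (p.1.1, p.1.2, p.2) | p <- basis_br a b].

Lemma mono_brE a b : mono_eval (mono_br a b) = d21_br (bvec a) (bvec b).
Proof. by rewrite /mono_eval big_map d21_br_basis. Qed.

Definition tag_mul (t u : option axis) : option axis := if t is None then u else t.
Definition tag_ok (t u : option axis) : bool := (t == None) || (u == None).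

Definition mono_brr (a : d21_basis) (l : seq mono) : seq mono :=
  flatten [seq [seq (tag_mul m.1.1 p.1.1, m.1.2 * p.1.2, p.2) | p <- basis_br a m.2]
          | m <- l].
Definition mono_brl (l : seq mono) (a : d21_basis) : seq mono :=
  flatten [seq [seq (tag_mul m.1.1 p.1.1, m.1.2 * p.1.2, p.2) | p <- basis_br m.2 a]
          | m <- l].
Definition brr_ok (a : d21_basis) (l : seq mono) : bool :=
  all (fun m => all (fun p : scoef * d21_basis => tag_ok m.1.1 p.1.1) (basis_br a m.2)) l.
Definition brl_ok (l : seq mono) (a : d21_basis) : bool :=
  all (fun m => all (fun p : scoef * d21_basis => tag_ok m.1.1 p.1.1) (basis_br m.2 a)) l.

Lemma tag_mulE t u : tag_ok t u -> tag_eval (tag_mul t u) = tag_eval t * tag_eval u.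
Proof. by case: t u => [i|] [j|] //= _; rewrite ?mulr1 ?mul1r. Qed.

Lemma d21_brsl y (I : Type) (r : seq I) (F : I -> K) (G : I -> d21_car) :
  d21_br (\sum_(i <- r) F i *: G i) y = \sum_(i <- r) F i *: d21_br (G i) y.
Proof.
elim: r => [|i r IH]; first by rewrite !big_nil d21_br0l.
by rewrite !big_cons d21_brlDZ IH.
Qed.

Lemma d21_brsr x (I : Type) (r : seq I) (F : I -> K) (G : I -> d21_car) :
  d21_br x (\sum_(i <- r) F i *: G i) = \sum_(i <- r) F i *: d21_br x (G i).
Proof.
elim: r => [|i r IH]; first by rewrite !big_nil d21_br0r.
by rewrite !big_cons d21_brrDZ IH.
Qed.

Lemma mono_brrE a l : brr_ok a l ->
  mono_eval (mono_brr a l) = d21_br (bvec a) (mono_eval l).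
Proof.
rewrite /mono_eval d21_brsr /mono_brr big_flatten big_map /=.
elim: l => [|m l IH] /=; first by rewrite !big_nil.
case/andP=> mok lok; rewrite !big_cons IH //; congr (_ + _).
rewrite big_map d21_br_basis scaler_sumr; apply: eq_big_seq => p pin.
rewrite scalerA tag_mulE; last exact: (allP mok).
by rewrite /scoef_eval rmorphM /= mulrACA.
Qed.

Lemma mono_brlE a l : brl_ok l a ->
  mono_eval (mono_brl l a) = d21_br (mono_eval l) (bvec a).
Proof.
rewrite /mono_eval d21_brsl /mono_brl big_flatten big_map /=.
elim: l => [|m l IH] /=; first by rewrite !big_nil.
case/andP=> mok lok; rewrite !big_cons IH //; congr (_ + _).
rewrite big_map d21_br_basis scaler_sumr; apply: eq_big_seq => p pin.
rewrite scalerA tag_mulE; last exact: (allP mok).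
by rewrite /scoef_eval rmorphM /= mulrACA.
Qed.

Definition skew_check : bool :=
  all (fun a => all (fun b =>
    mono_zero (mono_br a b ++
      mono_opp (basis_parity a && basis_parity b) (mono_br b a)))
    all_basis) all_basis.

Definition jacobi_check : bool :=
  all (fun a => all (fun b => all (fun c =>
    let e := basis_parity a && basis_parity b in
    [&& brr_ok a (mono_br b c), brr_ok b (mono_br a c), brl_ok (mono_br a b) c &
      mono_zero (mono_opp true (mono_brr a (mono_br b c)) ++
        (mono_brl (mono_br a b) c ++ mono_opp e (mono_brr b (mono_br a c))))])
    all_basis) all_basis) all_basis.

Definition part_check : bool :=
  all (fun a => all (fun b => all (fun m : mono =>
    basis_parity m.2 == basis_parity a (+) basis_parity b) (mono_br a b))
    all_basis) all_basis.

Fact skew_checkT : skew_check. Proof. by vm_compute. Qed.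
Fact jacobi_checkT : jacobi_check. Proof. by vm_compute. Qed.
Fact part_checkT : part_check. Proof. by vm_compute. Qed.

Lemma all_basisP (P : pred d21_basis) : all P all_basis -> forall b, P b.
Proof. by move=> /allP Pb b; apply/Pb/mem_all_basis. Qed.

Fact d21_full : (d21_part false + d21_part true)%VS = fullv.
Proof.
apply/eqP; rewrite eqEsubv subvf; apply/subvP=> x _; rewrite [x]bvec_sum.
apply: rpred_sum => b _; apply: rpredZ; have := bvec_part b.
by case: (basis_parity b); apply: subvP; rewrite ?addvSl ?addvSr.
Qed.

Fact d21_direct : (d21_part false :&: d21_part true)%VS = 0%VS.
Proof.
apply/eqP; rewrite -subv0; apply/subvP=> x.
rewrite memv_cap memv0 => /andP[/d21_partP x0 /d21_partP x1].
by apply/eqP/ffunP=> b; rewrite ffunE; case: b {x0 x1}(x0 b) (x1 b) => [p _|s]; auto.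
Qed.

Fact d21_br_part (a b : bool) x y : x \in d21_part a -> y \in d21_part b ->
  d21_br x y \in d21_part (a (+) b).
Proof.
move=> xa yb; move: x xa; apply: part_ind => [c x x' px px'||i ia].
- by rewrite d21_brlDZ rpredD ?rpredZ.
- by rewrite d21_br0l rpred0.
move: y yb; apply: part_ind => [c x x' px px'||j jb].
- by rewrite d21_brrDZ rpredD ?rpredZ.
- by rewrite d21_br0r rpred0.
rewrite -mono_brE /mono_eval big_seq; apply: rpred_sum => m mij.
have /all_basisP/(_ j)/allP/(_ m mij)/eqP :=
  all_basisP part_checkT i.
by rewrite ia jb => <-; apply/rpredZ/bvec_part.
Qed.

Fact d21_br_skew (a b : bool) x y : x \in d21_part a -> y \in d21_part b ->
  d21_br x y = - ((-1) ^+ (a && b) *: d21_br y x).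
Proof.
move=> xa yb; move: x xa; apply: part_ind => [c x x' px px'||i ia].
- rewrite d21_brlDZ d21_brrDZ px px' scalerDr opprD; congr (_ + _).
  by rewrite scalerN !scalerA mulrC.
- by rewrite d21_br0l d21_br0r scaler0 oppr0.
move: y yb; apply: part_ind => [c x x' px px'||j jb].
- rewrite d21_brlDZ d21_brrDZ px px' scalerDr opprD; congr (_ + _).
  by rewrite scalerN !scalerA mulrC.
- by rewrite d21_br0l d21_br0r scaler0 oppr0.
have /all_basisP/(_ j)/mono_zeroP := all_basisP skew_checkT i.
rewrite mono_eval_cat mono_eval_opp !mono_brE ia jb => /eqP.
by rewrite addr_eq0 => /eqP.
Qed.

Fact d21_br_jacobi (a b : bool) x y z : x \in d21_part a -> y \in d21_part b ->
  d21_br x (d21_br y z) =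
    d21_br (d21_br x y) z + (-1) ^+ (a && b) *: d21_br y (d21_br x z).
Proof.
move=> xa yb; move: x xa; apply: part_ind => [c x x' px px'||i ia].
- rewrite !(d21_brlDZ, d21_brrDZ) px px' !scalerDr addrACA; congr (_ + _ + (_ + _)).
  by rewrite !scalerA mulrC.
- by rewrite !(d21_br0l, d21_br0r) scaler0 addr0.
move: y yb; apply: part_ind => [c x x' px px'||j jb].
- rewrite !(d21_brlDZ, d21_brrDZ) px px' !scalerDr addrACA; congr (_ + _ + (_ + _)).
  by rewrite !scalerA mulrC.
- by rewrite !(d21_br0l, d21_br0r) scaler0 addr0.
rewrite [z]bvec_sum; elim/big_rec: _ => [|k w _ IH].
  by rewrite !(d21_br0l, d21_br0r) scaler0 addr0.
rewrite !(d21_brlDZ, d21_brrDZ) IH !scalerDr addrACA; congr (_ + _).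
rewrite scalerA [X in _ + X *: _]mulrC -scalerA -scalerDr; congr (_ *: _).
have /all_basisP/(_ j)/all_basisP/(_ k)/and4P[ok1 ok2 ok3 /mono_zeroP] :=
  all_basisP jacobi_checkT i.
rewrite !mono_eval_cat !mono_eval_opp !mono_brrE // mono_brlE // !mono_brE ia jb.
by rewrite expr1 scaleN1r addrC => /eqP; rewrite subr_eq0 => /eqP.
Qed.

Definition D21 : lieSuperalg K :=
  LieSuperalg d21_full d21_direct d21_br_linl d21_br_linr d21_br_part
    d21_br_skew d21_br_jacobi.

End D21.

(* Chevalley generators realizing the Cartan matrix; the simple roots are
   delta - epsilon_1 - epsilon_2 (odd), 2 epsilon_1 and 2 epsilon_2. *)
Section Chevalley.
Variables (K : numFieldType) (zeta : K).

Definition cartan_matrix : 'M[K]_3 := \matrix_(i, j)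
  nth 0 (nth [::] [:: [:: 0; 1; zeta]; [:: -1; 2; 0]; [:: -1; 0; 2]] i) j.

Definition hvec (i : axis) : D21 zeta := bvec K (inl (i, SH)).

Definition chev_e (i : 'I_3) : D21 zeta := bvec K
  (nth (inr (true, false, false)) [:: inr (true, false, false); inl (Eps1, SE); inl (Eps2, SE)] i).
Definition chev_f (i : 'I_3) : D21 zeta := bvec K
  (nth (inr (true, false, false)) [:: inr (false, true, true); inl (Eps1, SF); inl (Eps2, SF)] i).
Definition chev_h (i : 'I_3) : D21 zeta :=
  nth 0 [:: ((1 + zeta) / 2) *: hvec Delta
             + ((1 / 2) *: hvec Eps1 + (zeta / 2) *: hvec Eps2);
            hvec Eps1; hvec Eps2] i.

Local Ltac eval_br :=
  rewrite ?d21_br_basis;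
  repeat match goal with |- context [basis_br ?a ?b] =>
    let l := eval vm_compute in (basis_br a b) in
    replace (basis_br a b) with l by (vm_compute; reflexivity)
  end.

Local Ltac eval_coord :=
  rewrite ?big_cons ?big_nil /scoef_eval /tag_eval /sigma /= ?mulN1r ?scale0r ?scale1r;
  apply/ffunP; case=> [[[] []]|[[[] []] []]];
  rewrite !ffunE /= /GRing.scale /= ?NegzE; try by field.

Lemma chevalley_ef i j :
  lsa_br (chev_e i) (chev_f j) = (i == j)%:R *: chev_h i.
Proof.
case: i j => [[|[|[|//]]] ?] [[|[|[|//]]] ?]; rewrite /chev_e /chev_f /chev_h /=.
all: rewrite [LHS]d21_br_basis; eval_br; eval_coord.
Qed.

Lemma d21_lsaE (x y : D21 zeta) : lsa_br x y = d21_br zeta x y.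
Proof. by []. Qed.

Lemma d21_brlZ c (x y : D21 zeta) :
  d21_br zeta (c *: x) y = c *: d21_br zeta x y.
Proof. by rewrite -[c *: x]addr0 d21_brlDZ d21_br0l addr0. Qed.

Lemma chevalley_he i j :
  lsa_br (chev_h i) (chev_e j) = cartan_matrix i j *: chev_e j.
Proof.
case: i j => [[|[|[|//]]] ?] [[|[|[|//]]] ?];
  rewrite /chev_e /chev_f /chev_h mxE /=.
all: rewrite ?d21_lsaE ?d21_brlDZ ?d21_brlZ; eval_br; eval_coord.
Qed.

Lemma chevalley_hf i j :
  lsa_br (chev_h i) (chev_f j) = - cartan_matrix i j *: chev_f j.
Proof.
case: i j => [[|[|[|//]]] ?] [[|[|[|//]]] ?];
  rewrite /chev_e /chev_f /chev_h mxE /=.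
all: rewrite ?d21_lsaE ?d21_brlDZ ?d21_brlZ; eval_br; eval_coord.
Qed.

End Chevalley.

Section Roots.
Variables (K : numFieldType) (zeta : K).

(* The dual of the Cartan subalgebra, in coordinates with respect to the basis
   delta, epsilon_1, epsilon_2 dual to the coroots h_{2 delta}, h_{2 epsilon_1},
   h_{2 epsilon_2}. *)
Definition weight := {ffun axis -> K^o}.

Definition eps (i : axis) : weight := [ffun j => (j == i)%:R].

Definition cartan_sub : {vspace D21 zeta} := <<[seq hvec zeta i | i <- axes]>>%VS.

Definition pairing (mu : weight) (h : D21 zeta) : K :=
  \sum_(i : axis) mu i * (h : d21_car K) (inl (i, SH)).

Definition even_root (i : axis) : weight := 2 *: eps i.
Definition coroot (i : axis) : D21 zeta := hvec zeta i.

Definition even_pos_roots : seq weight := [seq even_root i | i <- axes].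
Definition odd_pos_roots : seq weight :=
  [seq eps Delta + (-1) ^+ s *: eps Eps1 + (-1) ^+ t *: eps Eps2
    | s : bool <- [:: false; true], t : bool <- [:: false; true]].

Definition rho : weight := - eps Delta + eps Eps1 + eps Eps2.

Definition srefl (i : axis) (nu : weight) : weight :=
  nu - pairing nu (coroot i) *: even_root i.

Definition ad_sub (i : axis) (alpha : weight) (x : D21 zeta) : D21 zeta :=
  lsa_br (hvec zeta i) x - alpha i *: x.

Fact ad_sub_linear i alpha : linear (ad_sub i alpha).
Proof.
move=> c x y; rewrite /ad_sub lsa_br_linr scalerBr scalerDr opprD addrACA.
by rewrite !scalerA mulrC.
Qed.
HB.instance Definition _ i alpha := GRing.isLinear.Build K (D21 zeta) (D21 zeta) _
  (ad_sub i alpha) (ad_sub_linear i alpha).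

Definition root_space (alpha : weight) : {vspace D21 zeta} :=
  (\bigcap_(i : axis) lker (linfun (ad_sub i alpha)))%VS.

Definition npos : {vspace D21 zeta} :=
  (\sum_(alpha <- even_pos_roots ++ odd_pos_roots) root_space alpha)%VS.

Definition borel_space : {vspace D21 zeta} := (cartan_sub + npos)%VS.

Definition basis_wt (b : d21_basis) (i : axis) : int :=
  match b with
  | inl (j, x) => if j == i then match x with SE => 2 | SH => 0 | SF => -2 end else 0
  | inr s => if sign_at s i then 1 else -1
  end.

Lemma hvec_br i b :
  d21_br zeta (bvec K (inl (i, SH))) (bvec K b) = (basis_wt b i)%:~R *: bvec K b.
Proof.
rewrite d21_br_basis; case: b => [[j x]|s] /=.
  rewrite eq_sym; case: eqP => [->|_]; last by rewrite big_nil scale0r.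
  by case: x; rewrite /= ?big_cons big_nil ?addr0 ?scale0r // /scoef_eval mul1r.
rewrite big_map /scoef_eval /=.
by case: i s => [] [[[] []] []]; rewrite /= big_cons big_nil addr0 mul1r.
Qed.

Lemma root_spaceP (alpha : weight) (x : D21 zeta) :
  reflect (forall i b, (basis_wt b i)%:~R * (x : d21_car K) b = alpha i * (x : d21_car K) b)
    (x \in root_space alpha).
Proof.
have E i b : (ad_sub i alpha x : d21_car K) b =
    (basis_wt b i)%:~R * (x : d21_car K) b - alpha i * (x : d21_car K) b.
  rewrite /ad_sub !ffunE; congr (_ - _).
  rewrite [x in LHS]bvec_sum [lsa_br _ _]d21_brsr sum_ffunE (bigD1 b) //=.
  rewrite big1 ?addr0 => [|c cb]; rewrite hvec_br !ffunE.
    by rewrite eqxx [RHS]mulrC [_ *: 1]mulr1.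
  by rewrite eq_sym (negPf cb) [X in _ *: X]mulr0 [LHS]mulr0.
rewrite memvE; apply: (iffP subv_bigcapP) => [xi i b|xE i _].
  have := xi i isT; rewrite -memvE memv_ker lfunE => /eqP/ffunP/(_ b).
  by rewrite E ffunE => /eqP; rewrite subr_eq0 => /eqP.
rewrite -memvE memv_ker lfunE; apply/eqP/ffunP=> b.
by rewrite [LHS]E ffunE xE subrr.
Qed.

Definition basis_weight (b : d21_basis) : weight := [ffun i => (basis_wt b i)%:~R].

Definition pos_basis : seq d21_basis :=
  [seq inl (i, SE) | i <- axes] ++
  [seq inr (true, s, t) | s <- [:: true; false], t <- [:: true; false]].

Lemma pos_rootsE :
  even_pos_roots ++ odd_pos_roots = [seq basis_weight b | b <- pos_basis].
Proof.
rewrite /even_pos_roots /odd_pos_roots /pos_basis /axes /=.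
do !congr (_ :: _); apply/ffunP; case; rewrite !ffunE /= /GRing.scale /=.
all: by rewrite ?(expr0, expr1, mulr0, mulr1, mul1r, mul0r, addr0, add0r).
Qed.

Definition sep_check : bool :=
  all (fun a => all (fun b => (b \in pos_basis) ||
    has (fun i => basis_wt b i != basis_wt a i) axes) all_basis) pos_basis.
Fact sep_checkT : sep_check. Proof. by vm_compute. Qed.

Lemma nposE : npos = bspan K (mem pos_basis).
Proof.
apply/eqP; rewrite eqEsubv; apply/andP; split.
  rewrite /npos pos_rootsE big_map big_seq.
  elim/big_ind: _ => [|U V UP VP|a ain]; first exact: sub0v.
    by rewrite subv_add UP VP.
  apply/subvP=> x /root_spaceP xa; apply/bspanP=> b bP.
  have /allP/(_ b (mem_all_basis b)) := allP sep_checkT _ ain.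
  case/orP=> [bP'|/hasP[i _ ne]]; first by rewrite [mem _ _]bP' in bP.
  have /eqP := xa i b.
  by rewrite ffunE -subr_eq0 -mulrBl -rmorphB mulf_eq0 intr_eq0 subr_eq0
    (negPf ne) => /eqP.
apply/span_subvP=> x /mapP[b]; rewrite mem_enum => bP ->{x}.
have bin : basis_weight b \in even_pos_roots ++ odd_pos_roots.
  by rewrite pos_rootsE map_f.
rewrite /npos (big_rem _ bin) /=; apply: subvP (addvSl _ _) _ _.
apply/root_spaceP=> i c; rewrite !ffunE.
by case: eqP => [->//|_]; rewrite !mulr0.
Qed.

Definition borel_basis : seq d21_basis := [seq inl (i, SH) | i <- axes] ++ pos_basis.

Lemma borelE : borel_space = bspan K (mem borel_basis).
Proof.
apply/eqP; rewrite /borel_space nposE eqEsubv; apply/andP; split.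
  rewrite subv_add; apply/andP; split; apply/span_subvP=> x /mapP[].
    by move=> i _ ->; apply: bvec_bspan; case: i.
  by move=> b; rewrite mem_enum => bP ->; apply: bvec_bspan; rewrite /= mem_cat [_ \in pos_basis]bP orbT.
apply/span_subvP=> x /mapP[b]; rewrite mem_enum [_ \in _]mem_cat => bin ->.
case/orP: bin => [/mapP[i iP ->]|bP].
  apply: subvP (addvSl _ _) _ _.
  by apply/memv_span/mapP; exists i.
by apply: subvP (addvSr _ _) _ _; apply: bvec_bspan.
Qed.

Definition borel_check : bool :=
  all (fun a => all (fun b => all (fun p : scoef * d21_basis =>
    (p.1.2 == 0) || (p.2 \in pos_basis)) (basis_br a b)) borel_basis) borel_basis.
Fact borel_checkT : borel_check. Proof. by vm_compute. Qed.

Lemma borel_br (x y : D21 zeta) :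
  x \in borel_space -> y \in borel_space -> lsa_br x y \in npos.
Proof.
rewrite borelE nposE => /bspanP xb /bspanP yb; rewrite d21_lsaE.
apply: rpred_sum => a _; apply: rpred_sum => b _.
have [ab|/xb->] := boolP (a \in borel_basis); last by rewrite mul0r scale0r rpred0.
have [bb|/yb->] := boolP (b \in borel_basis); last by rewrite mulr0 scale0r rpred0.
apply: rpredZ; rewrite big_seq; apply: rpred_sum => p pab.
have /orP[/eqP p0|pp] := allP (allP (allP borel_checkT _ ab) _ bb) _ pab.
  by rewrite /scoef_eval p0 mulr0 scale0r rpred0.
by apply/rpredZ/bvec_bspan.
Qed.

Fact borel_closed (x y : D21 zeta) :
  x \in borel_space -> y \in borel_space -> lsa_br x y \in borel_space.
Proof. by move=> xb yb; apply: subvP (addvSr _ _) _ (borel_br xb yb). Qed.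

Fact borel_graded :
  (borel_space <= (borel_space :&: lsa_part (D21 zeta) false)
                + (borel_space :&: lsa_part (D21 zeta) true))%VS.
Proof.
rewrite {1}borelE; apply/span_subvP=> x /mapP[b]; rewrite mem_enum => bb ->.
have bB : bvec K b \in borel_space by rewrite borelE; apply: bvec_bspan.
have := bvec_part K b; case: (basis_parity b) => bp.
  by apply: subvP (addvSr _ _) _ _; rewrite memv_cap bB.
by apply: subvP (addvSl _ _) _ _; rewrite memv_cap bB.
Qed.

Definition borel : subSuperalg (D21 zeta) := SubSuperalg borel_closed borel_graded.

(* The character of h + n_+ given by mu on h and by 0 on n_+. *)
Definition borel_char_fun (mu : weight) (x : subLie borel) : K^o :=
  pairing mu (vsval x).

Lemma pairing_linear mu : linear (pairing mu : D21 zeta -> K^o).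
Proof.
move=> c x y; rewrite /pairing scaler_sumr -big_split; apply: eq_bigr => i _ /=.
by rewrite !ffunE mulrDr mulrCA.
Qed.

Lemma pairing_npos mu x : x \in npos -> pairing mu x = 0.
Proof.
rewrite nposE => /bspanP xn; apply: big1 => i _; rewrite xn ?mulr0 //.
by case: i.
Qed.

Lemma pairing_odd mu x : x \in lsa_part (D21 zeta) true -> pairing mu x = 0.
Proof. by move=> /d21_partP xo; apply: big1 => i _; rewrite xo ?mulr0. Qed.

Fact borel_char_lin mu : linear (@borel_char_fun mu).
Proof. by move=> c x y; rewrite /borel_char_fun linearP pairing_linear. Qed.

Fact borel_char_br mu (a b : bool) (x y : subLie borel) :
  x \in lsa_part (subLie borel) a -> y \in lsa_part (subLie borel) b ->
  borel_char_fun mu x * borel_char_fun mu y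
    - (-1) ^+ (a && b) *: (borel_char_fun mu y * borel_char_fun mu x)
  = borel_char_fun mu (lsa_br x y).
Proof.
rewrite !sub_partE => xa yb; rewrite /borel_char_fun sub_brE.
rewrite (pairing_npos _ (borel_br (subvsP x) (subvsP y))).
case: a xa => [/pairing_odd->|xa]; first by rewrite mul0r mulr0 scaler0 subrr.
by rewrite scale1r [X in _ - X]mulrC subrr.
Qed.

Definition borel_char (mu : weight) : uenv (subLie borel) -> K^o :=
  ulift (SuperRep (borel_char_lin mu) (@borel_char_br mu)).
HB.instance Definition _ mu := GRing.RMorphism.on (borel_char mu).

Definition Verma (lambda : weight) : lmodType (uenv (D21 zeta)) :=
  indMod (@uenv_sub K (D21 zeta) borel) (oneDim (borel_char (lambda - rho))).

Definition Lirr (lambda : weight) : lmodType (uenv (D21 zeta)) :=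
  headMod (Verma lambda).

Section WeightVectors.
Variable M : lmodType (uenv (D21 zeta)).

Definition weight_vector (mu : weight) (v : M) : Prop :=
  forall h, h \in cartan_sub -> uenv_gen h *: v = (pairing mu h)%:A *: v.

Definition singular_vector (v : M) : Prop :=
  (exists mu, weight_vector mu v) /\
  forall x, x \in npos -> uenv_gen x *: v = 0.

End WeightVectors.
End Roots.

Lemma D21_dim (K : numFieldType) (zeta : K) : \dim {: D21 zeta} = 17%N.
Proof.
rewrite dimvf; transitivity (#|{: d21_basis}| * 1)%N; first by [].
by rewrite muln1 card_sum !card_prod !card_bool !cardE !enumT !unlock.
Qed.

(* With chevalley_ef, chevalley_he, chevalley_hf and D21_dim, the lemmas
   D21_generated and D21_simple identify D21 zeta as the 17-dimensional simple Lie
   superalgebra with Cartan matrix cartan_matrix zeta. *)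
Section Simplicity.
Variables (K : numFieldType) (zeta : K).
Hypotheses (zeta_neq0 : zeta != 0) (zeta_neqN1 : zeta != -1).

Lemma sigma_neq0 i : sigma zeta i != 0.
Proof.
have n2 : (2 : K) != 0 by rewrite pnatr_eq0.
case: i; rewrite /sigma mulf_neq0 ?invr_eq0 ?oner_eq0 //.
by rewrite oppr_eq0 addrC addr_eq0.
Qed.

Definition single_br (a b : d21_basis) : seq d21_basis :=
  if [seq p <- basis_br a b | p.1.2 != 0] is [:: p] then [:: p.2] else [::].

Lemma single_brP a b c (V : {vspace D21 zeta}) : c \in single_br a b ->
  d21_br zeta (bvec K a) (bvec K b) \in V -> bvec K c \in V.
Proof.
rewrite d21_br_basis /single_br.
have -> : \sum_(p <- basis_br a b) scoef_eval zeta p.1 *: bvec K p.2 =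
  \sum_(p <- [seq p <- basis_br a b | p.1.2 != 0])
    scoef_eval zeta p.1 *: bvec K p.2.
  rewrite big_filter [RHS]big_mkcond; apply: eq_bigr => p _.
  by case: eqP => // p0; rewrite /scoef_eval p0 mulr0 scale0r.
have : all (fun p : scoef * d21_basis => p.1.2 != 0)
  [seq p <- basis_br a b | p.1.2 != 0] by exact: filter_all.
case: [seq p <- _ | _] => [|p [|//]] //= /andP[p0 _].
rewrite inE => /eqP->; rewrite big_seq1 rpredZeq => /orP[|//].
rewrite /scoef_eval mulf_eq0 intr_eq0 (negPf p0) orbF.
by case: p.1.1 => [i|] /=; rewrite ?oner_eq0 ?(negPf (sigma_neq0 i)).
Qed.

Definition gen_step (l : seq d21_basis) : seq d21_basis :=
  undup (l ++ flatten [seq single_br a b | a <- l, b <- l]).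
Definition ideal_step (l : seq d21_basis) : seq d21_basis :=
  undup (l ++ flatten [seq single_br a b | a <- all_basis, b <- l]).

Definition chev_basis : seq d21_basis :=
  [:: inr (true, false, false); inl (Eps1, SE); inl (Eps2, SE);
      inr (false, true, true); inl (Eps1, SF); inl (Eps2, SF)].

Fact gen_checkT :
  all (fun b => b \in iter 6 gen_step chev_basis) all_basis.
Proof. by vm_compute. Qed.
Fact ideal_checkT :
  all (fun a => all (fun b => b \in iter 4 ideal_step [:: a]) all_basis) all_basis.
Proof. by vm_compute. Qed.

Lemma bvec_fullv (V : {vspace D21 zeta}) :
  (forall b, bvec K b \in V) -> V = fullv.
Proof.
move=> bV; apply/eqP; rewrite eqEsubv subvf; apply/subvP=> x _.
by rewrite [x]bvec_sum; apply: rpred_sum => b _; apply/rpredZ/bV.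
Qed.

Lemma D21_generated (V : {vspace D21 zeta}) :
    (forall i, chev_e zeta i \in V) -> (forall i, chev_f zeta i \in V) ->
    (forall x y, x \in V -> y \in V -> lsa_br x y \in V) ->
  V = fullv.
Proof.
move=> eV fV brV; apply: bvec_fullv => b.
suff /allP/(_ b) : all (fun c => bvec K c \in V) (iter 6 gen_step chev_basis).
  by apply; apply: (allP gen_checkT b (mem_all_basis b)).
elim: (6%N) => [|k /allP IH] /=; last first.
  apply/allP=> c; rewrite mem_undup mem_cat => /orP[/IH//|].
  case/flattenP=> s /allpairsP[[a a'] /= [/IH aV /IH a'V ->]] cs.
  exact/(single_brP cs)/brV.
by rewrite (eV 0) (eV 1) (eV 2) (fV 0) (fV 1) (fV 2).
Qed.

Definition wt_filter (l : seq (axis * int)) (d : d21_basis) : int :=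
  foldr (fun p r => (basis_wt d p.1 - p.2) * r) 1 l.

Definition wt_others (b : d21_basis) : seq (axis * int) :=
  [seq p <- [seq (i, m) | i <- axes, m <- [:: -2; -1; 0; 1; 2]]
     | basis_wt b p.1 != p.2].

Definition is_cartan (b : d21_basis) : bool := if b is inl (_, SH) then true else false.

Fact wt_checkT : all (fun b => all (fun d => (wt_filter (wt_others b) d != 0) ==
    ((d == b) || is_cartan b && is_cartan d)) all_basis) all_basis.
Proof. by vm_compute. Qed.

Lemma D21_simple (I : {vspace D21 zeta}) : I != 0%VS ->
  (forall x y, y \in I -> lsa_br x y \in I) -> I = fullv.
Proof.
move=> I0 brI.
suff [a aI] : exists a, bvec K a \in I.
  apply: bvec_fullv => b.
  suff /allP/(_ b) : all (fun c => bvec K c \in I) (iter 4 ideal_step [:: a]).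
    by apply; apply: (allP (allP ideal_checkT a (mem_all_basis a)) b (mem_all_basis b)).
  elim: (4%N) => [|k /allP IH] /=; first by rewrite aI.
  apply/allP=> c; rewrite mem_undup mem_cat => /orP[/IH//|].
  case/flattenP=> s /allpairsP[[a1 a2] /= [_ /IH a2I ->]] cs.
  exact/(single_brP cs)/brI.
have wtI l (x : D21 zeta) : x \in I -> exists2 y : D21 zeta, y \in I &
    forall d, (y : d21_car K) d = (wt_filter l d)%:~R * (x : d21_car K) d.
  move=> xI; elim: l => [|[i m] l [y yI yE]]; first by exists x => // d; rewrite mul1r.
  exists (lsa_br (hvec zeta i) y - m%:~R *: y); first by rewrite rpredB ?brI ?rpredZ.
  move=> d; rewrite !ffunE /= rmorphM rmorphB /= -mulrA -yE mulrBl; congr (_ - _).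
  rewrite [y in LHS]bvec_sum ?d21_lsaE d21_brsr sum_ffunE (bigD1 d) //=.
  rewrite big1 ?addr0 => [|c cd]; rewrite hvec_br !ffunE.
    by rewrite eqxx [RHS]mulrC [_ *: 1]mulr1.
  by rewrite eq_sym (negPf cd) [X in _ *: X]mulr0 [LHS]mulr0.
have wtE b d : (wt_filter (wt_others b) d != 0) =
    ((d == b) || is_cartan b && is_cartan d).
  have /allP/(_ d (mem_all_basis d))/eqP := allP wt_checkT b (mem_all_basis b).
  by [].
have wt0 b d : d != b -> ~~ (is_cartan b && is_cartan d) ->
    wt_filter (wt_others b) d = 0.
  by move=> /negPf db /negPf bd; apply/eqP/negbNE; rewrite wtE db bd.
have [x xI x0] : exists2 x : D21 zeta, x \in I & x != 0.
  by exists (vpick I); rewrite ?memv_pick // vpick0.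
have [b xb] : exists b, (x : d21_car K) b != 0.
  apply/existsP; apply: contraNT x0; rewrite negb_exists => /forallP xb.
  by apply/eqP/ffunP=> b; rewrite ffunE; apply/eqP; have := xb b; rewrite negbK.
have [y yI yE] := wtI (wt_others b) x xI.
have yb : (y : d21_car K) b != 0 by rewrite yE mulf_neq0 // intr_eq0 wtE eqxx.
case bH : (is_cartan b); last first.
  exists b; have : (y : d21_car K) b *: (bvec K b : D21 zeta) \in I.
    rewrite (_ : _ *: _ = y) //; apply/ffunP=> d; rewrite !ffunE.
    have [->|db] := eqVneq d b; first exact: mulr1.
    rewrite [LHS]mulr0 yE wt0 ?mul0r //.
    by rewrite bH.
  by rewrite rpredZeq (negPf yb).
case: b bH yb {xb} yE => [[i []]|//] // _ yi yE.
exists (inl (i, SE)); apply: (single_brP (a := inl (i, SE)) (b := inl (i, SH))).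
  by case: (i).
have := brI (bvec K (inl (i, SE))) y yI.
rewrite d21_lsaE [y]bvec_sum d21_brsr (bigD1 (inl (i, SH))) //= big1 ?addr0.
  by rewrite rpredZeq (negPf yi).
move=> d di; have [dH|dnH] := boolP (is_cartan d).
  case: d dH di => [[j []]|//] // _ /eqP ji.
  rewrite d21_br_basis /=; case: eqP => [ij|_]; last by rewrite big_nil scaler0.
  by case: ji; rewrite ij.
by rewrite yE wt0 ?mul0r ?scale0r //= (negPf dnH).
Qed.

End Simplicity.

(* Main.v *)
Require Import Defs.
From HB Require Import structures.
From mathcomp Require Import all_boot all_order all_algebra.
From mathcomp Require Import boolp classical_sets functions ring zify.
From mathcomp Require Import reals complex.

Set Implicit Arguments.
Unset Strict Implicit.
Unset Printing Implicit Defensive.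

Import Order.TTheory GRing.Theory Num.Theory.

Local Open Scope ring_scope.

(** Write F, f1, f2 for the negative root vectors of 2 delta, 2 epsilon_1,
    2 epsilon_2, write v for the highest weight vector of M_lambda and m_1, m_2
    for lambda_1 - 1, lambda_2 - 1, its weights at the last two coroots.  For a
    word l in the four negative odd root vectors x_{++}, x_{+-}, x_{-+}, x_{--},
    taken in this order without repetition, x_l is the product of its letters.

    The whole argument rests on the PBW basis F^a x_l f1^b f2^c v of M_lambda.
    Straightening a basis vector of the algebra against such a monomial gives a
    combination of monomials whose coefficients are polynomials in a, b, c, in
    the highest weight and in the structure constants.  That these formulas
    define a representation is a finite check on formal polynomials
    ([relation_checkT]).  A Verma module is given by generators and relations,
    so that maps out of it are at hand; therefore the transposed representation,
    on functions of the indices, is used: it yields coefficient functionals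
    ([coef]), which show that the monomials are independent ([pcoord_mon]).
    They span because commutation relations rewrite every
    product ([pmon_spanT]).

    Singular vector.  For gamma = 2 epsilon_i the root is simple and f_i^n v is
    singular.  For gamma = 2 delta and n = 0 take v.  For n > 0 write s1, s2 for
    the structure constants sigma_1, sigma_2 and put
      L = (1 - n)(s1 + s2) + m_1 s1 + m_2 s2.
    The vector
      L (2 s2 (m_2 + 1) - L) F^n v
      + n F^(n-1) [ (2 s2 m_2 - L) x_{++} x_{--} + L x_{+-} x_{-+}
                    + 2 s1 x_{++} x_{+-} f1 - 2 s2 x_{++} x_{-+} f2 ] v
      + n (n - 1) F^(n-2) x_{++} x_{+-} x_{-+} x_{--} v
    is singular, an identity between polynomials in n, m_1, m_2, s1, s2 again
    decided by computation ([delta_check]).  It never vanishes, whatever the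
    weight, because its coefficient at F^(n-1) x_{++} x_{+-} f1 v is
    2 n s1 = n, as s1 = 1/2 ([exists_singular]).  The universal property of Verma modules
    turns the singular vector into a nonzero homomorphism f ([verma_universal]).

    Multiplicity.  Let N be the largest proper submodule of the source of f.  As
    f is nonzero, its kernel lies in N, so im f / f(N) is the irreducible
    quotient of the source, and it remains to refine 0 <= f(N) < im f <= M_lambda
    to a composition series ([comp_mult_image]).  This is possible because
    M_lambda has finite length ([verma_rank]).  Indeed, the Casimir element of
    each of the three sl2 factors commutes with F, f1, f2, over which M_lambda
    is finitely generated, and it preserves the finite-dimensional weight
    spaces; hence it is annihilated on M_lambda by a nonzero polynomial
    ([casimir_killed]).  If N < P are submodules, a weight vector of P outside N
    of minimal depth is killed by e_{2 delta}, e_{2 epsilon_1}, e_{2 epsilon_2}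
    modulo N.  The three Casimir eigenvalues computed from its weight are then
    roots of these polynomials, which leaves finitely many weights and therefore
    finitely many monomials that can occur in it ([singular_box]).  So the
    dimension of the intersection of a submodule with the span of these
    monomials increases strictly with the submodule. *)

(** * Linear operators on a space of functions *)

Section DualOperators.
Variables (K : fieldType) (T : pointedType).

(** Operators that act on functions of the indices of a basis, to be used as
    transposes of operators on the span of that basis. *)
Record dualOp := DualOp {
  dual_fun :> (T -> K^o) -> T -> K^o;
  dual_lin : linear dual_fun
}.

HB.instance Definition _ := gen_eqMixin dualOp.
HB.instance Definition _ := gen_choiceMixin dualOp.

Lemma dualOpP (f g : dualOp) : (forall w t, f w t = g w t) -> f = g.
Proof.
case: f g => f fl [g gl] /= fg.
have E : f = g by apply/funext => w; apply/funext => t.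
by case: _ / E gl => gl; congr DualOp; exact: Prop_irrelevance.
Qed.

Fact dual_add_lin (f g : dualOp) : linear (fun w => f w + g w).
Proof. by move=> c w w'; rewrite !dual_lin scalerDr addrACA. Qed.
Fact dual_opp_lin (f : dualOp) : linear (fun w => - f w).
Proof. by move=> c w w'; rewrite dual_lin opprD scalerN. Qed.
Fact dual_zero_lin : linear (fun _ : T -> K^o => (0 : T -> K^o)).
Proof. by move=> c w w'; rewrite scaler0 addr0. Qed.
Fact dual_one_lin : linear (fun w : T -> K^o => w).
Proof. by []. Qed.
Fact dual_mul_lin (f g : dualOp) : linear (fun w => g (f w)).
Proof. by move=> c w w'; rewrite !dual_lin. Qed.
Fact dual_scale_lin d (f : dualOp) : linear (fun w => (d : K) *: f w).
Proof. by move=> c w w'; rewrite dual_lin scalerDr !scalerA mulrC. Qed.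

Definition dual_add f g := DualOp (dual_add_lin f g).
Definition dual_opp f := DualOp (dual_opp_lin f).
Definition dual_zero := DualOp dual_zero_lin.
Definition dual_one := DualOp dual_one_lin.

(** The product is reversed, [f * g] applying [f] first: transposition is
    then multiplicative, and the transpose of a left module is a map into
    this algebra. *)
Definition dual_mul f g := DualOp (dual_mul_lin f g).
Definition dual_scale d f := DualOp (dual_scale_lin d f).

Fact dual_addA : associative dual_add.
Proof. by move=> f g h; apply: dualOpP => w t /=; rewrite addrA. Qed.
Fact dual_addC : commutative dual_add.
Proof. by move=> f g; apply: dualOpP => w t /=; rewrite addrC. Qed.
Fact dual_add0 : left_id dual_zero dual_add.
Proof. by move=> f; apply: dualOpP => w t /=; rewrite add0r. Qed.
Fact dual_addN : left_inverse dual_zero dual_opp dual_add.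
Proof. by move=> f; apply: dualOpP => w t /=; rewrite addNr. Qed.

HB.instance Definition _ :=
  GRing.isZmodule.Build dualOp dual_addA dual_addC dual_add0 dual_addN.

Fact dual_mulA : associative dual_mul.
Proof. by move=> f g h; apply: dualOpP. Qed.
Fact dual_1mul : left_id dual_one dual_mul.
Proof. by move=> f; apply: dualOpP. Qed.
Fact dual_mul1 : right_id dual_one dual_mul.
Proof. by move=> f; apply: dualOpP. Qed.
Fact dual_mulDl : left_distributive dual_mul +%R.
Proof.
move=> f g h; apply: dualOpP => w t /=.
by have := dual_lin h 1 (f w) (g w); rewrite !scale1r => ->.
Qed.
Fact dual_mulDr : right_distributive dual_mul +%R.
Proof. by move=> f g h; apply: dualOpP. Qed.
Fact dual_1neq0 : dual_one != 0.
Proof.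
apply/eqP => E; have : dual_one (fun _ => 1) point = dual_zero (fun _ => 1) point.
  by rewrite E.
by move/eqP; rewrite oner_eq0.
Qed.

HB.instance Definition _ := GRing.Zmodule_isNzRing.Build dualOp
  dual_mulA dual_1mul dual_mul1 dual_mulDl dual_mulDr dual_1neq0.

Fact dual_scaleA c d f : dual_scale c (dual_scale d f) = dual_scale (c * d) f.
Proof. by apply: dualOpP => w t /=; rewrite scalerA. Qed.
Fact dual_scale1 : left_id 1 dual_scale.
Proof. by move=> f; apply: dualOpP => w t /=; rewrite scale1r. Qed.
Fact dual_scaleDr : right_distributive dual_scale +%R.
Proof. by move=> c f g; apply: dualOpP => w t /=; rewrite scalerDr. Qed.
Fact dual_scaleDl f : {morph dual_scale^~ f : c d / c + d}.
Proof. by move=> c d; apply: dualOpP => w t /=; rewrite scalerDl. Qed.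

HB.instance Definition _ := GRing.Zmodule_isLmodule.Build K dualOp
  dual_scaleA dual_scale1 dual_scaleDr dual_scaleDl.

Fact dual_scaleAl c (f g : dualOp) : c *: (f * g) = (c *: f) * g.
Proof.
apply: dualOpP => w t /=.
have := dual_lin g c (f w) 0; rewrite !addr0 => ->.
have := dual_lin g 0 0 0; rewrite !scale0r !addr0 add0r => g0.
by have := dual_lin g 1 0 0; rewrite !scale1r !addr0 => /eqP; rewrite -subr_eq0 opprD addNKr
  oppr_eq0 => /eqP->; rewrite addr0.
Qed.
HB.instance Definition _ := GRing.Lmodule_isLalgebra.Build K dualOp dual_scaleAl.

Fact dual_scaleAr c (f g : dualOp) : c *: (f * g) = f * (c *: g).
Proof. by apply: dualOpP. Qed.
HB.instance Definition _ := GRing.Lalgebra_isAlgebra.Build K dualOp dual_scaleAr.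

End DualOperators.

(** * The straightening algorithm *)

Section FormalSums.
Implicit Types I J : eqType.

(** Integer combinations are plain lists, with repetitions allowed, so that
    every operation computes and an identity is decided by normalizing one
    list. *)
Definition fsum I : Type := seq (int * I).

Definition fscale I (n : int) (s : fsum I) : fsum I :=
  [seq (n * t.1, t.2) | t <- s].

Definition fmap I J (f : I -> J) (s : fsum I) : fsum J :=
  [seq (t.1, f t.2) | t <- s].

Definition fbind I J (f : I -> fsum J) (s : fsum I) : fsum J :=
  flatten [seq fscale t.1 (f t.2) | t <- s].

Fixpoint fadd1 I (t : int * I) (s : fsum I) : fsum I :=
  if s is u :: s' then
    if u.2 == t.2 then (u.1 + t.1, u.2) :: s' else u :: fadd1 t s'
  else [:: t].

Definition fnorm I (s : fsum I) : fsum I :=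
  [seq t <- foldr (@fadd1 I) [::] s | t.1 != 0].

Variable R : pzRingType.

Definition feval I (F : I -> R) (s : fsum I) : R :=
  \sum_(t <- s) t.1%:~R * F t.2.

Lemma eq_feval I (F G : I -> R) s : F =1 G -> feval F s = feval G s.
Proof. by move=> FG; apply: eq_bigr => t _; rewrite FG. Qed.

Lemma feval_cat I (F : I -> R) s s' : feval F (s ++ s') = feval F s + feval F s'.
Proof. exact: big_cat. Qed.

Lemma feval1 I (F : I -> R) i : feval F [:: (1, i)] = F i.
Proof. by rewrite /feval big_seq1 mul1r. Qed.

Lemma feval_scale I (F : I -> R) n s : feval F (fscale n s) = n%:~R * feval F s.
Proof.
rewrite /feval big_map mulr_sumr; apply: eq_bigr => t _ /=.
by rewrite intrM mulrA.
Qed.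

Lemma feval_map I J (f : I -> J) (F : J -> R) s :
  feval F (fmap f s) = feval (F \o f) s.
Proof. exact: big_map. Qed.

Lemma feval_bind I J (f : I -> fsum J) (F : J -> R) s :
  feval F (fbind f s) = feval (fun i => feval F (f i)) s.
Proof.
rewrite /feval /fbind big_flatten big_map; apply: eq_bigr => t _.
exact: feval_scale.
Qed.

Lemma feval_add1 I (F : I -> R) t s :
  feval F (fadd1 t s) = t.1%:~R * F t.2 + feval F s.
Proof.
elim: s => [|u s IH] /=; first by rewrite /feval big_seq1 big_nil addr0.
rewrite /feval; case: eqP => [ut|_]; rewrite !big_cons /=.
  by rewrite -ut intrD mulrDl addrA [X in X + _]addrC.
by rewrite -/(feval _ _) IH addrCA.
Qed.

Lemma feval_norm I (F : I -> R) s : feval F (fnorm s) = feval F s.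
Proof.
rewrite /fnorm /feval big_filter big_mkcond /=.
transitivity (feval F (foldr (@fadd1 I) [::] s)).
  by apply: eq_bigr => t _; case: eqP => // ->; rewrite mul0r.
elim: s => [|t s IH] /=; first by [].
by rewrite feval_add1 IH [RHS]big_cons.
Qed.

End FormalSums.

(** A monomial is the list of its variables. Variables 0, 1, 2 stand for the
    exponents a, b, c of F, f1, f2; variables 3, 4, 5 for the highest weight
    at the coroots of 2 delta, 2 epsilon_1, 2 epsilon_2; variables 6, 7 for
    sigma_1 and sigma_2, while sigma_delta = - sigma_1 - sigma_2. *)
Definition monomial : Type := seq nat.
HB.instance Definition _ := Equality.on monomial.
Definition scalar_poly : Type := fsum monomial.

Definition pint (n : int) : scalar_poly := [:: (n, [::])].
Definition pvar (i : nat) : scalar_poly := [:: (1, [:: i])].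
Definition pmul (p q : scalar_poly) : scalar_poly := fbind (fun m => fmap (cat m) q) p.

Definition psubst (f : nat -> scalar_poly) (m : monomial) : scalar_poly :=
  foldr (fun i => pmul (f i)) (pint 1) m.

Definition letter : Type := (bool * bool)%type.
Definition letters : seq letter :=
  [:: (true, true); (true, false); (false, true); (false, false)].

(** The increasing words on [s], one for each subset of letters. *)
Definition words_of (s : seq letter) : seq (seq letter) :=
  foldr (fun u ws => map (cons u) ws ++ ws) [:: [::]] s.
Definition words : seq (seq letter) := words_of letters.

Definition expo : Type := (int * int * int)%type.

(** Exponents are integers, so that shifts compose without truncation. The
    coefficients produced by straightening vanish whenever an exponent would
    become negative. *)
Definition pbw : Type := (expo * seq letter)%type.
HB.instance Definition _ := Choice.on expo.
HB.instance Definition _ := Choice.on pbw.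
HB.instance Definition _ := isPointed.Build pbw ((0, 0, 0), [::]).

Definition addx (d d' : expo) : expo :=
  (d.1.1 + d'.1.1, d.1.2 + d'.1.2, d.2 + d'.2).

Definition sym_vect : Type := fsum (monomial * pbw)%type.

Definition vkey (d : expo) (l : seq letter) : sym_vect := [:: (1, ([::], (d, l)))].
Definition vmul (p : scalar_poly) (V : sym_vect) : sym_vect :=
  fbind (fun m => fmap (fun t => (m ++ t.1, t.2)) V) p.
Definition vshift (d : expo) (V : sym_vect) : sym_vect :=
  fmap (fun t => (t.1, (addx d t.2.1, t.2.2))) V.

Definition vnorm (V : sym_vect) : sym_vect :=
  fnorm (fmap (fun t => (sort leq t.1, t.2)) V).

Definition expo0 : expo := (0, 0, 0).

Definition scoef_poly (c : scoef) : scalar_poly :=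
  match c.1 with
  | None => pint c.2
  | Some Delta => [:: (- c.2, [:: 6%N]); (- c.2, [:: 7%N])]
  | Some Eps1 => [:: (c.2, [:: 6%N])]
  | Some Eps2 => [:: (c.2, [:: 7%N])]
  end.

Definition odd_neg (u : letter) : d21_basis := inr (false, u.1, u.2).
Definition fdelta : d21_basis := inl (Delta, SF).

(** The product x_u x_l for an increasing word l. The bracket of two negative
    odd vectors is a multiple of F, which is central among the negative
    vectors and therefore goes to the front as a shift of the first exponent. *)
Fixpoint odd_mul (u : letter) (l : seq letter) : sym_vect :=
  if l is h :: l' then
    if (index u letters < index h letters)%N then vkey expo0 (u :: l)
    else if u == h then [::]
    else fscale (-1) (fmap (fun t => (t.1, (t.2.1, h :: t.2.2))) (odd_mul u l')) ++
         flatten [seq vmul (scoef_poly c.1) (vkey (1, 0, 0) l')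
                 | c <- basis_br (odd_neg u) (odd_neg h)]
  else vkey expo0 [:: u].

(** The action on f1^b f2^c v, with e f^b v = b (m - b + 1) f^(b-1) v in sl2. *)
Definition act_nil (z : d21_basis) : sym_vect :=
  match z with
  | inl (Delta, SF) => vkey (1, 0, 0) [::]
  | inl (Eps1, SF) => vkey (0, 1, 0) [::]
  | inl (Eps2, SF) => vkey (0, 0, 1) [::]
  | inl (Delta, SH) => [:: (1, ([:: 3%N], (expo0, [::])))]
  | inl (Eps1, SH) => [:: (1, ([:: 4%N], (expo0, [::]))); (- 2%:Z, ([:: 1%N], (expo0, [::])))]
  | inl (Eps2, SH) => [:: (1, ([:: 5%N], (expo0, [::]))); (- 2%:Z, ([:: 2%N], (expo0, [::])))]
  | inl (Delta, SE) => [::]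
  | inl (Eps1, SE) => vmul [:: (1, [:: 1%N; 4%N]); (-1, [:: 1%N; 1%N]); (1, [:: 1%N])]
                        (vkey (0, -1, 0) [::])
  | inl (Eps2, SE) => vmul [:: (1, [:: 2%N; 5%N]); (-1, [:: 2%N; 2%N]); (1, [:: 2%N])]
                        (vkey (0, 0, -1) [::])
  | inr (e, s, t) => if e then [::] else vkey expo0 [:: (s, t)]
  end.

(** Moves [z] past the first letter by z x_h = (+-) x_h z + [z, x_h]. *)
Fixpoint act_word (z : d21_basis) (l : seq letter) : sym_vect :=
  if l is h :: l' then
    fscale (if basis_parity z then -1 else 1)
      (fbind (fun t => vmul [:: (1, t.1)] (vshift t.2.1 (odd_mul h t.2.2))) (act_word z l'))
    ++ flatten [seq vmul (scoef_poly c.1) (act_word c.2 l') | c <- basis_br z (odd_neg h)]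
  else act_nil z.

(** The action on F^a x_l f1^b f2^c v, from the expansion z F^a = F^a z + a
    F^(a-1) [z, F] + a (a-1) / 2 F^(a-2) [[z, F], F]. The last bracket is
    nonzero for z = e_{2 delta} only, where it is - 2 F. *)
Definition straighten (z : d21_basis) (l : seq letter) : sym_vect :=
  if l \in words then
    vnorm (act_word z l ++
      flatten [seq vmul (pmul (pvar 0) (scoef_poly c.1)) (vshift (-1, 0, 0) (act_word c.2 l))
              | c <- basis_br z fdelta] ++
      (if z is inl (Delta, SE) then
         vmul [:: (-1, [:: 0%N; 0%N]); (1, [:: 0%N])] (vkey (-1, 0, 0) l) else [::]))
  else [::].

(** Tabulated once, since the verification of the bracket relations looks up
    every entry many times. *)
Definition act_table := Eval vm_compute in
  [seq (z, [seq (l, straighten z l) | l <- words]) | z <- all_basis].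
Definition act (z : d21_basis) (l : seq letter) : sym_vect :=
  let r := nth (z, [::]) act_table (index z all_basis) in
  (nth ([::], [::]) r.2 (index l (map fst r.2))).2.

Definition pconst (n : int) : scalar_poly := if n == 0 then [::] else pint n.
Definition shift_var (d : expo) (i : nat) : scalar_poly :=
  pvar i ++ pconst match i with
            | 0 => d.1.1 | 1 => d.1.2 | 2 => d.2 | _ => 0 end.

(** The coefficients of [act] are polynomials in the exponents of the
    monomial acted upon, so each term of [V] reads them at its own shifted
    exponents. *)
Definition act_vect (z : d21_basis) (V : sym_vect) : sym_vect :=
  fbind (fun t => vmul [:: (1, t.1)]
    (vshift t.2.1 (fbind (fun t' => vmul (psubst (shift_var t.2.1) t'.1) [:: (1, ([::], t'.2))])
                     (act z t.2.2)))) V.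

Definition relation (x y : d21_basis) (l : seq letter) : sym_vect :=
  act_vect x (act y l) ++
  fscale (if basis_parity x && basis_parity y then 1 else -1) (act_vect y (act x l)) ++
  fscale (-1) (flatten [seq vmul (scoef_poly c.1) (act c.2 l) | c <- basis_br x y]).

(** By skew-symmetry of the bracket, one order of each pair suffices. *)
Fixpoint pairs_le (T : Type) (s : seq T) : seq (T * T) :=
  if s is x :: s' then [seq (x, y) | y <- s] ++ pairs_le s' else [::].
Definition relation_check : bool :=
  all (fun xy => all (fun l => vnorm (relation xy.1 xy.2 l) == [::]) words)
    (pairs_le all_basis).
Fact relation_checkT : relation_check. Proof. by vm_compute. Qed.

(** * Bracket relations of the straightened action *)

Section Model.
Variables (K : numFieldType) (zeta : K) (mu : weight K).

Definition env (d : expo) (i : nat) : K :=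
  nth 0 [:: d.1.1%:~R; d.1.2%:~R; d.2%:~R; mu Delta; mu Eps1; mu Eps2;
            sigma zeta Eps1; sigma zeta Eps2] i.
Definition meval (d : expo) (m : monomial) : K := \prod_(i <- m) env d i.
Definition peval (d : expo) (p : scalar_poly) : K := feval (meval d) p.
Definition veval (w : pbw -> K) (d : expo) (V : sym_vect) : K :=
  feval (fun t => meval d t.1 * w (addx d t.2.1, t.2.2)) V.

Lemma meval_cat d m m' : meval d (m ++ m') = meval d m * meval d m'.
Proof. exact: big_cat. Qed.

Lemma peval_cat d p q : peval d (p ++ q) = peval d p + peval d q.
Proof. exact: feval_cat. Qed.

Lemma peval_mul d p q : peval d (pmul p q) = peval d p * peval d q.
Proof.
rewrite /peval feval_bind [RHS]mulr_suml; apply: eq_bigr => t _.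
rewrite -mulrA; congr (_ * _); rewrite feval_map /feval mulr_sumr.
by apply: eq_bigr => u _ /=; rewrite meval_cat mulrCA.
Qed.

Lemma veval_cat w d V V' : veval w d (V ++ V') = veval w d V + veval w d V'.
Proof. exact: feval_cat. Qed.

Lemma veval_key w d e l : veval w d (vkey e l) = w (addx d e, l).
Proof. by rewrite /veval feval1 /meval big_nil mul1r. Qed.

Lemma veval_mul w d p V : veval w d (vmul p V) = peval d p * veval w d V.
Proof.
rewrite /veval feval_bind [RHS]mulr_suml; apply: eq_bigr => t _.
rewrite -mulrA; congr (_ * _); rewrite feval_map /feval mulr_sumr.
by apply: eq_bigr => u _ /=; rewrite meval_cat -mulrA mulrCA.
Qed.

Lemma veval_norm w d V : veval w d (vnorm V) = veval w d V.
Proof.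
rewrite /veval feval_norm feval_map; apply: eq_feval => t /=; congr (_ * _).
by apply: perm_big; rewrite perm_sort.
Qed.

Lemma veval_flatten w d (I : Type) (r : seq I) F :
  veval w d (flatten [seq F i | i <- r]) = \sum_(i <- r) veval w d (F i).
Proof.
elim: r => [|i r IH] /=; first by rewrite /veval /feval !big_nil.
by rewrite veval_cat IH big_cons.
Qed.

Lemma veval_scale w d n V : veval w d (fscale n V) = n%:~R * veval w d V.
Proof. exact: feval_scale. Qed.

Lemma veval_lin c w w' d V :
  veval (fun k => c * w k + w' k) d V = c * veval w d V + veval w' d V.
Proof.
rewrite /veval /feval mulr_sumr -big_split; apply: eq_bigr => t _ /=.
by rewrite mulrDr mulrDr; congr (_ + _); ring.
Qed.

Lemma peval_int d n : peval d (pint n) = n%:~R.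
Proof. by rewrite /peval /feval big_seq1 /meval big_nil mulr1. Qed.

Lemma peval_const d n : peval d (pconst n) = n%:~R.
Proof.
by rewrite /pconst; case: eqP => [->|_]; rewrite ?peval_int // /peval /feval big_nil.
Qed.

Lemma peval_var d i : peval d (pvar i) = env d i.
Proof. by rewrite /peval feval1 /meval big_seq1. Qed.

Lemma peval_shift d e i : peval d (shift_var e i) = env (addx d e) i.
Proof.
rewrite peval_cat peval_var peval_const /env.
by case: i => [|[|[|i]]] /=; rewrite ?intrD ?addr0.
Qed.

Lemma peval_subst d e m : peval d (psubst (shift_var e) m) = meval (addx d e) m.
Proof.
elim: m => [|i m IH] /=; first by rewrite peval_int /meval big_nil.
by rewrite peval_mul IH peval_shift /meval big_cons.
Qed.

Lemma scoef_polyE d c : peval d (scoef_poly c) = scoef_eval zeta c.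
Proof.
case: c => [[[]|] n]; rewrite /scoef_poly /scoef_eval /=; last by rewrite peval_int mul1r.
all: rewrite /peval /feval !big_cons big_nil /meval !big_cons !big_nil /env /=.
2,3: by rewrite addr0 mulr1 mulrC.
have -> : - (1 + zeta) / 2 = - (1 / 2) - zeta / 2 by field.
by rewrite intrN; ring.
Qed.

Lemma addxA d e f : addx d (addx e f) = addx (addx d e) f.
Proof. by rewrite /addx /= !addrA. Qed.

Lemma addx0 d : addx d (0, 0, 0) = d.
Proof. by case: d => [[a b] c]; rewrite /addx /= !addr0. Qed.

(** The transpose of the straightened action: the value at a monomial is the
    pairing of [w] with the image of that monomial. *)
Definition dual_act_fun (z : d21_basis) (w : pbw -> K^o) : pbw -> K^o :=
  fun k => veval w k.1 (act z k.2).

Fact dual_act_lin z : linear (dual_act_fun z).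
Proof.
move=> c w w'; apply/funext => k; exact: veval_lin.
Qed.

Definition dual_act (z : d21_basis) : dualOp K pbw := DualOp (dual_act_lin z).

(** Transposition reverses composition: this turns a relation between formal
    combinations into one between transposed operators. *)
Lemma veval_act z w d V : veval (dual_act z w) d V = veval w d (act_vect z V).
Proof.
rewrite /veval feval_bind; apply: eq_feval => -[m [e l]] /=.
rewrite -/(veval _ _ _) veval_mul /peval feval1; congr (_ * _).
rewrite /dual_act_fun /= /veval feval_map feval_bind; apply: eq_feval => -[m' [e' l']] /=.
rewrite feval_bind /= /peval -[meval (addx d e) m']peval_subst /peval /feval mulr_suml.
apply: eq_bigr => t _ /=; rewrite big_seq1 /= mul1r -mulrA; congr (_ * _).
by rewrite meval_cat /meval big_nil mulr1 addxA.
Qed.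

Lemma act_out z l : l \notin words -> act z l = [::].
Proof.
move=> lw; rewrite /act; set r := nth (z, [::]) act_table _.
have rl : map fst r.2 = words.
  have : all (fun z => map fst (nth (z, [::]) act_table (index z all_basis)).2 == words)
    all_basis by vm_compute.
  by move=> /allP/(_ z (mem_all_basis z))/eqP.
rewrite nth_default // -(size_map fst) leqNgt index_mem rl //.
Qed.

Lemma pairs_leP (T : eqType) (s : seq T) x y : x \in s -> y \in s ->
  (x, y) \in pairs_le s \/ (y, x) \in pairs_le s.
Proof.
elim: s => // z s IH; rewrite [pairs_le _]/= !inE => /predU1P[->|xs] /predU1P[->|ys].
- by left; rewrite eqxx.
- by left; rewrite mem_cat map_f ?orbT.
- by right; rewrite mem_cat map_f ?orbT.
- by have [h|h] := IH xs ys; [left|right]; rewrite mem_cat h !orbT.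
Qed.

(** The polynomial identity holds identically in a, b, c, hence at any
    exponents; for words outside the list the table is empty. *)
Lemma relation_eval w d x y l : (x, y) \in pairs_le all_basis ->
  veval w d (relation x y l) = 0.
Proof.
move=> xy; have [lw|lw] := boolP (l \in words).
  have /allP/(_ l lw)/eqP E := allP relation_checkT _ xy.
  by rewrite -veval_norm E /veval /feval big_nil.
rewrite /relation !act_out // veval_cat veval_cat !veval_scale.
rewrite [X in _ + (_ + _ * X)]veval_flatten.
rewrite big1 => [|c _]; last by rewrite act_out // veval_mul /veval /feval big_nil mulr0.
by rewrite /act_vect /fbind /= /veval /feval !big_nil !(mulr0, addr0).
Qed.

Definition rep_fun (x : D21 zeta) : dualOp K pbw :=
  \sum_b (x : d21_car K) b *: dual_act b.

Lemma rep_lin : linear rep_fun.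
Proof.
move=> c x y; rewrite /rep_fun scaler_sumr -big_split; apply: eq_bigr => b _ /=.
by rewrite !ffunE scalerDl scalerA.
Qed.

HB.instance Definition _ := GRing.isLinear.Build K (D21 zeta) (dualOp K pbw) _ rep_fun rep_lin.

Lemma rep_bvec b : rep_fun (bvec K b) = dual_act b.
Proof.
rewrite /rep_fun (bigD1 b) //= big1 => [|c cb]; last first.
  by rewrite ffunE (negPf cb) scale0r.
by rewrite ffunE eqxx scale1r addr0.
Qed.

Lemma dual_sumE (I : Type) (r : seq I) (F : I -> dualOp K pbw) w k :
  (\sum_(i <- r) F i) w k = \sum_(i <- r) F i w k.
Proof. by elim: r => [|i r IH]; rewrite ?big_nil // !big_cons -IH. Qed.

Lemma act_relation_le (x y : d21_basis) : (x, y) \in pairs_le all_basis ->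
  dual_act x * dual_act y - (-1) ^+ (basis_parity x && basis_parity y) *: (dual_act y *
    dual_act x)
    = rep_fun (d21_br zeta (bvec K x) (bvec K y)).
Proof.
move=> xy; rewrite d21_br_basis [RHS](linear_sum rep_fun).
under [RHS]eq_bigr => p _ do rewrite linearZ /= rep_bvec.
apply/eqP; rewrite -subr_eq0; apply/eqP/dualOpP => w [d l].
have := relation_eval w d l xy.
rewrite /relation !veval_cat !veval_scale -!veval_act veval_flatten => E.
change (dual_act y (dual_act x w) (d, l) - (-1) ^+ (basis_parity x && basis_parity y) *
  dual_act x (dual_act y w) (d, l)
  - (\sum_(p <- basis_br x y) scoef_eval zeta p.1 *: dual_act p.2) w (d, l) = 0).
rewrite -[RHS]E -addrA; congr (_ + (_ + _)).
  by case: (_ && _); rewrite ?expr1 ?mulN1r ?mul1r ?opprK.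
rewrite dual_sumE mulN1r; congr (- _); apply: eq_bigr => p _.
by rewrite veval_mul (scoef_polyE d).
Qed.

Lemma act_relation (x y : d21_basis) :
  dual_act x * dual_act y - (-1) ^+ (basis_parity x && basis_parity y) *: (dual_act y *
    dual_act x)
    = rep_fun (d21_br zeta (bvec K x) (bvec K y)).
Proof.
case: (pairs_leP (mem_all_basis x) (mem_all_basis y)) => [/act_relation_le//|yx].
have := act_relation_le yx.
rewrite (d21_br_skew zeta (bvec_part K x) (bvec_part K y)) (linearN rep_fun) (linearZZ rep_fun)
  /= => <-.
rewrite [basis_parity y && _]andbC scalerBr scalerA -expr2 sqrr_sign scale1r.
by rewrite opprB.
Qed.

Fact rep_br (a b : bool) (x y : D21 zeta) :
  x \in lsa_part (D21 zeta) a -> y \in lsa_part (D21 zeta) b ->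
  rep_fun x * rep_fun y - (-1) ^+ (a && b) *: (rep_fun y * rep_fun x)
    = rep_fun (lsa_br x y).
Proof.
move=> xa yb; move: x xa; apply: part_ind => [c x x' px px'||i ia].
- rewrite lsa_br_linl !linearP /= -px -px' mulrDl mulrDr -scalerAl -scalerAr.
  rewrite !scalerDr scalerN !scalerA mulrC opprD !addrA; congr (_ - _).
  by rewrite addrAC.
- by rewrite [lsa_br _ _]d21_br0l !linear0 mul0r mulr0 scaler0 subr0.
move: y yb; apply: part_ind => [c y y' py py'||j jb].
- rewrite lsa_br_linr !linearP /= -py -py' mulrDl mulrDr -scalerAl -scalerAr.
  rewrite !scalerDr scalerN !scalerA mulrC opprD !addrA; congr (_ - _).
  by rewrite addrAC.
- by rewrite [lsa_br _ _]d21_br0r !linear0 mul0r mulr0 scaler0 subr0.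
by rewrite !rep_bvec -ia -jb; exact: act_relation.
Qed.

(** The transposed PBW module, as a map from the enveloping algebra. *)
Definition pbwRep : superRep (D21 zeta) (dualOp K pbw) := SuperRep rep_lin rep_br.

End Model.

(** * Induced modules, spans over the ground field, enveloping algebras *)

Section IndLift.
Variables (A B : pzRingType) (phi : {rmorphism B -> A}) (N : lmodType B).
Variables (X : zmodType) (h : A -> N -> X).
Hypotheses (hDl : forall a a' n, h (a + a') n = h a n + h a' n)
  (hDr : forall a n n', h a (n + n') = h a n + h a n')
  (h_bal : forall a b n, h (a * phi b) n = h a (b *: n)).

Fixpoint teval (s : tterm A N) : X :=
  match s with
  | TZero => 0
  | TPure a n => h a n
  | TOpp s => - teval s
  | TAdd s t => teval s + teval t
  end.

Lemma teval_eqv s t : teqv phi s t -> teval s = teval t.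
Proof.
elim=> {s t} //=; do ?by move=> *; congruence.
- by move=> s t u; rewrite addrA.
- by move=> s t; rewrite addrC.
- by move=> s; rewrite add0r.
- by move=> s; rewrite addNr.
Qed.

(** The additive map out of an induced module given by a balanced biadditive
    [h]. *)
Definition ind_lift (u : indMod phi N) : X := teval (repr u).

Lemma ind_lift_pi s : ind_lift (ind_pi phi s) = teval s.
Proof. by apply: teval_eqv; apply: trepr_pi. Qed.

Fact ind_lift_zmod : zmod_morphism ind_lift.
Proof.
move=> u v; rewrite -[u]treprK -[v]treprK.
by rewrite -tpi_oppr -tpi_addr !ind_lift_pi.
Qed.

Lemma ind_lift_act (k : A -> X -> X) :
    (forall a, k a 0 = 0) -> (forall a x, k a (- x) = - k a x) ->
    (forall a x y, k a (x + y) = k a x + k a y) ->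
    (forall a a' n, h (a * a') n = k a (h a' n)) ->
  forall a u, ind_lift (a *: u) = k a (ind_lift u).
Proof.
move=> k0 kN kD kh a u; rewrite -[u]treprK.
rewrite (_ : a *: _ = ind_pi phi (tact a (repr u))) ?ind_lift_pi; last first.
  by rewrite tpi_act.
by elim: (repr u) => /= [|a' n|s IH|s IHs t IHt]; rewrite ?IH ?IHs ?IHt.
Qed.

End IndLift.

Lemma ind_mod_ind (A B : pzRingType) (phi : {rmorphism B -> A}) (N : lmodType B)
    (P : indMod phi N -> Prop) :
    P 0 -> (forall u, P u -> P (- u)) -> (forall u v, P u -> P v -> P (u + v)) ->
    (forall a n, P (ind_pure phi a n)) ->
  forall u, P u.
Proof.
move=> P0 PN PD Pp u; rewrite -[u]treprK.
elim: (repr u) => // [s IH|s IHs t IHt]; first by rewrite [ind_pi _ _]tpi_oppr; exact: PN.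
by rewrite tpi_addr; exact: PD.
Qed.

Section KSpan.
Variables (K : fieldType) (U : algType K) (M : lmodType U).
Implicit Types (P G : M -> Prop).

(** [M] is a module over [U] only; the ground field acts through the scalars
    [c%:A], and [ksub] says that [P] is a subspace for this action. *)
Definition ksub P : Prop :=
  P 0 /\ forall (c : K) x y, P x -> P y -> P (c%:A *: x + y).

Lemma ksubD P x y : ksub P -> P x -> P y -> P (x + y).
Proof. by case=> _ Pl Px Py; have := Pl 1 x y Px Py; rewrite !scale1r. Qed.

Lemma ksubZ P c x : ksub P -> P x -> P (c%:A *: x).
Proof. by case=> P0 Pl Px; have := Pl c x 0 Px P0; rewrite addr0. Qed.

Lemma ksubN P x : ksub P -> P x -> P (- x).
Proof. by move=> kP Px; rewrite -scaleN1r -scaleN1r; exact: ksubZ. Qed.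

Lemma ksub_sum P (I : eqType) (r : seq I) (F : I -> M) :
  ksub P -> (forall i, i \in r -> P (F i)) -> P (\sum_(i <- r) F i).
Proof.
move=> kP PF; rewrite big_seq; elim/big_ind: _ => //; first by case: kP.
by move=> x y; exact: ksubD.
Qed.

Lemma kscaleC (c : K) (u : U) (x : M) : u *: (c%:A *: x) = c%:A *: (u *: x).
Proof. by rewrite !scalerA mulr_algr mulr_algl. Qed.

Lemma kscaleA (c d : K) (x : M) : c%:A *: (d%:A *: x) = (c * d)%:A *: x.
Proof. by rewrite scalerA mulr_algl scalerA. Qed.

Lemma kscale_alg (c : K) (u : U) (x : M) : (c *: u) *: x = c%:A *: (u *: x).
Proof. by rewrite scalerA mulr_algl. Qed.

(** The span as the intersection of all subspaces that contain the
    generators: unfolding it is the induction principle of the span. *)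
Definition kspan G x : Prop :=
  forall P, ksub P -> (forall g, G g -> P g) -> P x.

Lemma kspan_gen G x : G x -> kspan G x.
Proof. by move=> Gx P _; apply. Qed.

Lemma kspan_ksub G : ksub (kspan G).
Proof.
split=> [P [P0 _] _|c x y Gx Gy P kP PG]; first by [].
by case: (kP) => _; apply; [apply: Gx|apply: Gy].
Qed.

Lemma kspan_act G G' (u : U) :
  (forall g, G g -> kspan G' (u *: g)) -> forall x, kspan G x -> kspan G' (u *: x).
Proof.
move=> uG x Gx; apply: (Gx (fun x => kspan G' (u *: x))) => //.
have [k0 kl] := kspan_ksub G'.
split=> [|c y z Py Pz]; first by rewrite scaler0.
by rewrite scalerDr kscaleC; exact: kl.
Qed.

End KSpan.

Section EnvelopingFacts.
Variables (K : fieldType) (g : lieSuperalg K).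

Lemma uenv_constE (c : K) : uenv_pi (UConst g c) = c%:A.
Proof.
have -> : c%:A = uenv_pi (UConst g c) * 1 :> uenv g by [].
by rewrite mulr1.
Qed.

Lemma ulift_const (A : algType K) (f : superRep g A) (c : K) :
  ulift f c%:A = c%:A.
Proof. by rewrite -uenv_constE ulift_pi. Qed.

Lemma uenv_ind (P : uenv g -> Prop) :
    (forall x, P (uenv_gen x)) -> (forall c : K, P c%:A) ->
    (forall u v, P u -> P v -> P (u + v)) ->
    (forall u v, P u -> P v -> P (u * v)) ->
  forall u, P u.
Proof.
move=> Pg Pc PD PM u; rewrite -[u]ureprK.
elim: (repr u) => [x|c|s IHs t IHt|s IHs t IHt].
- exact: Pg.
- by rewrite uenv_constE.
- by rewrite upi_addr; exact: PD.
- by rewrite upi_mulr; exact: PM.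
Qed.

End EnvelopingFacts.

(** * Root vectors acting on a module *)

Section EnvelopingD21.
Variables (K : numFieldType) (zeta : K).

Definition X (b : d21_basis) : uenv (D21 zeta) :=
  uenv_gen (bvec K b : D21 zeta).

Lemma X_mul a b : X a * X b =
  (-1) ^+ (basis_parity a && basis_parity b) *: (X b * X a) +
  \sum_(p <- basis_br a b) scoef_eval zeta p.1 *: X p.2.
Proof.
have E := @uenv_gen_br K (D21 zeta) _ _ _ _ (bvec_part K a) (bvec_part K b).
have -> : \sum_(p <- basis_br a b) scoef_eval zeta p.1 *: X p.2 =
    uenv_gen (lsa_br (bvec K a : D21 zeta) (bvec K b : D21 zeta)).
  rewrite [lsa_br _ _]d21_br_basis [RHS](linear_sum (@uenv_gen K (D21 zeta))).
  by apply: eq_bigr => p _; rewrite linearZ.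
by rewrite -E addrC subrK.
Qed.

Lemma X_sum (x : D21 zeta) : uenv_gen x = \sum_b (x : d21_car K) b *: X b.
Proof.
rewrite {1}[x]bvec_sum [LHS](linear_sum (@uenv_gen K (D21 zeta))).
by apply: eq_bigr => b _; rewrite linearZ.
Qed.

Lemma X_act (M : lmodType (uenv (D21 zeta))) a b (m : M) :
  X a *: (X b *: m) =
  ((-1) ^+ (basis_parity a && basis_parity b))%:A *: (X b *: (X a *: m)) +
  \sum_(p <- basis_br a b) (scoef_eval zeta p.1)%:A *: (X p.2 *: m).
Proof.
rewrite scalerA X_mul scalerDl kscale_alg !scalerA; congr (_ + _).
by rewrite scaler_suml; apply: eq_bigr => p _; rewrite kscale_alg.
Qed.

Lemma sum_axis (V : nmodType) (F : axis -> V) :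
  \sum_i F i = F Delta + (F Eps1 + F Eps2).
Proof.
rewrite (bigD1 Delta) //= (bigD1 Eps1) //= (bigD1 Eps2) //= big1 ?addr0 //.
by case.
Qed.

(** Reduces statements about weights to the three coroots. *)
Lemma cartanE (h : D21 zeta) : h \in cartan_sub zeta ->
  h = \sum_i (h : d21_car K) (inl (i, SH)) *: hvec zeta i.
Proof.
move=> hC.
have /bspanP h0 : h \in bspan K (mem [seq (inl (i, SH) : d21_basis) | i <- axes]).
  apply: subvP hC; apply/span_subvP => x /mapP[i ia ->].
  by apply: bvec_bspan; apply: map_f.
rewrite sum_axis; apply/ffunP => b; rewrite !ffunE.
case: b => [[i x]|s]; last first.
  by rewrite (h0 (inr s)) // /GRing.scale /= !mulr0 !addr0.
case: x i => [] i; rewrite ?(h0 (inl (i, SE))) ?(h0 (inl (i, SF))) //=;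
  case: i; rewrite //= /GRing.scale /= ?(mulr0, mulr1, addr0, add0r) //.
Qed.

Lemma pairing_hvec (kappa : weight K) i : pairing kappa (hvec zeta i) = kappa i.
Proof.
rewrite /pairing sum_axis !ffunE.
by case: i; rewrite !(mulr0, mulr1, addr0, add0r).
Qed.

Lemma weight_vectorP (M : lmodType (uenv (D21 zeta))) (kappa : weight K) (m : M) :
  weight_vector kappa m <->
  forall i, X (inl (i, SH)) *: m = (kappa i)%:A *: m.
Proof.
split=> [mk i|mk h /cartanE hE].
  rewrite -(pairing_hvec kappa i); apply: mk; apply: memv_span.
  by apply/mapP; exists i => //; case: (i).
rewrite [in LHS]hE [X in X *: _ = _](linear_sum (@uenv_gen K (D21 zeta))) scaler_suml.
rewrite /pairing !scaler_suml; apply: eq_bigr => i _.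
rewrite linearZ kscale_alg mk kscaleA.
by rewrite mulrC.
Qed.

Lemma weight_vector0 (M : lmodType (uenv (D21 zeta))) (kappa : weight K) :
  weight_vector kappa (0 : M).
Proof. by move=> h _; rewrite !scaler0. Qed.

Lemma weight_vector_lin (M : lmodType (uenv (D21 zeta))) (kappa : weight K) :
  ksub (@weight_vector K zeta M kappa).
Proof.
split=> [|c x y xk yk h hh]; first exact: weight_vector0.
by rewrite !scalerDr kscaleC xk // yk // [in RHS]kscaleC.
Qed.

(** A root vector moves weight spaces by its root. *)
Lemma weight_vector_X (M : lmodType (uenv (D21 zeta))) (kappa : weight K) b (m : M) :
  weight_vector kappa m -> weight_vector (kappa + basis_weight K b) (X b *: m).
Proof.
move=> /weight_vectorP mk; apply/weight_vectorP => i.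
rewrite scalerA X_mul /= expr0 scale1r scalerDl -scalerA mk kscaleC.
have -> : \sum_(p <- basis_br (inl (i, SH)) b) scoef_eval zeta p.1 *: X p.2 =
    (basis_wt b i)%:~R *: X b.
  rewrite /X -linearZ /= -(hvec_br zeta) d21_br_basis [RHS](linear_sum (@uenv_gen K (D21 zeta))).
  by apply: eq_bigr => p _; rewrite linearZ.
by rewrite (kscale_alg _ (X b)) -scalerDl -scalerDl !ffunE.
Qed.

End EnvelopingD21.

(** * The highest weight vector *)

Definition feps1 : d21_basis := inl (Eps1, SF).
Definition feps2 : d21_basis := inl (Eps2, SF).
Definition neg_basis : seq d21_basis :=
  [:: fdelta; feps1; feps2] ++ [seq odd_neg u | u <- letters].

Section VermaBasis.
Variables (K : numFieldType) (zeta : K) (lambda : weight K).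
Local Notation U := (uenv (D21 zeta)).
Local Notation M := (Verma zeta lambda).
Local Notation X := (X zeta).
Local Notation mu := (lambda - rho K).

Local Notation chi := (@borel_char K zeta mu).

Definition vpure (u : U) (c : K) : M := ind_pure _ u (c : oneDim chi).

Definition hwv : M := vpure 1 1.

Lemma vpure_act (a u : U) c : a *: vpure u c = vpure (a * u) c.
Proof. by rewrite [LHS]/GRing.scale /= /vpure /ind_pure -tpi_act. Qed.

Lemma vpure_bal u (b : uenv (subLie (borel zeta))) (c : K) :
  vpure (u * uenv_sub b) c = vpure u (chi b * c).
Proof. by apply/tpiP; exact: teqv_bal. Qed.

Lemma ind_pureE (u : U) (c : K) : vpure u c = u *: (c%:A *: hwv).
Proof.
rewrite /hwv !vpure_act mulr1 -[c in LHS]mulr1.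
have -> : u * c%:A = u * uenv_sub (c%:A : uenv (subLie (borel zeta))).
  by rewrite /uenv_sub ulift_const.
by rewrite vpure_bal /borel_char ulift_const [_ *: 1]mulr1.
Qed.

Lemma hwv_char (b : uenv (subLie (borel zeta))) :
  uenv_sub b *: hwv = (chi b : K)%:A *: hwv.
Proof.
rewrite /hwv vpure_act mulr1 -[uenv_sub b]mul1r vpure_bal.
by rewrite ind_pureE scale1r mulr1.
Qed.

Lemma hwv_borel x : x \in borel_space zeta ->
  uenv_gen x *: hwv = (pairing mu x)%:A *: hwv.
Proof.
move=> xb; pose y : subLie (borel zeta) := Subvs xb.
have := hwv_char (uenv_gen y).
by rewrite /uenv_sub ulift_gen /= /borel_char ulift_gen.
Qed.

Lemma X_borel b : b \in borel_basis ->
  X b *: hwv = (pairing mu (bvec K b : D21 zeta))%:A *: hwv.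
Proof. by move=> bb; apply: hwv_borel; rewrite borelE; apply: bvec_bspan. Qed.

Lemma X_pos b : b \in pos_basis -> X b *: hwv = 0.
Proof.
move=> bb; rewrite hwv_borel ?pairing_npos ?scale0r ?scale0r //.
  by rewrite nposE; apply: bvec_bspan.
by rewrite borelE; apply: bvec_bspan; rewrite /= mem_cat [_ \in pos_basis]bb orbT.
Qed.

Lemma hwv_weight : weight_vector mu hwv.
Proof.
apply/weight_vectorP => i; rewrite X_borel; last by case: i.
by rewrite -(pairing_hvec zeta _ i).
Qed.

Lemma verma_ind (P : M -> Prop) :
    P 0 -> (forall u, P u -> P (- u)) -> (forall u v, P u -> P v -> P (u + v)) ->
    (forall u c, P (vpure u c)) ->
  forall u, P u.
Proof. exact: ind_mod_ind. Qed.

(** A Verma module is generated from its highest weight vector by negative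
    vectors alone. The smallest subspace [Sp] that contains that vector and
    is stable under them is stable under every b': this holds at the highest
    weight vector, and b' (b y) = (+-) b (b' y) + [b', b] y carries it from y
    to b y, provided that all basis vectors are treated at once. *)
Lemma neg_gen (P : M -> Prop) : ksub P -> P hwv ->
  (forall b m, b \in neg_basis -> P m -> P (X b *: m)) -> forall m, P m.
Proof.
move=> kP Phw PX m.
pose Sp m := forall Q : M -> Prop, ksub Q -> Q hwv ->
  (forall b m, b \in neg_basis -> Q m -> Q (X b *: m)) -> Q m.
suff : Sp m by apply.
have kS : ksub Sp.
  split=> [Q [Q0 _] //|c x y Sx Sy Q kQ Qh QX].
  by case: (kQ) => _; apply; [apply: Sx|apply: Sy].
have Sh : Sp hwv by [].
have SX b x : b \in neg_basis -> Sp x -> Sp (X b *: x).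
  by move=> bn Sx Q kQ Qh QX; apply: (QX) => //; apply: (Sx Q).
have SXX x : Sp x -> forall b, Sp (X b *: x).
  move=> Sx; suff [] : Sp x /\ forall b, Sp (X b *: x) by [].
  apply: (Sx (fun x => Sp x /\ forall b, Sp (X b *: x))).
  - split=> [|c y z [Sy Yb] [Sz Zb]].
      by split=> [|b]; rewrite ?scaler0; case: kS.
    split=> [|b]; first by case: (kS) => _; apply.
    by rewrite scalerDr kscaleC; case: (kS) => _; apply.
  - split=> // b; have [bb|bn] := boolP (b \in borel_basis).
      by rewrite X_borel //; exact: (ksubZ _ kS).
    apply: SX => //; have : all (fun b => (b \in borel_basis) || (b \in neg_basis)) all_basis.
      by vm_compute.
    by move=> /allP/(_ b (mem_all_basis b)); rewrite (negPf bn).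
  move=> b y bn [Sy Yb]; split=> [|b']; first exact: SX.
  rewrite X_act; apply: (ksubD kS); first by apply: (ksubZ _ kS); apply: SX.
  by apply: (ksub_sum kS) => p _; exact: (ksubZ _ kS).
have SU (u : U) x : Sp x -> Sp (u *: x).
  elim/uenv_ind: u x => [y|c|u v IHu IHv|u v IHu IHv] x Sx.
  - rewrite X_sum scaler_suml; apply: (ksub_sum kS) => b _.
    by rewrite kscale_alg; apply: (ksubZ _ kS); apply: SXX.
  - exact: (ksubZ _ kS).
  - by rewrite scalerDl; apply: (ksubD kS); [apply: IHu|apply: IHv].
  - by rewrite -scalerA; apply: IHu; apply: IHv.
elim/verma_ind: m => [|u|u v|u c].
- by case: kS.
- exact: (ksubN kS).
- exact: (ksubD kS).
- rewrite ind_pureE; apply: SU; exact: (ksubZ _ kS).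
Qed.

Lemma hwv_gen (N : submodClosed M) : hwv \in N -> forall m, m \in N.
Proof.
move=> hN; apply: neg_gen => [|//|b m _ mN]; last exact: rpredZ.
by split=> [|c x y xN yN]; rewrite ?rpred0 // rpredD ?rpredZ.
Qed.

End VermaBasis.

(** * Coefficient functionals on a Verma module *)

(** Indices of genuine PBW monomials, with natural exponents. *)
Definition idx : Type := (nat * nat * nat * seq letter)%type.
HB.instance Definition _ := Choice.on idx.

Definition idx_pbw (j : idx) : pbw :=
  ((Posz j.1.1.1, Posz j.1.1.2, Posz j.1.2), j.2).

Lemma idx_pbw_inj : injective idx_pbw.
Proof. by move=> [[[a b] c] l] [[[a' b'] c'] l'] [-> -> -> ->]. Qed.

Section PBW.
Variables (K : numFieldType) (zeta : K) (lambda : weight K).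
Local Notation U := (uenv (D21 zeta)).
Local Notation M := (Verma zeta lambda).
Local Notation X := (X zeta).
Local Notation mu := (lambda - rho K).
Local Notation dual_act := (dual_act zeta mu).
Local Notation R := (pbwRep zeta mu).
Local Notation hwv := (hwv zeta lambda).
Local Notation origin := ((0, 0, 0, [::]) : pbw).

Definition Xw (l : seq letter) : U := \prod_(u <- l) X (odd_neg u).

(** The monomial F^a x_l f1^b f2^c v. *)
Definition pmon (j : idx) : M :=
  X fdelta ^+ j.1.1.1 *: (Xw j.2 *: (X feps1 ^+ j.1.1.2 *: (X feps2 ^+ j.1.2 *: hwv))).

Local Notation chi := (@borel_char K zeta mu).

Lemma expX_act (N : lmodType U) (u : U) k (m : N) :
  u ^+ k.+1 *: m = u *: (u ^+ k *: m).
Proof. by rewrite exprS scalerA. Qed.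

Lemma Xw_cons (N : lmodType U) u l (m : N) :
  Xw (u :: l) *: m = X (odd_neg u) *: (Xw l *: m).
Proof. by rewrite /Xw big_cons scalerA. Qed.

Lemma Xw_nil (N : lmodType U) (m : N) : Xw [::] *: m = m.
Proof. by rewrite /Xw big_nil scale1r. Qed.

(** Every coefficient of a positive vector at F^a f1^b f2^c v has a factor a,
    b or c, and so vanishes at the origin. *)
Lemma dual_act_pos b w : b \in pos_basis -> dual_act b w origin = 0.
Proof.
move=> bp; rewrite /= /dual_act_fun /veval /feval big_seq big1 // => t tb.
have : all (fun b => all (fun t : int * (monomial * pbw) =>
    has (fun i => (i < 3)%N) t.2.1) (act b [::])) pos_basis by vm_compute.
move=> /allP/(_ b bp)/allP/(_ t tb)/hasP[i im i3].
rewrite /meval (big_rem _ im) /= [env _ _ _ _](_ : _ = 0) ?mul0r ?mulr0 //.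
by case: i i3 {im} => [|[|[|]]].
Qed.

Lemma dual_act_cartan i w : dual_act (inl (i, SH)) w origin = mu i * w origin.
Proof.
rewrite /= /dual_act_fun; case: i => /=; rewrite /veval /feval !big_cons big_nil /meval /=.
all: by rewrite !(big_cons, big_nil) /env /= /addx /= mulr0z mulr1z
  !(addr0, add0r, mul1r, mulr1, mul0r, mulr0).
Qed.

Lemma dual_act_borel b w : b \in borel_basis ->
  dual_act b w origin = pairing mu (bvec K b : D21 zeta) * w origin.
Proof.
rewrite mem_cat => /orP[/mapP[i _ ->]|bp].
  by rewrite dual_act_cartan -[bvec _ _]/(hvec zeta i) pairing_hvec.
by rewrite dual_act_pos // pairing_npos ?mul0r // nposE; apply: bvec_bspan.
Qed.

Lemma pairing_sum (kappa : weight K) (x : D21 zeta) :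
  pairing kappa x = \sum_b (x : d21_car K) b * pairing kappa (bvec K b : D21 zeta).
Proof.
rewrite {1}[x]bvec_sum /pairing.
under [RHS]eq_bigr => b _ do rewrite mulr_sumr.
rewrite [RHS]exchange_big; apply: eq_bigr => i _ /=.
rewrite sum_ffunE mulr_sumr; apply: eq_bigr => b _.
by rewrite ffunE [RHS]mulrCA.
Qed.

Lemma rep_fun_borel (x : D21 zeta) w : x \in borel_space zeta ->
  rep_fun mu x w origin = pairing mu x * w origin.
Proof.
rewrite borelE => /bspanP xb.
rewrite /rep_fun dual_sumE pairing_sum mulr_suml; apply: eq_bigr => b _.
have [bb|/xb->] := boolP (b \in borel_basis); last by rewrite scale0r mul0r mul0r.
by rewrite -mulrA -dual_act_borel.
Qed.

(** The origin behaves as a highest weight vector under transposed operators;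
    this is the balancing condition for [coef]. *)
Lemma rep_borel (b : uenv (subLie (borel zeta))) w :
  ulift R (uenv_sub b) w origin = @borel_char K zeta mu b * w origin.
Proof.
elim/uenv_ind: b w => [x|c|u v IHu IHv|u v IHu IHv] w.
- rewrite /uenv_sub ulift_gen /= ulift_gen /borel_char ulift_gen /= /borel_char_fun.
  exact: rep_fun_borel (subvsP x).
- by rewrite /uenv_sub ulift_const /borel_char !ulift_const /= [in RHS]/GRing.scale /= mulr1.
- by rewrite !rmorphD /= mulrDl -IHu -IHv.
- by rewrite !rmorphM /= -mulrA IHv IHu mulrCA.
Qed.

(** The functional that sends u v to the value of [w] on the straightened
    form of u applied to the trivial monomial. *)
Definition coef (w : pbw -> K^o) : M -> K :=
  @ind_lift U _ (@uenv_sub K (D21 zeta) (borel zeta)) (oneDim chi) K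
    (fun u c => (c : K) * ulift R u w origin).

Lemma coef_pure w u c : coef w (vpure lambda u c) = c * ulift R u w origin.
Proof.
apply: (@ind_lift_pi U _ (@uenv_sub K (D21 zeta) (borel zeta)) (oneDim chi) K
    (fun u c => (c : K) * ulift R u w origin)).
- by move=> a a' n; rewrite rmorphD /= mulrDr.
- by move=> a n n'; rewrite mulrDl.
- move=> a b n; rewrite rmorphM /= rep_borel mulrCA mulrA.
  by rewrite [in RHS]/GRing.scale /= /oneDim_scale mulrC.
Qed.

Fact coef_zmod w : zmod_morphism (coef w).
Proof.
apply: ind_lift_zmod.
- by move=> a a' n; rewrite rmorphD /= mulrDr.
- by move=> a n n'; rewrite mulrDl.
- move=> a b n; rewrite rmorphM /= rep_borel mulrCA mulrA.
  by rewrite [in RHS]/GRing.scale /= /oneDim_scale mulrC.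
Qed.
HB.instance Definition _ w := GRing.isZmodMorphism.Build M K (coef w) (coef_zmod w).

Lemma coef_zero w : coef w 0 = 0. Proof. exact: raddf0. Qed.
Lemma coef_opp w m : coef w (- m) = - coef w m. Proof. exact: raddfN. Qed.
Lemma coef_add w m m' : coef w (m + m') = coef w m + coef w m'.
Proof. exact: raddfD. Qed.

Lemma coef_act w u m : coef w (u *: m) = coef (ulift R u w) m.
Proof.
elim/verma_ind: m => [|m IH|m m' IH IH'|a c].
- by rewrite scaler0 !coef_zero.
- by rewrite scalerN !coef_opp IH.
- by rewrite scalerDr !coef_add IH IH'.
by rewrite vpure_act !coef_pure rmorphM.
Qed.

Lemma coefX w b m : coef w (X b *: m) = coef (dual_act b w) m.
Proof. by rewrite coef_act /X ulift_gen /= rep_bvec. Qed.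

Lemma coef_scale w c m : coef w (c%:A *: m) = c * coef w m.
Proof.
elim/verma_ind: m => [|m IH|m m' IH IH'|a d].
- by rewrite scaler0 coef_zero mulr0.
- by rewrite scalerN !coef_opp IH mulrN.
- by rewrite scalerDr !coef_add IH IH' mulrDr.
rewrite vpure_act !coef_pure rmorphM.
have -> : ulift R c%:A * ulift R a = c *: ulift R a by rewrite ulift_const mulr_algl.
by rewrite [LHS]mulrCA.
Qed.

Lemma coef_hwv w : coef w hwv = w origin.
Proof. by rewrite coef_pure rmorph1 mul1r. Qed.

(** Coordinate functional, from the indicator function of one index. *)
Definition pcoord (j : idx) : M -> K := coef (fun k => (k == idx_pbw j)%:R).
HB.instance Definition _ j := GRing.isZmodMorphism.Build M K (pcoord j) (coef_zmod _).

End PBW.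

(** * Products of negative root vectors *)

Section Basis.
Variables (K : numFieldType) (zeta : K) (lambda : weight K).
Local Notation U := (uenv (D21 zeta)).
Local Notation M := (Verma zeta lambda).
Local Notation X := (X zeta).
Local Notation mu := (lambda - rho K).
Local Notation dual_act := (dual_act zeta mu).
Local Notation hwv := (hwv zeta lambda).
Local Notation Xw := (Xw zeta).
Local Notation pmon := (pmon zeta lambda).
Local Notation pcoord := (@pcoord K zeta lambda).

Lemma dual_act_key b w d e l l' : act b l = vkey e l' ->
  dual_act b w (d, l) = w (addx d e, l').
Proof. by rewrite /= /dual_act_fun /= => ->; rewrite veval_key. Qed.

Lemma act_fdelta l : l \in words -> act fdelta l = vkey (1, 0, 0) l.
Proof.
move=> lw; apply/eqP; have : all (fun l => act fdelta l == vkey (1, 0, 0) l) words.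
  by vm_compute.
by move=> /allP/(_ l lw).
Qed.

Lemma words_behead u l : u :: l \in words -> l \in words.
Proof.
move=> lw; have : all (fun l => behead l \in words) words by vm_compute.
by move=> /allP/(_ _ lw).
Qed.

Lemma act_odd u l : u :: l \in words -> act (odd_neg u) l = vkey (0, 0, 0) (u :: l).
Proof.
move=> lw; apply/eqP.
have : all (fun l => if l is u :: l' then act (odd_neg u) l' == vkey (0, 0, 0) l
                     else true) words by vm_compute.
by move=> /allP/(_ _ lw).
Qed.

(** Multiplying an increasing monomial on the left by its next factor needs
    no straightening, so [coef w] reads off the value of [w] at the index. *)
Lemma coef_pmon w j : j.2 \in words -> coef w (pmon j) = w (idx_pbw j).
Proof.
case: j => [[[a b] c] l] /= lw; rewrite /pmon /idx_pbw /=.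
elim: a w => [|a IH] w; last first.
  rewrite expX_act coefX IH (dual_act_key _ _ (act_fdelta lw)) /addx /= !addr0.
  by congr (w (_, _, _, _)); rewrite -PoszD addn1.
rewrite expr0 scale1r; elim: l lw w => [_|u l IH lw] w; last first.
  rewrite Xw_cons coefX IH ?(words_behead lw) // (dual_act_key _ _ (act_odd lw)).
  by rewrite /addx /= !addr0.
rewrite Xw_nil; elim: b w => [|b IH] w; last first.
  rewrite expX_act coefX IH (dual_act_key _ _ (_ : act feps1 [::] = vkey (0, 1, 0) [::])) //.
  rewrite /addx /= ?(addr0, add0r).
  by congr (w (_, _, _, _)); rewrite -PoszD addn1.
rewrite expr0 scale1r; elim: c w => [|c IH] w; last first.
  rewrite expX_act coefX IH (dual_act_key _ _ (_ : act feps2 [::] = vkey (0, 0, 1) [::])) //.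
  rewrite /addx /= ?(addr0, add0r).
  by congr (w (_, _, _, _)); rewrite -PoszD addn1.
by rewrite expr0 scale1r coef_hwv.
Qed.

Lemma pcoord_mon j j' : j'.2 \in words -> pcoord j (pmon j') = (j' == j)%:R.
Proof. by move=> jw; rewrite /pcoord coef_pmon // (inj_eq idx_pbw_inj). Qed.

End Basis.

Section NegativePart.
Variables (K : numFieldType) (zeta : K) (M : lmodType (uenv (D21 zeta))).
Local Notation U := (uenv (D21 zeta)).
Local Notation X := (X zeta).
Local Notation Xw := (Xw zeta).
Implicit Types (m w : M).

Lemma X_comm a b : basis_br a b = [::] -> basis_parity b = false ->
  X a * X b = X b * X a.
Proof.
by move=> ab bp; rewrite X_mul bp andbF expr0 scale1r ab big_nil addr0.
Qed.

Lemma F_comm b : b \in neg_basis -> X b * X fdelta = X fdelta * X b.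
Proof.
move=> bn; apply: X_comm => //; apply/eqP.
have : all (fun b => basis_br b fdelta == [::]) neg_basis by vm_compute.
by move=> /allP/(_ b bn).
Qed.

Lemma odd_neg_basis u : odd_neg u \in neg_basis.
Proof. by rewrite mem_cat map_f ?orbT //; case: u => [[] []]. Qed.

Lemma comm_act (u u' : U) k m : u * u' = u' * u ->
  u *: (u' ^+ k *: m) = u' ^+ k *: (u *: m).
Proof. by move=> uu; rewrite !scalerA; congr (_ *: _); apply/commrX. Qed.

Lemma F_act b a m : b \in neg_basis ->
  X b *: (X fdelta ^+ a *: m) = X fdelta ^+ a *: (X b *: m).
Proof. by move=> bn; apply/comm_act/F_comm. Qed.

Lemma F_odd_act u a m :
  X (odd_neg u) *: (X fdelta ^+ a *: m) = X fdelta ^+ a *: (X (odd_neg u) *: m).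
Proof. exact/F_act/odd_neg_basis. Qed.

(** The bracket of two odd negative vectors has all its nonzero terms along
    F. *)
Lemma odd_odd_act u h m : exists c : K,
  X (odd_neg u) *: (X (odd_neg h) *: m) =
  (-1)%:A *: (X (odd_neg h) *: (X (odd_neg u) *: m)) + c%:A *: (X fdelta *: m).
Proof.
pose br := basis_br (odd_neg u) (odd_neg h).
exists (\sum_(p <- br | p.2 == fdelta) scoef_eval zeta p.1).
rewrite X_act expr1; congr (_ + _); rewrite -/br !scaler_suml [RHS]big_mkcond /=.
apply: eq_big_seq => p pb; case: eqP => [->//|/eqP pF].
have : all (fun u => all (fun h => all (fun p : scoef * d21_basis => (p.2 == fdelta) || (p.1.2
  == 0))
  (basis_br (odd_neg u) (odd_neg h))) letters) letters by vm_compute.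
have lT : forall u, u \in letters by case=> [[] []].
move=> /allP/(_ u (lT u))/allP/(_ h (lT h))/allP/(_ p pb); rewrite (negPf pF) /= => /eqP p0.
by rewrite /scoef_eval p0 mulr0 !scale0r.
Qed.

Lemma double_eq0 m : m = (-1)%:A *: m -> m = 0.
Proof.
move=> mN; have : (2 : K)%:A *: m = 0.
  by rewrite scaler_nat scaler_nat mulr2n [X in X + _]mN scaleN1r addNr.
move=> /(congr1 (fun m => (2^-1 : K)%:A *: m)).
by rewrite kscaleA scaler0 mulVf ?pnatr_eq0 // !scale1r.
Qed.

(** Twice an odd root is not a root, so the square is its own opposite. *)
Lemma odd_sq_act u m : X (odd_neg u) *: (X (odd_neg u) *: m) = 0.
Proof.
apply: double_eq0; rewrite {1}X_act expr1 big1_seq ?addr0 // => p /= pu.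
have : all (fun u => all (fun p : scoef * d21_basis => p.1.2 == 0)
  (basis_br (odd_neg u) (odd_neg u))) letters by vm_compute.
have uT : u \in letters by case: (u) => [[] []].
move=> /allP/(_ u uT)/allP/(_ p pu)/eqP p0.
by rewrite /scoef_eval p0 mulr0 !scale0r.
Qed.

(** F, f1 and f2 commute with an odd negative vector up to another one. *)
Lemma even_odd_act i u m : exists (c : K) (u' : letter),
  X (inl (i, SF)) *: (X (odd_neg u) *: m) =
  X (odd_neg u) *: (X (inl (i, SF)) *: m) + c%:A *: (X (odd_neg u') *: m).
Proof.
case: u => s t; case: i.
- exists 0, (s, t); rewrite X_act expr0 scale1r scale1r /= big_nil.
  by rewrite !scale0r.
- exists (if s then 1 else 0), (false, t); rewrite X_act expr0 scale1r scale1r /=.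
  by case: s => /=; rewrite ?big_cons big_nil ?scale0r ?scale0r ?addr0 // /scoef_eval mul1r.
- exists (if t then 1 else 0), (s, false); rewrite X_act expr0 scale1r scale1r /=.
  by case: t => /=; rewrite ?big_cons big_nil ?scale0r ?scale0r ?addr0 // /scoef_eval mul1r.
Qed.

(** The span of the F^a x_l w for increasing words l on the letters [s]. *)
Definition odd_span (s : seq letter) w : M -> Prop :=
  kspan (fun m => exists a l, l \in words_of s /\ m = X fdelta ^+ a *: (Xw l *: w)).

Lemma odd_span_F s w m : odd_span s w m -> odd_span s w (X fdelta *: m).
Proof.
apply: kspan_act => _ [a [l [ls ->]]]; apply: kspan_gen.
by exists a.+1, l; rewrite expX_act.
Qed.

Lemma odd_span_sub s h w m : odd_span s w m -> odd_span (h :: s) w m.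
Proof.
move=> sm; apply: (sm _ (kspan_ksub _)) => _ [a [l [ls ->]]]; apply: kspan_gen.
by exists a, l; rewrite mem_cat ls orbT.
Qed.

Lemma odd_span_cons s h w m : odd_span s w m -> odd_span (h :: s) w (X (odd_neg h) *: m).
Proof.
apply: kspan_act => _ [a [l [ls ->]]]; apply: kspan_gen.
exists a, (h :: l); rewrite mem_cat map_f //; split=> //.
by rewrite F_odd_act Xw_cons.
Qed.

(** Induction on the letters: let h be the first letter of [s]. If u = h, it
    either starts a new word or squares to zero. Otherwise x_u x_h is - x_h
    x_u plus a multiple of F, and x_u acts on words without h. *)
Lemma odd_span_act s u w m : uniq s -> u \in s ->
  odd_span s w m -> odd_span s w (X (odd_neg u) *: m).
Proof.
elim: s u m => // h s IH u m /= /andP[hs us] uin; apply: kspan_act => _ [a [l [ls ->]]].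
have kS s' : ksub (odd_span s' w) by exact: kspan_ksub.
have gen l' : l' \in words_of s -> odd_span s w (X fdelta ^+ a *: (Xw l' *: w)).
  by move=> l's; apply: kspan_gen; exists a, l'.
move: ls; rewrite mem_cat => /orP[/mapP[l' l's ->]|/gen sm]; last first.
  move: uin; rewrite inE => /predU1P[->|uin]; first exact: odd_span_cons.
  by apply: odd_span_sub; apply: IH.
rewrite Xw_cons -F_odd_act.
move: uin; rewrite inE => /predU1P[->|uin].
  by rewrite odd_sq_act; case: (kS (h :: s)).
have [c ->] := odd_odd_act u h (X fdelta ^+ a *: (Xw l' *: w)).
have kl := (kS (h :: s)).2; apply: (ksubD (kS (h :: s))).
  apply: (ksubZ (-1) (kS (h :: s))).
  apply: odd_span_cons; apply: IH => //; exact: (gen l' l's).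
by apply: (ksubZ c (kS (h :: s))); apply: odd_span_F; apply: odd_span_sub; exact: (gen l' l's).
Qed.

End NegativePart.

(** * The PBW basis of a Verma module *)

Section Expansion.
Variables (K : numFieldType) (zeta : K) (lambda : weight K).
Local Notation U := (uenv (D21 zeta)).
Local Notation M := (Verma zeta lambda).
Local Notation X := (X zeta).
Local Notation mu := (lambda - rho K).
Local Notation hwv := (hwv zeta lambda).
Local Notation Xw := (Xw zeta).
Local Notation pmon := (pmon zeta lambda).
Local Notation pcoord := (@pcoord K zeta lambda).

Definition pmon_span : M -> Prop :=
  kspan (fun m => exists2 j : idx, j.2 \in words & m = pmon j).

Lemma pmon_span_ksub : ksub pmon_span. Proof. exact: kspan_ksub. Qed.

Lemma pmon_span_odd u m : pmon_span m -> pmon_span (X (odd_neg u) *: m).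
Proof.
apply: kspan_act => _ [[[[a b] c] l] /= lw ->].
set w := X feps1 ^+ b *: (X feps2 ^+ c *: hwv).
have : odd_span letters w (X (odd_neg u) *: (X fdelta ^+ a *: (Xw l *: w))).
  apply: odd_span_act => //; first by case: u => [[] []].
  by apply: kspan_gen; exists a, l.
apply; first exact: pmon_span_ksub.
by move=> _ [a' [l' [lw' ->]]]; apply: kspan_gen; exists (a', b, c, l').
Qed.

Lemma pmon_span_F m : pmon_span m -> pmon_span (X fdelta *: m).
Proof.
apply: kspan_act => _ [[[[a b] c] l] /= lw ->]; apply: kspan_gen.
by exists (a.+1, b, c, l); rewrite // /pmon /= expX_act.
Qed.

Lemma pmon_span_Fn a m : pmon_span m -> pmon_span (X fdelta ^+ a *: m).
Proof.
move=> sm; elim: a => [|a IH]; first by rewrite expr0 scale1r.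
by rewrite expX_act; apply: pmon_span_F.
Qed.

Lemma pmon_span_Xw l m : pmon_span m -> pmon_span (Xw l *: m).
Proof.
move=> sm; elim: l => [|u l IH]; first by rewrite Xw_nil.
by rewrite Xw_cons; apply: pmon_span_odd.
Qed.

Lemma pmon_span_even i m : i != Delta -> pmon_span m -> pmon_span (X (inl (i, SF)) *: m).
Proof.
move=> iD; apply: kspan_act => _ [[[[a b] c] l] /= lw ->].
set w := X feps1 ^+ b *: (X feps2 ^+ c *: hwv).
have sw l' : pmon_span (Xw l' *: w).
  apply: pmon_span_Xw; apply: kspan_gen; exists (0%N, b, c, [::]) => //.
  by rewrite /pmon expr0 scale1r Xw_nil.
rewrite F_act; last by case: i iD.
apply: pmon_span_Fn.
elim: l {lw} => [|u l IH].
  rewrite Xw_nil; apply: kspan_gen; case: i iD => // _.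
    by exists (0%N, b.+1, c, [::]); rewrite // /pmon expr0 scale1r Xw_nil expX_act.
  exists (0%N, b, c.+1, [::]); rewrite // /pmon expr0 scale1r Xw_nil /= expX_act.
  by rewrite /w comm_act //; apply: X_comm.
rewrite Xw_cons; have [d [u' ->]] := even_odd_act i u (Xw l *: w).
apply: (ksubD pmon_span_ksub); first exact: pmon_span_odd.
by apply: (ksubZ _ pmon_span_ksub); apply: pmon_span_odd.
Qed.

(** With [pcoord_mon] this makes the monomials a basis. *)
Lemma pmon_spanT m : pmon_span m.
Proof.
move: m; apply: neg_gen; first exact: pmon_span_ksub.
  apply: kspan_gen; exists (0%N, 0%N, 0%N, [::]) => //.
  by rewrite /pmon !expr0 !scale1r Xw_nil.
move=> b m; rewrite mem_cat => /orP[|/mapP[u _ ->]]; last exact: pmon_span_odd.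
by rewrite !inE => /or3P[]/eqP->; [apply: pmon_span_F|apply: pmon_span_even|apply:
  pmon_span_even].
Qed.

Lemma pcoordD j m m' : pcoord j (m + m') = pcoord j m + pcoord j m'. Proof. exact: coef_add. Qed.
Lemma pcoord0 j : pcoord j 0 = 0. Proof. exact: coef_zero. Qed.
Lemma pcoordZ j c m : pcoord j (c%:A *: m) = c * pcoord j m. Proof. exact: coef_scale. Qed.

Lemma pcoord_sum j (r : seq idx) (c : idx -> K) : uniq r -> all (fun i => i.2 \in words) r ->
  pcoord j (\sum_(i <- r) (c i)%:A *: pmon i) = if j \in r then c j else 0.
Proof.
move=> ru rw.
have -> : pcoord j (\sum_(i <- r) (c i)%:A *: pmon i) = \sum_(i <- r) c i * (i == j)%:R.
  elim: r {ru} rw => [|i r IH] /=; first by rewrite !big_nil pcoord0.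
  by case/andP=> iw rw; rewrite !big_cons pcoordD pcoordZ pcoord_mon // IH.
case: ifP => [jr|/negbT jr].
  by rewrite (bigD1_seq j) //= eqxx mulr1 big1 ?addr0 // => i /negPf->; rewrite mulr0.
rewrite big1_seq // => i /= ir.
by case: eqP ir => [->|_ _]; rewrite ?(negPf jr) ?mulr0.
Qed.

(** Stated for every large enough list of indices, so that the expansions of
    two vectors can be added without merging their lists. *)
Lemma pmon_expand m : exists2 js : seq idx, all (fun j => j.2 \in words) js &
  forall js', uniq js' -> {subset js <= js'} -> all (fun j => j.2 \in words) js' ->
  m = \sum_(j <- js') (pcoord j m)%:A *: pmon j.
Proof.
apply: (pmon_spanT m (P := fun m => exists2 js : seq idx, all (fun j => j.2 \in words) js &
  forall js', uniq js' -> {subset js <= js'} -> all (fun j => j.2 \in words) js' ->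
  m = \sum_(j <- js') (pcoord j m)%:A *: pmon j)).
  split=> [|d x y [js jw xE] [js' jw' yE]].
    by exists [::] => // js _ _ _; rewrite big1 // => j _; rewrite pcoord0 !scale0r.
  exists (js ++ js'); first by rewrite all_cat jw.
  move=> r ru sub rw.
  rewrite {1}(xE r) // => [|j jj]; last by apply: sub; rewrite mem_cat jj.
  rewrite {1}(yE r) // => [|j jj]; last by apply: sub; rewrite mem_cat jj orbT.
  rewrite scaler_sumr -big_split; apply: eq_bigr => j _ /=.
  by rewrite pcoordD pcoordZ kscaleA -scalerDl -scalerDl.
move=> _ [j jw ->]; exists [:: j]; first by rewrite /= jw.
move=> r ru sub rw; have jr : j \in r by apply: sub; rewrite inE.
rewrite (bigD1_seq j) //= pcoord_mon // eqxx !scale1r big1 ?addr0 // => i ij.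
by rewrite pcoord_mon // eq_sym (negPf ij) !scale0r.
Qed.

Lemma pcoord_inj m : (forall j, pcoord j m = 0) -> m = 0.
Proof.
move=> m0; have [js jw mE] := pmon_expand m.
rewrite (mE (undup js)) ?undup_uniq //; first by rewrite big1 // => j _; rewrite m0 !scale0r.
  by move=> j; rewrite mem_undup.
by apply/allP => j; rewrite mem_undup => /(allP jw).
Qed.

Lemma pcoord_supp m j : pcoord j m != 0 -> j.2 \in words.
Proof.
move=> mj; have [js jw mE] := pmon_expand m.
have uw : all (fun j => j.2 \in words) (undup js).
  by apply/allP => i; rewrite mem_undup => /(allP jw).
apply: contraNT mj => jn; rewrite (mE (undup js)) ?undup_uniq //; last first.
  by move=> i; rewrite mem_undup.
rewrite pcoord_sum ?undup_uniq //; case: ifP => // /(allP uw) jw'.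
by rewrite jw' in jn.
Qed.

Lemma pmon_expand_in m (js : seq idx) : uniq js -> all (fun j => j.2 \in words) js ->
  (forall j, pcoord j m != 0 -> j \in js) -> m = \sum_(j <- js) (pcoord j m)%:A *: pmon j.
Proof.
move=> ju jw jm; apply/eqP; rewrite -subr_eq0; apply/eqP/pcoord_inj => j.
rewrite pcoordD -scaleN1r pcoordZ pcoord_sum //; case: ifP => [_|/negbT jjs].
  by rewrite mulN1r subrr.
by rewrite mulr0 addr0; apply: contraNeq jjs => /jm.
Qed.

Definition idx_weight (j : idx) : weight K :=
  mu + basis_weight K feps2 *+ j.1.2 + basis_weight K feps1 *+ j.1.1.2
  + \sum_(u <- j.2) basis_weight K (odd_neg u) + basis_weight K fdelta *+ j.1.1.1.

Lemma weight_vector_Xn (N : lmodType U) b k kappa (m : N) : weight_vector kappa m ->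
  weight_vector (kappa + basis_weight K b *+ k) (X b ^+ k *: m).
Proof.
move=> mk; elim: k => [|k IH]; first by rewrite addr0 expr0 scale1r.
by rewrite expX_act mulrSr addrA; apply: weight_vector_X.
Qed.

Lemma weight_vector_Xw (N : lmodType U) l kappa (m : N) : weight_vector kappa m ->
  weight_vector (kappa + \sum_(u <- l) basis_weight K (odd_neg u)) (Xw l *: m).
Proof.
move=> mk; elim: l => [|u l IH]; first by rewrite big_nil addr0 Xw_nil.
by rewrite Xw_cons big_cons addrCA addrC; apply: weight_vector_X.
Qed.

Lemma pmon_weight j : weight_vector (idx_weight j) (pmon j).
Proof.
apply/weight_vector_Xn/weight_vector_Xw/weight_vector_Xn/weight_vector_Xn.
exact: hwv_weight.
Qed.

Lemma dual_act_weight j w i : j.2 \in words ->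
  dual_act zeta mu (inl (i, SH)) w (idx_pbw j) = idx_weight j i * w (idx_pbw j).
Proof.
move=> jw; rewrite -(coef_pmon zeta lambda _ jw) -coefX.
have /weight_vectorP -> := pmon_weight j.
by rewrite coef_scale coef_pmon.
Qed.

(** Coordinates are eigenfunctionals of the Cartan subalgebra, so a weight
    vector only involves monomials of its own weight. *)
Lemma pcoord_weight kappa m j : weight_vector kappa m -> pcoord j m != 0 ->
  kappa = idx_weight j.
Proof.
move=> /weight_vectorP mk mj; have jw := pcoord_supp mj; apply/ffunP => i.
have E : coef (dual_act zeta mu (inl (i, SH)) (fun k => (k == idx_pbw j)%:R)) m = idx_weight j
  i * pcoord j m.
  apply: (pmon_spanT m (P := fun m => coef _ m = idx_weight j i * pcoord j m)).
    split=> [|c x y xE yE]; first by rewrite coef_zero pcoord0 mulr0.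
    by rewrite coef_add coef_scale xE yE pcoordD pcoordZ mulrDr mulrCA.
  move=> _ [j' jw' ->]; rewrite coef_pmon // dual_act_weight // pcoord_mon // (inj_eq
    idx_pbw_inj).
  by case: eqP => [->|_]; rewrite ?mulr0.
have := congr1 (pcoord j) (mk i); rewrite pcoordZ {1}/pcoord coefX E.
by move/(mulIf mj).
Qed.

End Expansion.

(** * Singular vectors *)

(** The integral part of the weight of a monomial, relative to the highest
    weight. *)
Definition idx_wt (j : idx) (i : axis) : int :=
  basis_wt feps2 i * j.1.2%:Z + basis_wt feps1 i * j.1.1.2%:Z
  + foldr (fun u s => basis_wt (odd_neg u) i + s) 0 j.2
  + basis_wt fdelta i * j.1.1.1%:Z.

Definition pvect : Type := seq (scalar_poly * (expo * seq letter)).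

Definition vect_of (P : pvect) : sym_vect :=
  flatten [seq vmul t.1 (vkey t.2.1 t.2.2) | t <- P].

Definition vsubst (f : nat -> scalar_poly) (V : sym_vect) : sym_vect :=
  fbind (fun t => vmul (psubst f t.1) [:: (1, ([::], t.2))]) V.

(** The substitution [f] imposes the relation between the highest weight and
    the exponent n, and the vanishing of the other exponents, before testing
    that positive vectors give the zero combination. *)
Definition singular_check (f : nat -> scalar_poly) (P : pvect) : bool :=
  all (fun b => vnorm (vsubst f (act_vect b (vect_of P))) == [::]) pos_basis.

(** Here n is the exponent b, and <lambda, h> = n reads m_1 = b - 1. *)
Definition subst_eps1 (i : nat) : scalar_poly :=
  match i with 0 | 2 => [::] | 4 => pvar 1 ++ pint (-1) | _ => pvar i end.
Definition subst_eps2 (i : nat) : scalar_poly :=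
  match i with 0 | 1 => [::] | 5 => pvar 2 ++ pint (-1) | _ => pvar i end.

(** Here n is the exponent a. As rho is -1 at this coroot, <lambda, h> = n
    means that the highest weight takes the value a + 1. *)
Definition subst_delta (i : nat) : scalar_poly :=
  match i with 1 | 2 => [::] | 3 => pvar 0 ++ pint 1 | _ => pvar i end.

Definition highest : pvect := [:: (pint 1, (expo0, [::]))].

(** The vector for 2 delta, each exponent being written as a shift of F^n. *)
Definition delta_vector : pvect :=
  let n := pvar 0 in let s1 := pvar 6 in let s2 := pvar 7 in
  let two := pint 2 in
  let L := pmul (pint 1 ++ fscale (-1) n) (s1 ++ s2)
           ++ pmul (pvar 4) s1 ++ pmul (pvar 5) s2 in
  let x1 := (true, true) in let x2 := (true, false) in
  let x3 := (false, true) in let x4 := (false, false) in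
  [:: (pmul L (pmul two (pmul s2 (pvar 5 ++ pint 1)) ++ fscale (-1) L), (expo0, [::]));
      (pmul n (pmul two (pmul s2 (pvar 5)) ++ fscale (-1) L), ((-1, 0, 0), [:: x1; x4]));
      (pmul n L, ((-1, 0, 0), [:: x2; x3]));
      (pmul two (pmul n s1), ((-1, 1, 0), [:: x1; x2]));
      (fscale (-2) (pmul n s2), ((-1, 0, 1), [:: x1; x3]));
      (pmul n (n ++ pint (-1)), ((-2, 0, 0), [:: x1; x2; x3; x4]))].

Fact eps1_check : singular_check subst_eps1 highest. Proof. by vm_compute. Qed.
Fact eps2_check : singular_check subst_eps2 highest. Proof. by vm_compute. Qed.
Fact delta_check : singular_check subst_delta delta_vector. Proof. by vm_compute. Qed.

Section Singular.
Variables (K : numFieldType) (zeta : K) (lambda : weight K).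
Local Notation U := (uenv (D21 zeta)).
Local Notation M := (Verma zeta lambda).
Local Notation X := (X zeta).
Local Notation mu := (lambda - rho K).
Local Notation pmon := (pmon zeta lambda).
Local Notation pcoord := (@pcoord K zeta lambda).
Local Notation peval := (peval zeta mu).
Local Notation meval := (meval zeta mu).
Local Notation veval := (veval zeta mu).
Local Notation env := (env zeta mu).

Lemma idx_weightE j i : idx_weight lambda j i = mu i + (idx_wt j i)%:~R.
Proof.
have E b k : (basis_weight K b *+ k) i = (basis_wt b i)%:~R * k%:~R.
  by rewrite -pmulrn mulr_natr; elim: k => [|k IH]; rewrite ?mulrS ffunE // IH ffunE.
rewrite /idx_weight; move: (lambda - rho K) => m.
rewrite !ffunE !E sum_ffunE /idx_wt !intrD !intrM.
have -> : \sum_(u <- j.2) basis_weight K (odd_neg u) i =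
    (foldr (fun u s => basis_wt (odd_neg u) i + s) 0 j.2)%:~R.
  elim: j.2 => [|u l IH]; first by rewrite big_nil.
  by rewrite big_cons IH /= intrD ffunE.
by rewrite !addrA.
Qed.

Definition expo_idx (d : expo) (l : seq letter) : idx :=
  (`|d.1.1|%N, `|d.1.2|%N, `|d.2|%N, l).

Definition pvect_eval (P : pvect) (d : expo) : M :=
  \sum_(t <- P) (peval d t.1)%:A *: pmon (expo_idx (addx d t.2.1) t.2.2).

(** Absolute values turn exponents into natural numbers; this is harmless
    where the exponents are nonnegative or the coefficient vanishes, as n (n
    - 1) does at F^(n-2) for n = 1. *)
Definition pvect_ok (P : pvect) (d : expo) : Prop :=
  forall t, t \in P -> t.2.2 \in words /\
    (peval d t.1 = 0 \/ idx_pbw (expo_idx (addx d t.2.1) t.2.2) = (addx d t.2.1, t.2.2)).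

Lemma coef_pvect w P d : pvect_ok P d ->
  coef w (pvect_eval P d) = veval w d (vect_of P).
Proof.
move=> ok; rewrite /vect_of veval_flatten /pvect_eval.
elim: P ok => [|t P IH] ok; first by rewrite !big_nil coef_zero.
rewrite !big_cons coef_add coef_scale IH => [|t' tP]; last by apply: ok; rewrite inE tP orbT.
congr (_ + _); rewrite veval_mul veval_key.
have [|tw [->|tE]] := ok t; rewrite ?mem_head ?mul0r //.
by rewrite coef_pmon // tE.
Qed.

Lemma peval_subst_id f d : (forall i, peval d (f i) = env d i) ->
  forall m, peval d (psubst f m) = meval d m.
Proof.
move=> fE; elim=> [|i m IH] /=; first by rewrite peval_int /meval big_nil.
by rewrite peval_mul IH fE /meval big_cons.
Qed.

Lemma veval_subst f d w V : (forall i, peval d (f i) = env d i) ->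
  veval w d (vsubst f V) = veval w d V.
Proof.
move=> fE; rewrite [LHS]feval_bind; apply: eq_feval => t.
rewrite -/(veval w d _) veval_mul peval_subst_id //; congr (_ * _).
by rewrite /veval feval1 /meval big_nil mul1r.
Qed.

(** The symbolic check bears on all coordinates at once, and coordinates
    separate vectors. *)
Lemma pvect_pos P d f b : pvect_ok P d -> (forall i, peval d (f i) = env d i) ->
  singular_check f P -> b \in pos_basis -> X b *: pvect_eval P d = 0.
Proof.
move=> ok fE chk bp; apply: pcoord_inj => j.
rewrite /pcoord coefX coef_pvect // veval_act -(veval_subst _ _ fE) -veval_norm.
by have /allP/(_ b bp)/eqP-> := chk; rewrite /veval /feval big_nil.
Qed.

Lemma expo_idxE d l : 0 <= d.1.1 -> 0 <= d.1.2 -> 0 <= d.2 ->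
  idx_pbw (expo_idx d l) = (d, l).
Proof.
by case: d => [[a b] c] /= a0 b0 c0; rewrite /idx_pbw /expo_idx /= !gez0_abs.
Qed.

Lemma rho_eps i : rho K i = if i == Delta then -1 else 1.
Proof. by rewrite !ffunE; case: i; rewrite /= ?(subr0, addr0, add0r, oppr0). Qed.

Lemma even_root_mulrn i j n :
  (even_root K i *+ n) j = 2 * n%:R * (j == i)%:R.
Proof.
elim: n => [|n IH]; first by rewrite mulr0n ffunE mulr0 mul0r.
rewrite mulrS ffunE IH !ffunE -[n.+1%:R]natr1 mulrDr mulrDl mulr1 addrC.
by congr (_ + _).
Qed.

Lemma exists_singular_eps gamma (n : nat) : gamma != Delta -> lambda gamma = n%:R ->
  exists v : M, [/\ v != 0, forall b, b \in pos_basis -> X b *: v = 0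
    & weight_vector (mu - even_root K gamma *+ n) v].
Proof.
move=> gD lg.
pose d : expo := if gamma == Eps1 then (0, n%:Z, 0) else (0, 0, n%:Z).
pose f := if gamma == Eps1 then subst_eps1 else subst_eps2.
have ok : pvect_ok highest d.
  move=> t; rewrite inE => /eqP-> /=; split=> //; right.
  by rewrite addx0 /d; case: ifP => _; apply: expo_idxE.
have vE : pvect_eval highest d = pmon (expo_idx d [::]).
  by rewrite /pvect_eval big_seq1 peval_int !scale1r /= addx0.
exists (pmon (expo_idx d [::])); split.
- apply/eqP => /(congr1 (pcoord (expo_idx d [::]))); rewrite pcoord_mon // eqxx pcoord0.
  by move/eqP; rewrite oner_eq0.
- move=> b bp; rewrite -vE; apply: (pvect_pos (f := f) ok _ _ bp); last first.
    by rewrite /f; case: ifP => _; [exact: eps1_check|exact: eps2_check].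
  move=> i; rewrite /f /d; case: gamma gD lg {d f ok vE} => // _ lg;
    case: i => [|[|[|[|[|[|i]]]]]]; rewrite /= ?peval_var //.
  all: rewrite ?/peval /feval ?big_nil /env //=.
  1,2: rewrite big_cons big_seq1 /meval !(big_cons, big_nil) /env /= mul1r !mulr1 -pmulrn mulrN1z.
  1,2: by rewrite ffunE lg ffunE rho_eps.
have -> : mu - even_root K gamma *+ n = idx_weight lambda (expo_idx d [::]).
  apply/ffunP => i; rewrite idx_weightE ffunE; congr (_ + _).
  rewrite ffunE even_root_mulrn /d.
  case: (gamma) gD => // _; case: i; rewrite /expo_idx /idx_wt /=;
    rewrite ?(mulr0, mul0r, addr0, add0r, oppr0, mulr1) ?intrM -?pmulrn ?mulNr //.
exact: pmon_weight.
Qed.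

Lemma exists_singular_delta (n : nat) : (0 < n)%N -> lambda Delta = n%:R ->
  exists v : M, [/\ v != 0, forall b, b \in pos_basis -> X b *: v = 0
    & weight_vector (mu - even_root K Delta *+ n) v].
Proof.
move=> n0 ln; pose d : expo := (n%:Z, 0, 0).
have envn : env d 0 = n%:R by rewrite /env /= -pmulrn.
have ok : pvect_ok delta_vector d.
  move=> t; rewrite !inE => /or4P[|||/or3P[]] /eqP-> /=; split=> //.
  1-5: right; apply: expo_idxE => //=; rewrite /addx /= ?(addr0, add0r) //.
  1-4: by rewrite subr_ge0 lez_nat.
  case: n n0 @d envn {ln} => // -[_ d envn|n _ d _]; [left|right].
    change (peval d (pmul (pvar 0) (pvar 0 ++ pint (-1))) = 0).
    by rewrite peval_mul peval_cat !peval_var peval_int envn mulrN1z subrr mulr0.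
  by apply: expo_idxE => //=; rewrite subr_ge0 lez_nat.
have fE i : peval d (subst_delta i) = env d i.
  case: i => [|[|[|[|i]]]]; rewrite ?peval_var //.
  1,2: by rewrite /peval /feval big_nil.
  change (peval d (pvar 0 ++ pint 1) = env d 3); rewrite peval_cat peval_var peval_int envn
    /env /= ffunE ln ffunE rho_eps /=.
  by rewrite opprK.
(* The coefficient at F^(n-1) x_{++} x_{+-} f1 v is 2 n sigma_1, and sigma_1
   is 1/2. *)
pose j : idx := (n.-1, 1%N, 0%N, [:: (true, true); (true, false)]).
have vj : pcoord j (pvect_eval delta_vector d) = n%:R.
  rewrite /pcoord coef_pvect // /vect_of veval_flatten.
  pose t0 : scalar_poly * (expo * seq letter) :=
    (pmul (pint 2) (pmul (pvar 0) (pvar 6)), ((-1, 1, 0), j.2)).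
  have t0P : t0 \in delta_vector by vm_compute.
  have uP : uniq delta_vector by vm_compute.
  rewrite (bigD1_seq t0) //= big1_seq ?addr0 => [|t /andP[tt0 tP]].
    rewrite veval_mul veval_key !peval_mul peval_int !peval_var envn.
    rewrite (_ : (addx d (-1, 1, 0), _) = idx_pbw j) ?eqxx; last first.
      by rewrite /idx_pbw /addx /= !(addr0, add0r) -[in LHS](prednK n0) -addn1 PoszD addrK.
    by rewrite /env /= mulr1 mulrCA mul1r mulfV ?mulr1 // pnatr_eq0.
  rewrite veval_mul veval_key.
  have /allP/(_ t tP) : all (fun t => (t == t0) || (t.2.2 != j.2)) delta_vector by vm_compute.
  by rewrite (negPf tt0) /= => /negPf tj; rewrite xpair_eqE tj andbF mulr0.
exists (pvect_eval delta_vector d); split.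
- apply: contraTneq n0 => v0; rewrite -leqNgt leqn0 -(eqr_nat K) -vj v0.
  by rewrite pcoord0.
- move=> b bp; apply: (pvect_pos ok fE _ bp); exact: delta_check.
(* All terms lie n times 2 delta below the highest weight, since the shifts
   of the exponents balance the weights of the words. *)
have key t i : t \in delta_vector -> (mu - even_root K Delta *+ n) i =
    mu i + (basis_wt feps2 i * (addx d t.2.1).2 + basis_wt feps1 i * (addx d t.2.1).1.2
     + foldr (fun u s => basis_wt (odd_neg u) i + s) 0 t.2.2
     + basis_wt fdelta i * (addx d t.2.1).1.1)%:~R.
  move=> tP; rewrite ffunE; congr (_ + _); rewrite ffunE even_root_mulrn.
  have : all (fun t : scalar_poly * (expo * seq letter) => all (fun i =>
      basis_wt feps2 i * t.2.1.2 + basis_wt feps1 i * t.2.1.1.2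
     + foldr (fun u s => basis_wt (odd_neg u) i + s) 0 t.2.2
     + basis_wt fdelta i * t.2.1.1.1 == 0) axes) delta_vector by vm_compute.
  move=> /allP/(_ t tP)/allP/(_ i); rewrite (_ : i \in axes) => [/(_ isT)/eqP E|]; last by
    case: i.
  rewrite /addx /d [(_, _).1]/= [(_, _).2]/=; move: E; set S := foldr _ _ _ => E.
  rewrite [X in X%:~R](_ : _ = basis_wt fdelta i * n%:Z); last first.
    by apply/eqP; rewrite -subr_eq0 -[X in _ == X]E /=; apply/eqP; ring.
  case: (i); rewrite /= ?mul0r ?mulr0 ?oppr0 // mulr1 intrM -pmulrn.
  by rewrite mulNr.
apply: ksub_sum => [|t tP]; first exact: weight_vector_lin.
have [tw [->|tE]] := ok t tP.
  by rewrite scale0r scale0r; exact: weight_vector0.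
apply: (ksubZ _ (weight_vector_lin _ _)).
rewrite (_ : mu - _ = idx_weight lambda (expo_idx (addx d t.2.1) t.2.2)); first exact:
  pmon_weight.
apply/ffunP => i; rewrite (key t i tP) idx_weightE /idx_wt.
have /= -> := congr1 (fun k : pbw => k.1.2) tE.
have /= -> := congr1 (fun k : pbw => k.1.1.2) tE.
by have /= -> := congr1 (fun k : pbw => k.1.1.1) tE.
Qed.

Lemma exists_singular gamma (n : nat) : lambda gamma = n%:R ->
  exists v : M, [/\ v != 0, forall b, b \in pos_basis -> X b *: v = 0
    & weight_vector (mu - even_root K gamma *+ n) v].
Proof.
have [->|gD] := eqVneq gamma Delta; last exact: exists_singular_eps.
case: n => [_|n]; last exact: exists_singular_delta.
exists (hwv zeta lambda); split.
- apply/eqP => /(congr1 (coef (fun=> 1))); rewrite coef_hwv coef_zero.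
  by move/eqP; rewrite oner_eq0.
- exact: X_pos.
- by rewrite mulr0n subr0; exact: hwv_weight.
Qed.

Lemma singular_vectorP kappa (v : M) : weight_vector kappa v ->
  (forall b, b \in pos_basis -> X b *: v = 0) -> singular_vector v.
Proof.
move=> vk v0; split; first by exists kappa.
move=> x; rewrite nposE => /bspanP xn; rewrite X_sum scaler_suml big1 // => b _.
rewrite kscale_alg; have [/v0->|/xn->] := boolP (b \in pos_basis); first exact: scaler0.
by rewrite scale0r scale0r.
Qed.

End Singular.

(** * Submodules and chains with irreducible factors *)

Section SubmodOf.
Variables (A : pzRingType) (M : lmodType A).

Definition prop_submod (P : M -> Prop) : Prop :=
  P 0 /\ forall a x y, P x -> P y -> P (a *: x + y).

Definition submod_pred P (_ : prop_submod P) : pred M := fun x => `[< P x >].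

Fact submod_pred_closed P (cP : prop_submod P) : submod_closed (submod_pred cP).
Proof.
case: (cP) => P0 Pl; split=> [|a x y /asboolP Px /asboolP Py]; first exact/asboolP.
exact/asboolP/Pl.
Qed.
HB.instance Definition _ P (cP : prop_submod P) :=
  GRing.isSubmodClosed.Build A M (submod_pred cP) (submod_pred_closed cP).

(** Submodules are boolean predicates; this packages a propositional one by
    classical reflection. *)
Definition submod_of P (cP : prop_submod P) : submodClosed M :=
  GRing.SubmodClosed.clone A M (submod_pred cP) _.

Lemma submod_ofP P (cP : prop_submod P) x : reflect (P x) (x \in submod_of cP).
Proof. exact: asboolP. Qed.

Lemma zero_prop : prop_submod (fun x => x = 0).
Proof. by split=> // a x y -> ->; rewrite scaler0 addr0. Qed.

Lemma full_prop : prop_submod (fun _ => True). Proof. by []. Qed.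

End SubmodOf.

Section ModuleIso.
Variable A : pzRingType.
Implicit Types M N Q : lmodType A.

Lemma mod_iso_sym M N : mod_iso M N -> mod_iso N M.
Proof.
case=> f [g fK gK].
have gl : linear g by move=> a x y; apply: (can_inj fK); rewrite linearP !gK.
pose gL := GRing.isLinear.Build A N M _ g gl.
by exists (HB.pack_for {linear N -> M} g gL); exists f.
Qed.

Lemma first_iso M Q (N : submodClosed M) (f : {linear M -> Q}) :
    (forall q, exists x, f x = q) -> (forall x, f x = 0 <-> x \in N) ->
  mod_iso (quotMod N) Q.
Proof.
move=> fs fk.
pose h (u : quotMod N) : Q := f (repr u).
have hE x : h (quot_proj N x) = f x.
  apply/eqP; rewrite -subr_eq0 -linearB; apply/eqP/fk/quot_projP.
  by rewrite /quot_proj reprK.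
have hl : linear h.
  move=> a u v; have [x ->] := quot_surj u; have [y ->] := quot_surj v.
  by rewrite -linearP /= !hE linearP.
pose hL := GRing.isLinear.Build A (quotMod N) Q _ h hl.
exists (HB.pack_for {linear quotMod N -> Q} h hL) => /=.
have hi : injective h.
  move=> u v; have [x ->] := quot_surj u; have [y ->] := quot_surj v.
  rewrite !hE => fxy; apply/quot_projP/fk.
  by rewrite linearB fxy subrr.
pose g q := quot_proj N (projT1 (cid (fs q))).
have gK : cancel g h by move=> q; rewrite /g hE; case: (cid _).
by exists g => // u; apply: hi; rewrite gK.
Qed.

End ModuleIso.

Section Subquot.
Variables (A : pzRingType) (M : lmodType A).
Implicit Types N P Q : submodClosed M.

Definition sq_proj N P x (xP : x \in P) : subquot N P :=
  quot_proj _ (SubmodElt xP).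

Lemma sq_surj N P (u : subquot N P) : exists x (xP : x \in P), u = sq_proj N xP.
Proof. by have [[x xP] ->] := quot_surj u; exists x, xP. Qed.

Lemma sq_eq0 N P x (xP : x \in P) : sq_proj N xP = 0 <-> x \in N.
Proof.
rewrite /sq_proj -(raddf0 (quot_proj _)).
by split=> [/quot_projP|xN]; [|apply/quot_projP]; rewrite subr0.
Qed.

Lemma sq_lin N P a x y (xP : x \in P) (yP : y \in P) (zP : a *: x + y \in P) :
  sq_proj N zP = a *: sq_proj N xP + sq_proj N yP.
Proof. by rewrite /sq_proj -linearP; congr quot_proj; apply: val_inj. Qed.

Lemma sq_irr N P x (xP xP' : x \in P) : sq_proj N xP = sq_proj N xP'.
Proof. by congr sq_proj; exact: bool_irrelevance. Qed.

(** Lattice form of irreducibility: a submodule of P/N is pulled back to P. *)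
Lemma irreducible_subquot N P : submod_sub N P ->
    (exists2 x, x \in P & x \notin N) ->
    (forall Q, submod_sub N Q -> submod_sub Q P -> (exists2 x, x \in Q & x \notin N) ->
       submod_sub P Q) ->
  irreducible_mod (subquot N P).
Proof.
move=> subNP [x xP xN] maxN; split.
  by exists (sq_proj N xP); apply: contraNneq xN => /sq_eq0.
move=> N' [u uN' u0] v.
have cQ : prop_submod (fun y => exists2 yP : y \in P, sq_proj N yP \in N' & True).
  split.
    by exists (rpred0 P) => //; rewrite (iffRL (sq_eq0 _ _)) ?rpred0.
  move=> a y z [yP yN' _] [zP zN' _].
  have wP : a *: y + z \in P by rewrite rpredD ?rpredZ.
  by exists wP => //; rewrite (sq_lin _ yP zP) rpredD ?rpredZ.
have [y [yP vE]] := sq_surj v.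
have : y \in submod_of cQ.
  apply: (maxN _ _ _ _ _ yP).
  - move=> z zN; apply/submod_ofP.
    have zP : z \in P by exact: subNP.
    by exists zP => //; rewrite (iffRL (sq_eq0 _ _)) ?rpred0.
  - by move=> z /submod_ofP[].
  have [z [zP uE]] := sq_surj u; exists z.
    by apply/submod_ofP; exists zP; rewrite // -uE.
  by apply: contraNN u0 => zN; rewrite uE; apply/eqP/sq_eq0.
by move=> /submod_ofP[yP' ? _]; rewrite vE (sq_irr _ _ yP').
Qed.

Definition simple_step N P : Prop := submod_sub N P /\ irreducible_mod (subquot N P).

Fixpoint step_chain N (s : seq (submodClosed M)) : Prop :=
  if s is P :: s' then simple_step N P /\ step_chain P s' else True.

Lemma step_chain_cat N s s' :
  step_chain N (s ++ s') <-> step_chain N s /\ step_chain (last N s) s'.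
Proof. by elim: s N => [|P s IH] N /=; [tauto|rewrite IH; tauto]. Qed.

Lemma step_chain_nth N s i : step_chain N s -> (i < size s)%N ->
  simple_step (nth N (N :: s) i) (nth N (N :: s) i.+1).
Proof.
have gen N0 : step_chain N s -> (i < size s)%N ->
    simple_step (nth N0 (N :: s) i) (nth N0 (N :: s) i.+1).
  elim: s N i => // P s IH N [|i] /= [NP Ps] ?; first by [].
  exact: IH.
exact: gen.
Qed.

Variable d : submodClosed M -> nat.
Hypothesis d_strict : forall N P, submod_sub N P -> (exists2 x, x \in P & x \notin N) ->
  (d N < d P)%N.

(** If P/N is reducible, an intermediate submodule splits the problem in two,
    and the strictly increasing integer [d] makes this terminate. *)
Lemma step_chain_exists N P : submod_sub N P -> (exists2 x, x \in P & x \notin N) ->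
  exists s, step_chain N s /\ last N s = P.
Proof.
have [k] := ubnP (d P - d N); elim: k N P => // k IH N P dk NP PN.
have [irr|] := pselect (irreducible_mod (subquot N P)); first by exists [:: P].
have [[Q [NQ QP QN PQ]] _|noQ irr] := pselect (exists Q, [/\ submod_sub N Q,
    submod_sub Q P, exists2 x, x \in Q & x \notin N & exists2 x, x \in P & x \notin Q]).
  have dNQ := d_strict NQ QN; have dQP := d_strict QP PQ.
  have [|s [Ns sQ]] := IH N Q _ NQ QN; first by lia.
  have [|t [Qt tP]] := IH Q P _ QP PQ; first by lia.
  by exists (s ++ t); rewrite step_chain_cat last_cat sQ.
case: irr; apply: irreducible_subquot => // Q NQ QP QN x xP.
apply: contrapT => /negP xQ; apply: noQ; exists Q; split=> //; by exists x.
Qed.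

End Subquot.

(** * The multiplicity of a quotient of the source of a homomorphism *)

Section ImageFactor.
Variables (A : pzRingType) (M1 M : lmodType A) (f : {linear M1 -> M}).
Variable N1 : submodClosed M1.
Hypothesis kerN1 : forall x, f x = 0 -> x \in N1.

Lemma image_prop (P : submodClosed M1) : prop_submod (fun y => exists2 x, x \in P & f x = y).
Proof.
split; first by exists 0; rewrite ?rpred0 ?linear0.
move=> a y z [x xP <-] [x' x'P <-]; exists (a *: x + x'); last by rewrite linearP.
by rewrite rpredD ?rpredZ.
Qed.

Definition image_sub : submodClosed M := submod_of (image_prop N1).
Definition image_full : submodClosed M := submod_of (image_prop (submod_of (full_prop M1))).

Lemma image_fullP x : f x \in image_full.
Proof. by apply/submod_ofP; exists x => //; apply/submod_ofP. Qed.

Lemma image_subP x : f x \in image_sub <-> x \in N1.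
Proof.
split=> [/submod_ofP[y yN fy]|xN]; last by apply/submod_ofP; exists x.
rewrite -[x](subrK y) rpredD //; apply: kerN1.
by rewrite linearB fy subrr.
Qed.

Lemma image_sub_full : submod_sub image_sub image_full.
Proof. by move=> _ /submod_ofP[x _ <-]; exact: image_fullP. Qed.

(** Because N1 contains the kernel, f induces an isomorphism from M1/N1 onto
    f(M1)/f(N1). *)
Lemma image_factor_iso : mod_iso (subquot image_sub image_full) (quotMod N1).
Proof.
apply: mod_iso_sym.
pose g x := sq_proj image_sub (image_fullP x).
have gl : linear g.
  move=> a x y; rewrite /g -(sq_lin _ _ _ (rpredD (rpredZ a (image_fullP x)) (image_fullP y))).
  have E : a *: f x + f y = f (a *: x + y) by rewrite linearP.
  by move: (rpredD _ _); rewrite E => h; apply: sq_irr.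
pose gL := GRing.isLinear.Build A M1 (subquot image_sub image_full) _ g gl.
apply: (first_iso (f := HB.pack_for {linear M1 -> subquot image_sub image_full} g gL)).
  move=> q; have [y [yI ->]] := sq_surj q.
  have /submod_ofP[x _ xy] := yI; case: _ / xy yI => yI; exists x => /=.
  exact: sq_irr.
by move=> x; rewrite /= /g sq_eq0 image_subP.
Qed.

Hypothesis N1_max : forall Q : submodClosed M1, (exists2 x, x \in Q & x \notin N1) ->
  forall x, x \in Q.
Hypothesis N1_proper : exists x, x \notin N1.
Variable d : submodClosed M -> nat.
Hypothesis d_strict : forall N P : submodClosed M,
  submod_sub N P -> (exists2 x, x \in P & x \notin N) -> (d N < d P)%N.

Lemma preim_prop (Q : submodClosed M) : prop_submod (fun x => f x \in Q).
Proof.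
split; first by rewrite linear0 rpred0.
by move=> a x y xQ yQ; rewrite linearP rpredD ?rpredZ.
Qed.

(** A submodule between f(N1) and f(M1) is determined by its preimage, and N1
    is maximal. *)
Lemma image_factor_irr : irreducible_mod (subquot image_sub image_full).
Proof.
apply: irreducible_subquot; first exact: image_sub_full.
  have [x xN] := N1_proper; exists (f x); first exact: image_fullP.
  by apply: contra xN => /image_subP.
move=> Q _ QI [y yQ yN] _ /submod_ofP[x _ <-].
have /submod_ofP[z _ zy] := QI _ yQ; rewrite -zy in yQ yN.
suff /submod_ofP : x \in submod_of (preim_prop Q) by [].
apply: N1_max; exists z; first exact/submod_ofP.
by apply: contra yN => /image_subP.
Qed.

(** The chain 0 <= f(N1) < f(M1) <= M is refined on both sides of its middle
    step, which is the required factor. The two outer steps may be trivial. *)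
Lemma comp_mult_image : exists2 m, comp_mult M (quotMod N1) m & (0 < m)%N.
Proof.
pose Z : submodClosed M := submod_of (zero_prop M).
pose F : submodClosed M := submod_of (full_prop M).
have [Z0 [s1 [Z00 [ch1 l1]]]] : exists (Z0 : submodClosed M) s1,
    (forall x, x \in Z0 -> x = 0) /\ step_chain Z0 s1 /\ last Z0 s1 = image_sub.
  have [[x xA x0]|noA] := pselect (exists2 x, x \in image_sub & x != 0).
    have [||s [? ?]] := @step_chain_exists _ _ d d_strict Z image_sub.
    - by move=> y /submod_ofP->; rewrite rpred0.
    - by exists x => //; apply: contra x0 => /submod_ofP->.
    by exists Z, s; split=> // y /submod_ofP.
  exists image_sub, [::]; split=> // x xA; apply: contrapT => /eqP x0.
  by apply: noA; exists x.
have [s2 [ch2 l2]] : exists s2, step_chain image_full s2 /\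
    forall x, x \in last image_full s2.
  have [[x xI]|noI] := pselect (exists x, x \notin image_full).
    have [||s [? sF]] := @step_chain_exists _ _ d d_strict image_full F.
    - by move=> y _; apply/submod_ofP.
    - by exists x => //; apply/submod_ofP.
    by exists s; split=> // y; rewrite sF; apply/submod_ofP.
  exists [::]; split=> // x; apply: contrapT => /negP xI.
  by apply: noI; exists x.
pose s := s1 ++ image_full :: s2; pose N i := nth Z0 (Z0 :: s) i.
have chs : step_chain Z0 s.
  rewrite step_chain_cat l1; split=> //; split=> //.
  by split; [exact: image_sub_full|exact: image_factor_irr].
have cs : composition_series (size s) N.
  split=> [x|x|i ins]; first exact: Z00; last exact: step_chain_nth.
  by rewrite /N -last_nth last_cat.
exists (composition_count (size s) N (quotMod N1)); first by exists (size s), N.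
have i_lt : (size s1 < size s)%N by rewrite size_cat /= addnS ltnS leq_addr.
rewrite /composition_count card_gt0; apply/set0Pn; exists (Ordinal i_lt).
rewrite inE; apply/asboolP => /=.
have -> : N (size s1) = image_sub.
  by rewrite /N -cat_cons nth_cat /= ltnSn -l1 -last_nth.
have -> : N (size s1).+1 = image_full.
  by rewrite /N -cat_cons nth_cat /= ltnn subnn.
exact: image_factor_iso.
Qed.

End ImageFactor.

(** * Weight components, the maximal submodule, and the universal property *)

Section WeightSeparation.
Variables (K : numFieldType) (zeta : K) (M : lmodType (uenv (D21 zeta))).
Variable N : submodClosed M.
Local Notation X := (X zeta).

(** Submodules contain the weight components of their elements. Applying h_i
    - kappa_i, for a coroot at which kappa differs from kappa0, kills the
    component at kappa and rescales the one at kappa0 by a nonzero scalar. *)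
Lemma weight_sep1 (r : seq (weight K)) kappa0 (m0 : M) (m : weight K -> M) :
    kappa0 \notin r -> weight_vector kappa0 m0 ->
    (forall kappa, kappa \in r -> weight_vector kappa (m kappa)) ->
  m0 + \sum_(kappa <- r) m kappa \in N -> m0 \in N.
Proof.
elim: r m0 m => [|kappa r IH] m0 m; first by rewrite big_nil addr0.
rewrite inE negb_or => /andP[k0k k0r] m0w mw.
rewrite big_cons => sN.
have /existsP[i ki] : [exists i, kappa0 i != kappa i].
  rewrite -negb_forall; apply: contra k0k => /forallP kk.
  by apply/eqP/ffunP => i; exact/eqP.
pose u := X (inl (i, SH)) - (kappa i)%:A.
have uE kappa' (m' : M) : weight_vector kappa' m' -> u *: m' = (kappa' i - kappa i)%:A *: m'.
  by move=> /weight_vectorP mk; rewrite /u scalerBl mk -scalerBl -scalerBl.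
have wZ c kappa' (m' : M) : weight_vector kappa' m' -> weight_vector kappa' (c%:A *: m').
  exact: (ksubZ _ (weight_vector_lin _ _)).
have mr kappa' : kappa' \in r -> weight_vector kappa' (m kappa').
  by move=> kr; apply: mw; rewrite inE kr orbT.
have : (kappa0 i - kappa i)%:A *: m0 \in N.
  apply: (IH _ (fun kappa' => (kappa' i - kappa i)%:A *: m kappa')) => //.
  - exact: wZ.
  - by move=> kappa' kr; apply/wZ/mr.
  have := rpredZ u sN; rewrite !scalerDr (uE _ _ m0w) (uE kappa); last first.
    by apply: mw; rewrite mem_head.
  rewrite subrr scale0r scale0r add0r scaler_sumr.
  by congr (_ + _ \in N); apply: eq_big_seq => kappa' kr; apply/uE/mr.
move=> /(rpredZ ((kappa0 i - kappa i)^-1)%:A); rewrite kscaleA mulVf ?scale1r ?scale1r //.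
by rewrite subr_eq0.
Qed.

Lemma weight_sep (r : seq (weight K)) (m : weight K -> M) :
    uniq r -> (forall kappa, kappa \in r -> weight_vector kappa (m kappa)) ->
  \sum_(kappa <- r) m kappa \in N -> forall kappa, kappa \in r -> m kappa \in N.
Proof.
move=> ru mw sN kappa kr.
have pr := perm_to_rem kr; have := rem_uniq kappa ru.
have rK : kappa \notin rem kappa r by rewrite (perm_uniq pr) /= in ru; case/andP: ru.
move=> _; apply: (weight_sep1 rK (mw _ kr) (m := m)).
  by move=> k kin; apply: mw; exact: mem_rem kin.
by move: sN; rewrite (perm_big _ pr) big_cons.
Qed.

End WeightSeparation.

Section Verma1.
Variables (K : numFieldType) (zeta : K) (lambda : weight K).
Local Notation U := (uenv (D21 zeta)).
Local Notation M := (Verma zeta lambda).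
Local Notation X := (X zeta).
Local Notation mu := (lambda - rho K).
Local Notation hwv := (hwv zeta lambda).
Local Notation pmon := (pmon zeta lambda).
Local Notation pcoord := (@pcoord K zeta lambda).
Local Notation wt := (idx_weight lambda).

Lemma weight_decomp (m : M) : exists (r : seq (weight K)) (p : weight K -> M),
  [/\ uniq r, forall kappa, weight_vector kappa (p kappa) & m = \sum_(kappa <- r) p kappa].
Proof.
have [js0 jw0 mE] := pmon_expand m; pose js := undup js0.
have {}mE : m = \sum_(j <- js) (pcoord j m)%:A *: pmon j.
  apply: mE => [|j|]; first exact: undup_uniq; first by rewrite mem_undup.
  by apply/allP => j; rewrite mem_undup => /(allP jw0).
exists (undup (map wt js)), (fun kappa => \sum_(j <- js | wt j == kappa) (pcoord j m)%:A *:
  pmon j).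
split=> [|kappa|]; first exact: undup_uniq.
  elim/big_ind: _ => [|x y xk yk|j /eqP<-]; first exact: weight_vector0.
    exact: (ksubD (weight_vector_lin _ _)).
  by apply: (ksubZ _ (weight_vector_lin _ _)); exact: pmon_weight.
rewrite {1}mE; under [RHS]eq_bigr => kappa _ do rewrite big_mkcond.
rewrite exchange_big; apply: eq_big_seq => j jjs /=.
have wj : wt j \in undup (map wt js) by rewrite mem_undup map_f.
rewrite (bigD1_seq (wt j)) ?undup_uniq //= eqxx big1 ?addr0 // => kappa.
by rewrite eq_sym => /negPf->.
Qed.

Definition sign_sum (i : axis) (l : seq letter) : int :=
  foldr (fun u s => basis_wt (odd_neg u) i + s) 0 l.

Lemma sign_sum_delta l : sign_sum Delta l = - (size l)%:Z.
Proof. by elim: l => //= u l ->; lia. Qed.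

Lemma sign_sum_bound i l : `|sign_sum i l| <= (size l)%:Z.
Proof.
elim: l => //= u l IH; apply: le_trans (ler_normD _ _) _.
have -> : `|basis_wt (odd_neg u) i| = 1 by case: i {IH}; case: u => [[] []].
by rewrite -add1n PoszD lerD2l.
Qed.

Lemma words_size l : l \in words -> (size l <= 4)%N.
Proof.
move=> lw; have : all (fun l => size l <= 4)%N words by [].
by move=> /allP/(_ l lw).
Qed.

Lemma idx_wt_delta j : idx_wt j Delta = - (2 * j.1.1.1 + size j.2)%:Z.
Proof. by rewrite /idx_wt -/(sign_sum _ _) sign_sum_delta /=; lia. Qed.
Lemma idx_wt_eps1 j : idx_wt j Eps1 = sign_sum Eps1 j.2 - (2 * j.1.1.2)%:Z.
Proof. by rewrite /idx_wt -/(sign_sum _ _) /=; lia. Qed.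
Lemma idx_wt_eps2 j : idx_wt j Eps2 = sign_sum Eps2 j.2 - (2 * j.1.2)%:Z.
Proof. by rewrite /idx_wt -/(sign_sum _ _) /=; lia. Qed.

Lemma idx_weight_inj j j' : wt j = wt j' -> forall i, idx_wt j i = idx_wt j' i.
Proof.
move=> jj i; have := congr1 (fun k : weight K => k i) jj.
by rewrite !idx_weightE => /addrI/eqP; rewrite eqr_int => /eqP.
Qed.

Definition idx0 : idx := (0%N, 0%N, 0%N, [::]).

Lemma pmon0 : pmon idx0 = hwv.
Proof. by rewrite /pmon !expr0 !scale1r Xw_nil. Qed.

Lemma idx_weight0 j : wt j = wt idx0 -> j = idx0.
Proof.
move=> jj; have E := idx_weight_inj jj.
have := E Delta; have := E Eps1; have := E Eps2.
rewrite !(idx_wt_delta, idx_wt_eps1, idx_wt_eps2); case: j {jj E} => [[[a b] c] l] /=.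
move=> e2 e1 e0; have al : a = 0%N /\ size l = 0%N by lia.
by case: al e1 e2 => -> /size0nil -> /= e1 e2; congr (_, _, _, _); lia.
Qed.

(** The highest weight space is the line of v. If the coordinate on it were
    nonzero, a weight component in N would be a nonzero multiple of v, which
    generates everything. *)
Lemma proper_pcoord0 (N : submodClosed M) m : proper_submod N -> m \in N -> pcoord idx0 m = 0.
Proof.
move=> [x xN] mN; have [r [p [ru pw mE]]] := weight_decomp m.
have hN : hwv \notin N by apply: contra xN => hN; exact: (hwv_gen hN).
rewrite mE /pcoord raddf_sum big1_seq // => kappa /= kr; apply/eqP.
apply: contraNT hN => ck.
have pN : p kappa \in N.
  by apply: (weight_sep ru _ _ kr) => [k _|]; rewrite -?mE.
have k0 := pcoord_weight (pw kappa) ck.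
have pE : p kappa = (pcoord idx0 (p kappa))%:A *: hwv.
  rewrite -pmon0 {1}(pmon_expand_in (js := [:: idx0]) _ _ (m := p kappa)) ?big_seq1 // => j cj.
  by rewrite inE (idx_weight0 (_ : wt j = wt idx0)) // -k0 -(pcoord_weight (pw kappa) cj).
have := rpredZ ((pcoord idx0 (p kappa))^-1%:A) pN.
by rewrite {2}pE kscaleA mulVf ?scale1r ?scale1r.
Qed.

(** By linearity the coordinate at v also vanishes on sums of elements of
    proper submodules, while it is 1 at v. *)
Lemma hwv_maxsub : hwv \notin (@maxsub U M).
Proof.
apply/negP => /asboolP[s sP hE].
have : pcoord idx0 hwv = 1 by rewrite -pmon0 pcoord_mon // eqxx.
rewrite hE /pcoord raddf_sum big1_seq => [/esym/eqP|y /= ys]; first by rewrite oner_eq0.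
by have [N Np yN] := sP y ys; exact: proper_pcoord0 Np yN.
Qed.

End Verma1.

Lemma maxsub_max (A : pzRingType) (M : lmodType A) (Q : submodClosed M) :
  (exists2 x, x \in Q & x \notin @maxsub A M) -> forall x, x \in Q.
Proof.
move=> [x xQ xm] y; apply: contrapT => /negP yQ; move/negP: xm; apply.
apply/asboolP; exists [:: x]; last by rewrite big_seq1.
by move=> z; rewrite inE => /eqP->; exists Q => //; exists y.
Qed.

Section Universal.
Variables (K : numFieldType) (zeta : K) (lambda : weight K).
Variable (M : lmodType (uenv (D21 zeta))) (v : M).
Local Notation U := (uenv (D21 zeta)).
Local Notation mu := (lambda - rho K).
Hypothesis v_weight : weight_vector mu v.
Hypothesis v_sing : singular_vector v.

Lemma singular_borel (b : uenv (subLie (borel zeta))) :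
  uenv_sub b *: v = (@borel_char K zeta mu b : K)%:A *: v.
Proof.
elim/uenv_ind: b => [x|c|a b IHa IHb|a b IHa IHb].
- rewrite /uenv_sub ulift_gen /borel_char ulift_gen /= /borel_char_fun.
  have /memv_addP[h hC [n nN ->]] := subvsP x.
  rewrite linearD scalerDl (v_weight hC) (proj2 v_sing _ nN) addr0.
  have := @pairing_linear K zeta mu 1 h n; rewrite !scale1r => ->.
  by rewrite (pairing_npos _ nN) addr0.
- rewrite /uenv_sub /borel_char !ulift_const; congr (_%:A *: v).
  exact: esym (mulr1 c).
- by rewrite !rmorphD /= !scalerDl IHa IHb.
- rewrite !rmorphM /= -scalerA IHb kscaleC IHa kscaleA; congr (_%:A *: v).
  exact: mulrC.
Qed.

Local Notation h := (fun (u : U) (c : oneDim (@borel_char K zeta mu)) => u *: ((c : K)%:A *: v)).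

Fact verma_map_addl a a' c : h (a + a') c = h a c + h a' c.
Proof. exact: scalerDl. Qed.
Fact verma_map_addr a c c' : h a (c + c') = h a c + h a c'.
Proof.
have -> : ((c + c' : oneDim _) : K)%:A = (c : K)%:A + (c' : K)%:A :> U by exact: scalerDl.
by rewrite scalerDl scalerDr.
Qed.
Fact verma_map_bal a b c : h (a * uenv_sub b) c = h a (b *: c).
Proof.
rewrite /= -scalerA kscaleC singular_borel kscaleA.
congr (_ *: (_%:A *: v)); exact: mulrC.
Qed.

Definition verma_map : Verma zeta lambda -> M :=
  @ind_lift U _ (@uenv_sub K (D21 zeta) (borel zeta)) _ M h.

Fact verma_map_lin : linear verma_map.
Proof.
have z := ind_lift_zmod verma_map_addl verma_map_addr verma_map_bal.
have zN y : verma_map (- y) = - verma_map y.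
  by rewrite -[- y]sub0r [LHS]z -(subrr y) z subrr sub0r.
move=> a x y; rewrite -[y in LHS]opprK [LHS]z -/(verma_map _) -/(verma_map _) zN opprK.
congr (_ + _); apply: (ind_lift_act verma_map_addl verma_map_addr verma_map_bal (k := fun a m
  => a *: m)).
- exact: scaler0.
- exact: scalerN.
- exact: scalerDr.
- by move=> b c n; rewrite /= -scalerA.
Qed.

Lemma verma_map_hwv : verma_map (hwv zeta lambda) = v.
Proof. by rewrite [LHS](ind_lift_pi verma_map_addl verma_map_addr verma_map_bal) /= !scale1r. Qed.

(** A vector that satisfies the defining relations of the highest weight
    vector is the image of that vector. *)
Lemma verma_universal : exists f : {linear Verma zeta lambda -> M}, f (hwv zeta lambda) = v.
Proof.
pose fL := GRing.isLinear.Build U (Verma zeta lambda) M _ verma_map verma_map_lin.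
by exists (HB.pack_for {linear Verma zeta lambda -> M} verma_map fL); exact: verma_map_hwv.
Qed.

End Universal.

(** * Casimir elements of the three copies of sl2 *)

(** A nonzero polynomial has finitely many roots, in particular in c + Z. *)
Lemma root_bound (K : numFieldType) (q : {poly K}) (c : K) : q != 0 ->
  exists B : nat, forall k : int, root q (c + k%:~R) -> `|k| <= B%:Z.
Proof.
have [n] := ubnP (size q); elim: n q => // n IH q qn q0.
have [[k0 /factor_theorem[q' qE]]|nok] := pselect (exists k : int, root q (c + k%:~R)).
  have q'0 : q' != 0 by apply: contraNneq q0 => q'0; rewrite qE q'0 mul0r.
  have [|B HB] := IH q' _ q'0.
    by move: qn; rewrite qE size_Mmonic ?monicXsubC // size_XsubC addn2.
  exists (B + `|k0|)%N => k; rewrite qE rootM root_XsubC => /orP[/HB|]; first by lia.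
  by move=> /eqP/addrI/eqP; rewrite eqr_int => /eqP ->; lia.
by exists 0%N => k rk; case: nok; exists k.
Qed.

Section Casimir.
Variables (K : numFieldType) (zeta : K).
Local Notation U := (uenv (D21 zeta)).
Local Notation X := (X zeta).
Local Notation E i := (X (inl (i, SE))).
Local Notation H i := (X (inl (i, SH))).
Local Notation F i := (X (inl (i, SF))).

(** Four times the sl2 Casimir element f e + h (h + 2) / 4; on a vector of
    weight k killed by e it is k (k + 2). *)
Definition casimir (i : axis) : U := 4 *: (F i * E i) + H i * H i + 2 *: H i.

Lemma even_comm i j x y : i != j ->
  X (inl (i, x)) * X (inl (j, y)) = X (inl (j, y)) * X (inl (i, x)).
Proof. by move=> ij; apply: X_comm => //=; rewrite (negPf ij). Qed.

Lemma HF i : H i * F i = F i * H i - 2 *: F i.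
Proof.
rewrite X_mul expr0 scale1r /= eqxx big_cons big_nil addr0; congr (_ + _).
by rewrite /scoef_eval mul1r /= scaleNr.
Qed.

Lemma EF i : E i * F i = F i * E i + H i.
Proof.
rewrite X_mul expr0 scale1r /= eqxx big_cons big_nil addr0; congr (_ + _).
by rewrite /scoef_eval mul1r scale1r.
Qed.

(** The Casimir element is central in its sl2, and the other two sl2 commute
    with that one. *)
Lemma casimir_comm i j : casimir i * F j = F j * casimir i.
Proof.
rewrite /casimir !mulrDl !mulrDr -!scalerAl -!scalerAr.
have [<-|ij] := eqVneq i j; last first.
  have c x := even_comm x SF ij.
  by rewrite -!mulrA !c !mulrA !c -!mulrA.
have fe : F i * E i * F i = F i * (F i * E i) + F i * H i.
  by rewrite -mulrA EF mulrDr.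
have hh : H i * H i * F i = F i * (H i * H i) - 4 *: (F i * H i) + 4 *: F i.
  rewrite -mulrA HF mulrBr -scalerAr [H i * (F i * H i)]mulrA HF mulrBl -scalerAl -mulrA
    scalerBr scalerA.
  have -> : 4 *: (F i * H i) = 2 *: (F i * H i) + 2 *: (F i * H i).
    by rewrite -scalerDl -natrD.
  by rewrite -natrM opprB opprD !addrA addrAC.
rewrite fe hh HF !scalerDr scalerN scalerA -natrM -!addrA; congr (_ + _).
by rewrite addrCA; congr (_ + _); rewrite addNKr addrC subrK.
Qed.

Lemma X_casimir_poly i j p (M : lmodType U) (m : M) :
  horner_alg (casimir i) p *: (F j *: m) = F j *: (horner_alg (casimir i) p *: m).
Proof.
rewrite !scalerA; congr (_ *: _).
elim/poly_ind: p => [|p c IH]; first by rewrite rmorph0 mul0r mulr0.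
rewrite rmorphD rmorphM /= horner_algX horner_algC [LHS]mulrDl [RHS]mulrDr mulr_algl mulr_algr.
by rewrite -mulrA casimir_comm !mulrA IH.
Qed.

Lemma casimir_singular i (M : lmodType U) (N : submodClosed M) kappa (m : M) :
  weight_vector kappa m -> E i *: m \in N ->
  casimir i *: m - (kappa i * kappa i + 2 * kappa i)%:A *: m \in N.
Proof.
move=> /weight_vectorP mk mN.
rewrite /casimir [in X in X - _]scalerDl [in X in X + _ - _]scalerDl.
rewrite -[(H i * H i) *: m]scalerA mk kscaleC mk kscaleA.
rewrite (kscale_alg 4) (kscale_alg 2) mk kscaleA -[X in X - _]addrA -scalerDl -scalerDl addrK
  -[(F i * E i) *: m]scalerA.
by apply: rpredZ; apply: rpredZ.
Qed.

(** On a vector killed by e_i modulo N, a polynomial in the Casimir element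
    acts modulo N as its value at the eigenvalue computed from the weight. *)
Lemma casimir_poly_singular i p (M : lmodType U) (N : submodClosed M) kappa (m : M) :
  weight_vector kappa m -> E i *: m \in N ->
  horner_alg (casimir i) p *: m - (p.[kappa i * kappa i + 2 * kappa i])%:A *: m \in N.
Proof.
move=> mk mN; have cN := casimir_singular mk mN.
set c := kappa i * kappa i + 2 * kappa i in cN *.
elim/poly_ind: p => [|p d IH]; first by rewrite rmorph0 horner0 !scale0r subr0 rpred0.
rewrite rmorphD rmorphM /= horner_algX horner_algC hornerMXaddC scalerDl scalerDl.
rewrite [in X in _ - X]scalerDl opprD addrACA subrr addr0 -scalerA.
have -> : (horner_alg (casimir i) p *: (casimir i *: m) - (p.[c] * c)%:A *: m) =
    horner_alg (casimir i) p *: (casimir i *: m - c%:A *: m)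
    + c%:A *: (horner_alg (casimir i) p *: m - p.[c]%:A *: m).
  rewrite !scalerBr kscaleC kscaleA [c * _]mulrC addrA.
  by rewrite subrK.
by rewrite rpredD ?rpredZ.
Qed.

End Casimir.

(** * Casimir elements on a Verma module *)

(** A finite list of indices, large enough to hold all those of bounded
    weight. *)
Definition box (B : nat) : seq idx :=
  undup [seq (x, l) | x <- [seq (y, c) | y <- [seq (a, b) | a <- iota 0 B, b <- iota 0 B],
                                         c <- iota 0 B], l <- words].

Lemma box_uniq B : uniq (box B). Proof. exact: undup_uniq. Qed.

Lemma box_words B : all (fun j : idx => j.2 \in words) (box B).
Proof.
by apply/allP => j; rewrite mem_undup => /allpairsP[[x l] [_ lw ->]].
Qed.

Lemma mem_box B (j : idx) : j.2 \in words -> (j.1.1.1 < B)%N -> (j.1.1.2 < B)%N ->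
  (j.1.2 < B)%N -> j \in box B.
Proof.
case: j => [[[a b] c] l] /= lw aB bB cB; rewrite mem_undup.
by rewrite !allpairs_f ?mem_iota.
Qed.

Section FiniteLength.
Variables (K : numFieldType) (zeta : K) (lambda : weight K).
Local Notation U := (uenv (D21 zeta)).
Local Notation M := (Verma zeta lambda).
Local Notation X := (X zeta).
Local Notation Xw := (Xw zeta).
Local Notation mu := (lambda - rho K).
Local Notation hwv := (hwv zeta lambda).
Local Notation pmon := (pmon zeta lambda).
Local Notation pcoord := (@pcoord K zeta lambda).
Local Notation wt := (idx_weight lambda).
Local Notation cas i p := (horner_alg (casimir zeta i) p).

(** The at most four odd factors contribute at most 4 to each weight
    coordinate, and an even exponent contributes twice itself. *)
Lemma mem_box_wt B (j : idx) : j.2 \in words -> (forall i, `|idx_wt j i| <= B%:Z) ->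
  j \in box (B + 5).
Proof.
move=> jw jB; have := words_size jw.
have := jB Delta; have := jB Eps1; have := jB Eps2.
rewrite idx_wt_delta idx_wt_eps1 idx_wt_eps2.
have := sign_sum_bound Eps1 j.2; have := sign_sum_bound Eps2 j.2.
by move=> *; apply: mem_box => //; lia.
Qed.

(** Weight spaces are finite-dimensional: the weight fixes the three integers
    that bound the exponents. *)
Lemma weight_box kappa (m : M) : weight_vector kappa m ->
  exists B, forall m' : M, weight_vector kappa m' -> forall j, pcoord j m' != 0 -> j \in box B.
Proof.
move=> _; have [[m' [j [mk mj]]]|no] := pselect (exists (m' : M) j, weight_vector kappa m' /\
  pcoord j m' != 0).
  exists (`|idx_wt j Delta| + `|idx_wt j Eps1| + `|idx_wt j Eps2| + 5)%N => m2 m2k j2 m2j.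
  apply: mem_box_wt => [|i]; first exact: pcoord_supp m2j.
  have -> : idx_wt j2 i = idx_wt j i.
    by apply: (idx_weight_inj (lambda := lambda)); rewrite -(pcoord_weight m2k m2j)
      -(pcoord_weight mk mj).
  by case: i; lia.
by exists 0%N => m' mk j mj; case: no; exists m', j.
Qed.

Lemma casimir_weight i kappa (m : M) : weight_vector kappa m ->
  weight_vector kappa (casimir zeta i *: m).
Proof.
move=> mk; have kl := weight_vector_lin M kappa.
have := weight_vector_X (inl (i, SF)) (weight_vector_X (inl (i, SE)) mk).
have -> : kappa + basis_weight K (inl (i, SE)) + basis_weight K (inl (i, SF)) = kappa.
  apply/ffunP => j; rewrite !ffunE /= -addrA -intrD.
  by case: eqP => _; rewrite ?addr0 // addrN addr0.
move=> mfe; rewrite /casimir [_ *: m]scalerDl [X in X + _]scalerDl.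
move/weight_vectorP: (mk) => mk'.
apply: (ksubD kl); first apply: (ksubD kl).
- by rewrite kscale_alg -[(_ * _) *: m]scalerA; apply: (ksubZ _ kl).
- rewrite -[(_ * _) *: m]scalerA !mk' kscaleC mk'.
  by apply: (ksubZ _ kl); apply: (ksubZ _ kl).
- rewrite kscale_alg mk'.
  by apply: (ksubZ _ kl); apply: (ksubZ _ kl).
Qed.

(** The powers of the Casimir element applied to [m] stay in one
    finite-dimensional weight space, so they are linearly dependent. *)
Lemma weight_killed i kappa (m : M) : weight_vector kappa m ->
  exists2 p : {poly K}, p != 0 & cas i p *: m = 0.
Proof.
move=> mk; have [B mB] := weight_box mk.
pose n := size (box B); pose v k := (casimir zeta i) ^+ k *: m.
have vk k : weight_vector kappa (v k).
  elim: k => [|k IH]; first by rewrite /v expr0 scale1r.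
  by rewrite /v expX_act; apply: casimir_weight.
pose A := \matrix_(k < n.+1, s < n) pcoord (nth idx0 (box B) s) (v k).
have /rowV0Pn[c cA c0] : kermx A != 0.
  rewrite kermx_eq0 /row_free; apply: contraTneq (rank_leq_col A) => ->.
  by rewrite -ltnNge.
have {}cA : c *m A = 0 by apply/eqP; rewrite -sub_kermx.
pose p : {poly K} := \poly_(k < n.+1) c 0 (inord k).
exists p.
  have /rV0Pn[k ck] := c0; apply: contraNneq ck => p0.
  by have := coef_poly n.+1 (fun k => c 0 (inord k)) k; rewrite -/p p0 coef0 ltn_ord inord_val
    => <-.
have pE : cas i p *: m = \sum_(k < n.+1) (c 0 k)%:A *: v k.
  rewrite /p poly_def linear_sum scaler_suml; apply: eq_bigr => k _.
  by rewrite linearZ /= rmorphXn /= horner_algX -scalerA inord_val.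
have pk : weight_vector kappa (cas i p *: m).
  by rewrite pE; apply: (ksub_sum (weight_vector_lin _ _)) => k _; apply: (ksubZ _
    (weight_vector_lin _ _)).
apply: pcoord_inj => j; apply/eqP; apply: contraTT isT => cj.
have jB := mB _ pk j cj; have js : (index j (box B) < n)%N by rewrite index_mem.
have := congr1 (fun A : 'rV_n => A 0 (Ordinal js)) cA; rewrite !mxE => E.
move: cj; rewrite pE /pcoord raddf_sum /= => /eqP[].
rewrite -[RHS]E; apply: eq_bigr => k _.
by rewrite -/(pcoord j _) /pcoord coef_scale mxE /= nth_index.
Qed.

Lemma casimir_poly_comm i p q (m : M) :
  cas i (p * q) *: m = cas i p *: (cas i q *: m).
Proof. by rewrite rmorphM scalerA. Qed.

(** One polynomial for the finitely many x_l v, by taking a product. *)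
Lemma words_killed i : exists2 p : {poly K}, p != 0 &
  forall l, l \in words -> cas i p *: (Xw l *: hwv) = 0.
Proof.
elim: words => [|l ls [p p0 IH]]; first by exists 1; rewrite ?oner_neq0.
have [q q0 ql] := weight_killed i (weight_vector_Xw l (@hwv_weight K zeta lambda)).
exists (p * q); first by rewrite mulf_neq0.
move=> l'; rewrite inE => /predU1P[->|l'l]; first by rewrite casimir_poly_comm ql scaler0.
by rewrite mulrC casimir_poly_comm IH // scaler0.
Qed.

Lemma kernel_ksub (u : U) : ksub (fun m : M => u *: m = 0).
Proof.
by split=> [|c x y x0 y0]; rewrite ?scaler0 // scalerDr kscaleC x0 y0 scaler0 addr0.
Qed.

(** Since the Casimir element commutes with F, f1 and f2, the vectors killed
    by [p] of it form a subspace stable under these three. The induction over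
    the module keeps arbitrary products of odd vectors in front: such a
    product applied to v lies in the span of the F^a x_l v, while F, f1 and
    f2 pass to the front of the product up to replacing one of its letters. *)
Lemma casimir_killed i : exists2 p : {poly K}, p != 0 & forall m : M, cas i p *: m = 0.
Proof.
have [p p0 pw] := words_killed i; exists p => // m.
have kk := kernel_ksub (cas i p).
have ker_f j (x : M) : cas i p *: x = 0 -> cas i p *: (X (inl (j, SF)) *: x) = 0.
  by move=> x0; rewrite X_casimir_poly x0 scaler0.
have os (s : seq letter) : odd_span letters hwv (Xw s *: hwv).
  elim: s => [|u s IH].
    by apply: kspan_gen; exists 0%N, [::]; rewrite expr0 scale1r.
  by rewrite Xw_cons; apply: odd_span_act => //; case: u => [[] []].
suff : forall s, cas i p *: (Xw s *: m) = 0 by move=> /(_ [::]); rewrite Xw_nil.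
apply: (neg_gen (P := fun m => forall s, cas i p *: (Xw s *: m) = 0)).
- split=> [s|c x y xs ys s]; first by rewrite !scaler0.
  by rewrite scalerDr kscaleC; apply: (proj2 kk).
- move=> s; apply: (os s _ kk) => _ [a [l [lw ->]]].
  elim: a => [|a IH]; first by rewrite expr0 scale1r pw.
  by rewrite expX_act; apply: ker_f.
move=> b x bn xs s.
have odd u : forall s, cas i p *: (Xw s *: (X (odd_neg u) *: x)) = 0.
  move=> t; have := xs (rcons t u).
  by rewrite /Xw -cats1 big_cat big_seq1 /= -[(_ * _) *: x]scalerA.
have even j : forall s, cas i p *: (Xw s *: (X (inl (j, SF)) *: x)) = 0.
  move=> {}s; suff gen t t' : cas i p *: (Xw t *: (X (inl (j, SF)) *: (Xw t' *: x))) = 0.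
    by have := gen s [::]; rewrite Xw_nil.
  elim/last_ind: t t' => [|t u IH] t'; first by rewrite Xw_nil; apply: ker_f.
  have XwR (y : M) : Xw (rcons t u) *: y = Xw t *: (X (odd_neg u) *: y).
    by rewrite /Xw -cats1 big_cat big_seq1 /= scalerA.
  have [c [u' E]] := even_odd_act j u (Xw t' *: x).
  have E' : X (odd_neg u) *: (X (inl (j, SF)) *: (Xw t' *: x)) =
      (- c)%:A *: (X (odd_neg u') *: (Xw t' *: x)) +
       X (inl (j, SF)) *: (X (odd_neg u) *: (Xw t' *: x)).
    by rewrite E scaleNr scaleNr addrCA addNr addr0.
  rewrite XwR E' -!Xw_cons scalerDr kscaleC.
  apply: (proj2 kk); last exact: IH.
  by have := xs (t ++ u' :: t'); rewrite /Xw big_cat /= -scalerA.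
move: bn; rewrite mem_cat => /orP[|/mapP[u _ ->]]; last exact: odd.
by rewrite !inE => /or3P[]/eqP->; apply: even.
Qed.

End FiniteLength.

(** * Finite length of Verma modules *)

(** A linearly closed predicate on a finite-dimensional space is a subspace:
    take one of maximal dimension inside it. *)
Lemma vspace_of_pred (K : fieldType) (V : vectType K) (P : V -> Prop) :
    P 0 -> (forall c x y, P x -> P y -> P (c *: x + y)) ->
  exists W : {vspace V}, forall x, x \in W <-> P x.
Proof.
move=> P0 Pl.
pose good n := `[< exists2 W : {vspace V}, \dim W = n & forall x, x \in W -> P x >].
have g0 : exists n, good n.
  exists 0%N; apply/asboolP; exists 0%VS; first exact: dimv0.
  by move=> x; rewrite memv0 => /eqP->.
have gb n : good n -> (n <= \dim (fullv : {vspace V}))%N.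
  by move=> /asboolP[W <- _]; apply/dimvS/subvf.
case: (ex_maxnP g0 gb) => n /asboolP[W Wn WP] nmax.
exists W => x; split=> [/WP//|Px].
have /nmax : good (\dim (W + <[x]>)%VS).
  apply/asboolP; exists (W + <[x]>)%VS => // y /memv_addP[w wW [z /vlineP[c ->] ->]].
  by rewrite addrC; apply: Pl => //; apply: WP.
rewrite -Wn => dW; have /eqP WE : W == (W + <[x]>)%VS by rewrite eqEdim addvSl.
by rewrite WE; apply: subvP (addvSr _ _) _ (memv_line x).
Qed.

Section Rank.
Variables (K : numFieldType) (zeta : K) (lambda : weight K).
Local Notation U := (uenv (D21 zeta)).
Local Notation M := (Verma zeta lambda).
Local Notation X := (X zeta).
Local Notation mu := (lambda - rho K).
Local Notation pmon := (pmon zeta lambda).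
Local Notation pcoord := (@pcoord K zeta lambda).
Local Notation wt := (idx_weight lambda).
Local Notation cas i p := (horner_alg (casimir zeta i) p).
Implicit Types N P : submodClosed M.

Lemma supported (m : M) : m != 0 -> exists j, pcoord j m != 0.
Proof.
move=> m0; apply: contrapT => no; case/eqP: m0; apply: pcoord_inj => j.
by apply: contrapT => /eqP cj; apply: no; exists j.
Qed.

Lemma weight_in_diff N P : (exists2 x, x \in P & x \notin N) ->
  exists kappa p, [/\ weight_vector kappa p, p \in P & p \notin N].
Proof.
move=> [x xP xN]; have [r [p [ru pw xE]]] := weight_decomp x.
have pP kappa : kappa \in r -> p kappa \in P.
  by apply: weight_sep ru _ _ _ => //; rewrite -xE.
have [[kappa kr kN]|no] := pselect (exists2 kappa, kappa \in r & p kappa \notin N).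
  by exists kappa, (p kappa); split=> //; apply: pP.
case/negP: xN; rewrite xE big_seq; apply: rpred_sum => kappa kr.
by apply: contrapT => /negP kN; apply: no; exists kappa.
Qed.

(** Each of the three e_i lowers the depth by 2, and it is bounded below
    because even exponents only increase it while a word is one of sixteen;
    the constant, with some room to spare, makes the bound 0. *)
Definition depth (j : idx) : int :=
  8%:Z - (idx_wt j Delta + idx_wt j Eps1 + idx_wt j Eps2).

Lemma depth_ge0 j : j.2 \in words -> 0 <= depth j.
Proof.
move=> /words_size; rewrite /depth idx_wt_delta idx_wt_eps1 idx_wt_eps2.
have := sign_sum_bound Eps1 j.2; have := sign_sum_bound Eps2 j.2.
move: (sign_sum Eps1 j.2) (sign_sum Eps2 j.2) (size j.2) => s1 s2 k.
by rewrite !ler_norml => /andP[? ?] /andP[? ?] ?; lia.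
Qed.

(** A weight vector outside N that some e_i does not send to N is replaced by
    its image, which has smaller depth. *)
Lemma approx_singular N P : (exists2 x, x \in P & x \notin N) ->
  exists kappa p, [/\ weight_vector kappa p, p \in P, p \notin N
    & forall i, X (inl (i, SE)) *: p \in N].
Proof.
move=> /weight_in_diff[kappa [p [pw pP pN]]].
have [j pj] : exists j, pcoord j p != 0.
  by apply: supported; apply: contraNneq pN => ->; rewrite rpred0.
have [n] := ubnP `|depth j|%N; elim: n kappa p j pw pP pN pj => // n IH kappa p j pw pP pN pj jn.
have [[i iN]|no] := pselect (exists i, X (inl (i, SE)) *: p \notin N); last first.
  exists kappa, p; split=> // i; apply: contrapT => /negP iN; apply: no; by exists i.
have ew := weight_vector_X (inl (i, SE)) pw.
have [j' pj'] : exists j, pcoord j (X (inl (i, SE)) *: p) != 0.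
  by apply: supported; apply: contraNneq iN => ->; rewrite rpred0.
apply: (IH _ _ j' ew _ iN pj'); first exact: rpredZ.
have E k : idx_wt j' k = idx_wt j k + basis_wt (inl (i, SE)) k.
  have := congr1 (fun w : weight K => w k) (pcoord_weight ew pj').
  rewrite (pcoord_weight pw pj) idx_weightE ffunE idx_weightE [basis_weight _ _ _]ffunE.
  by rewrite -addrA -intrD => /addrI/eqP; rewrite eqr_int => /eqP.
have := depth_ge0 (pcoord_supp pj); have := depth_ge0 (pcoord_supp pj').
have : depth j' = depth j - 2%:Z.
  by rewrite /depth !E; case: (i) => /=; lia.
move: jn; lia.
Qed.

(** The weight kappa of the vector found above satisfies q(kappa_i (kappa_i +
    2)) = 0 for a polynomial q that does not depend on N and P; as kappa_i
    differs from the highest weight by an integer, it takes finitely many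
    values. *)
Lemma singular_box : exists B, forall N P, (exists2 x, x \in P & x \notin N) ->
  exists p, [/\ p \in P, p \notin N & forall j, pcoord j p != 0 -> j \in box B].
Proof.
have bound i : exists B : nat, forall N kappa (p : M), weight_vector kappa p ->
    p \notin N -> X (inl (i, SE)) *: p \in N ->
    forall j, pcoord j p != 0 -> `|idx_wt j i| <= B%:Z.
  have [q q0 qM] := casimir_killed zeta lambda i.
  have q'0 : q \Po ('X * 'X + 2%:P * 'X) != 0.
    rewrite comp_poly_eq0 //; rewrite -mulrDl size_mulX ?size_XaddC //.
    by rewrite -size_poly_eq0 size_XaddC.
  have [B HB] := root_bound (mu i) q'0; exists B => N kappa p pw pN eN j pj.
  apply: HB; rewrite -idx_weightE -(pcoord_weight pw pj) rootE horner_comp !hornerE.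
  have := rpredZ (-1) (casimir_poly_singular q pw eN).
  rewrite qM sub0r scaleN1r opprK => cN.
  apply: contraNT pN => c0.
  have := rpredZ ((q.[kappa i * kappa i + 2 * kappa i])^-1%:A) cN.
  by rewrite kscaleA mulVf ?scale1r ?scale1r.
have [B0 H0] := bound Delta; have [B1 H1] := bound Eps1; have [B2 H2] := bound Eps2.
exists (B0 + B1 + B2 + 5)%N => N P PN.
have [kappa [p [pw pP pN pe]]] := approx_singular PN.
exists p; split=> // j pj; apply: mem_box_wt; first exact: pcoord_supp pj.
have h0 := H0 N kappa p pw pN (pe _) j pj.
have h1 := H1 N kappa p pw pN (pe _) j pj.
have h2 := H2 N kappa p pw pN (pe _) j pj.
by case; lia.
Qed.

(** The dimension of the intersection with the span of the finitely many
    monomials of the box grows strictly: the vector of [singular_box] lies in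
    this span, in P and not in N. *)
Lemma verma_rank : exists d : submodClosed M -> nat, forall N P,
  submod_sub N P -> (exists2 x, x \in P & x \notin N) -> (d N < d P)%N.
Proof.
have [B HB] := singular_box; pose J := box B; pose n := size J.
pose vec (c : 'rV[K]_n) : M := \sum_(s < n) (c 0 s)%:A *: pmon (nth idx0 J s).
have vec_lin c x y : vec (c *: x + y) = c%:A *: vec x + vec y.
  rewrite /vec scaler_sumr -big_split; apply: eq_bigr => s _ /=.
  by rewrite !mxE scalerDl scalerDl kscaleA.
have subN N : exists W : {vspace 'rV[K]_n}, forall c, c \in W <-> vec c \in N.
  apply: vspace_of_pred => [|c x y xN yN].
    by rewrite /vec big1 ?rpred0 // => s _; rewrite mxE !scale0r.
  by rewrite vec_lin rpredD ?rpredZ.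
pose W N := projT1 (cid (subN N)).
have WP N c : c \in W N <-> vec c \in N by exact: (projT2 (cid (subN N)) c).
exists (fun N => \dim (W N)) => N P NP PN.
have [p [pP pN pB]] := HB N P PN.
have sub : (W N <= W P)%VS by apply/subvP => c /WP cN; apply/WP/NP.
rewrite ltn_neqAle dimvS // andbT; apply: contra pN => /eqP dE.
have /eqP WE : W N == W P by rewrite eqEdim sub dE /=.
have pE : vec (\row_s pcoord (nth idx0 J s) p) = p.
  rewrite [RHS](pmon_expand_in (box_uniq B) (box_words B) pB) (big_nth idx0) big_mkord.
  by apply: eq_bigr => s _; rewrite mxE.
by rewrite -pE; apply/WP; rewrite WE; apply/WP; rewrite pE.
Qed.

End Rank.

(** * The theorem *)

Lemma srefl_weight (K : numFieldType) (zeta : K) (lambda : weight K) gamma n :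
  pairing lambda (coroot zeta gamma) = n%:R ->
  srefl zeta gamma lambda - rho K = lambda - rho K - even_root K gamma *+ n.
Proof. by move=> ln; rewrite /srefl ln scaler_nat addrAC. Qed.

Theorem lemma2p4 (R : realType) (zeta : R[i])
    (zeta_neq0 : zeta != 0) (zeta_neqN1 : zeta != -1)
    (lambda : weight R[i]) (gamma : axis) (n : nat)
    (lambda_gamma : pairing lambda (coroot zeta gamma) = n%:R) :
  [/\ exists v : Verma zeta lambda,
        [/\ v != 0, singular_vector v
           & weight_vector (lambda - rho _ - even_root _ gamma *+ n) v],
      exists f : {linear Verma zeta (srefl zeta gamma lambda) -> Verma zeta lambda},
        exists x, f x != 0
    & exists2 m : nat,
        comp_mult (Verma zeta lambda) (Lirr zeta (srefl zeta gamma lambda)) m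
        & (0 < m)%N].
Proof.
have lg : lambda gamma = n%:R by rewrite -lambda_gamma pairing_hvec.
have [v [v0 vX vw]] := exists_singular zeta lg.
have vs := singular_vectorP vw vX.
have vw' : weight_vector (srefl zeta gamma lambda - rho _) v.
  by rewrite (srefl_weight lambda_gamma).
have [f fv] := verma_universal vw' vs.
split; first by exists v.
  by exists f, (hwv zeta (srefl zeta gamma lambda)); rewrite fv.
have [d d_strict] := verma_rank zeta lambda.
(* The kernel of f is proper, as f v is nonzero, so it lies in the largest
   proper submodule. *)
apply: (@comp_mult_image _ _ _ f
  (GRing.SubmodClosed.clone _ _ (@maxsub _ (Verma zeta (srefl zeta gamma lambda))) _)
  _ _ _ d d_strict).
- move=> x fx0; apply/asboolP; exists [:: x]; last by rewrite big_seq1.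
  move=> y; rewrite inE => /eqP->.
  exists (submod_of (preim_prop f (submod_of (zero_prop (Verma zeta lambda))))).
    exists (hwv zeta (srefl zeta gamma lambda)); apply/negP => /submod_ofP/submod_ofP.
    by rewrite fv => /eqP; rewrite (negPf v0).
  by apply/submod_ofP/submod_ofP.
- exact: maxsub_max.
- by exists (hwv zeta (srefl zeta gamma lambda)); exact: hwv_maxsub.
Qed.
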